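(* Let $(S,g_S,\omega_S)$ be a compact CSCK (constant scalar curvature Kähler) Hodge $4$-manifold (real dimension $4$) with non-negative scalar curvature, and let $E$ be a holomorphic line bundle on $S$ such that $c_1(E)=[\omega_S/2\pi]$. Then, in each admissible Kähler class on $M=P(\mathcal O\oplus E)\to S$ there exists at least one admissible Kähler metric conformal to an Einstein–Maxwell metric.
   Context: **Admissible metrics and classes.** Let $K$ be the generator of the $S^1$-action on $M=P(\mathcal O\oplus E)$ by scalar multiplication on $\mathcal O$. For $x\in(0,1)$, an admissible Kähler metric is a Kähler structure on $M$ given, off the zero and infinity sections, by $$g=\frac{1+xz}{x}g_S+\frac{dz^2}{\Theta(z)}+\Theta(z)\theta^2,\qquad\omega=\frac{1+xz}{x}\omega_S+dz\wedge\theta,$$ where $z:M\to[-1,1]$ is the momentum map of $K$, $\theta$ is a connection $1$-form with $\theta(K)=1$, $d\theta=\omega_S$ (induced by the Chern connection of a Hermitian metric on $E$), and $\Theta$ is smooth on $[-1,1]$, positive on $(-1,1)$, with $\Theta(\pm1)=0$, $\Theta'(\pm1)=\mp2$; the complex structure is the horizontal lift of that of $S$ together with $Jdz=\Theta\theta$. The class $\Omega_x=[\omega]$ depends only on $x$ and is called an admissible Kähler class. **Einstein–Maxwell.** A Kähler metric $g$ is conformal to a (conformally Kähler) Einstein–Maxwell metric if there is a positive Killing potential $f$ of $g$ (i.e. $J\,\mathrm{grad}_gf$ is a Killing field) such that $h=f^{-2}g$ has constant scalar curvature. *)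

(* Defs.v *)
From HB Require Import structures.
From mathcomp Require Import all_boot all_order all_algebra.
From mathcomp Require Import all_classical all_reals all_analysis.
From mathcomp Require Import complex.
Set Implicit Arguments.
Unset Strict Implicit.
Unset Printing Implicit Defensive.
Import Order.TTheory GRing.Theory Num.Theory.
Import numFieldNormedType.Exports.
Local Open Scope classical_set_scope.
Local Open Scope ring_scope.

(** * Calculus on open subsets of R^n

    Tangent vectors are row vectors, 1-forms are column vectors, and a
    covariant 2-tensor G is the matrix with G(v, w) = v *m G *m w^T. *)

Definition partial (R : realType) n (i : 'I_n) (f : 'rV[R]_n -> R) :
  'rV[R]_n -> R := fun x => 'D_(delta_mx 0 i) f x.

(** C^oo on the open set U. *)
Definition smooth_on (R : realType) n (U : set 'rV[R]_n) (f : 'rV[R]_n -> R) :=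
  forall (s : seq 'I_n) x, U x -> differentiable (foldr (@partial R n) f s) x.

Definition grad (R : realType) n (f : 'rV[R]_n -> R) (x : 'rV[R]_n) :
  'cV[R]_n := \col_i partial i f x.

(** Exterior derivative of a 1-form. *)
Definition extd (R : realType) n (beta : 'rV[R]_n -> 'cV[R]_n) (x : 'rV[R]_n) :
  'M[R]_n :=
  \matrix_(i, j) (partial i (fun y => beta y j 0) x
                  - partial j (fun y => beta y i 0) x).

Definition closed_form2 (R : realType) n (U : set 'rV[R]_n)
    (w : 'rV[R]_n -> 'M[R]_n) :=
  forall x i j k, U x ->
    partial i (fun y => w y j k) x + partial j (fun y => w y k i) x
    + partial k (fun y => w y i j) x = 0.

Section Curvature.
Context (R : realType) (n : nat) (G : 'rV[R]_n -> 'M[R]_n).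

(** [christoffel k i j] is Gamma^k_{ij}. *)
Definition christoffel (k i j : 'I_n) (x : 'rV[R]_n) : R :=
  2^-1 * \sum_l invmx (G x) k l *
    (partial i (fun y => G y j l) x + partial j (fun y => G y i l) x
     - partial l (fun y => G y i j) x).

Definition ricci (j k : 'I_n) (x : 'rV[R]_n) : R :=
  \sum_i (partial i (christoffel i j k) x - partial j (christoffel i i k) x)
  + \sum_i \sum_l (christoffel i i l x * christoffel l j k x
                   - christoffel i j l x * christoffel l i k x).

Definition scal (x : 'rV[R]_n) : R :=
  \sum_j \sum_k invmx (G x) j k * ricci j k x.

(** L_X G = 0 at x. *)
Definition killing_at (X : 'rV[R]_n -> 'rV[R]_n) (x : 'rV[R]_n) :=
  forall i j, \sum_k (X x 0 k * partial k (fun y => G y i j) x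
                      + partial i (fun y => X y 0 k) x * G x k j
                      + partial j (fun y => X y 0 k) x * G x i k) = 0.
End Curvature.

(** * Complex calculus

    C^m is R^(m+m), the point z being row_mx (Re z) (Im z). *)

(** Multiplication by the imaginary unit, v |-> v *m Jmx. *)
Definition Jmx (R : realType) m : 'M[R]_(m + m) :=
  block_mx 0 1%:M (- 1%:M) 0.

Definition holomorphic_on (R : realType) m k (U : set 'rV[R]_(m + m))
    (F : 'rV[R]_(m + m) -> 'rV[R]_(k + k)) :=
  (forall j, smooth_on U (fun x => F x 0 j)) /\
  (forall x, U x -> Jmx R m *m jacobian F x = jacobian F x *m Jmx R k).

(** d^c u = - du o J = i (dbar u - d u), so that d d^c = 2 i d dbar and, for
    the (1,0)-part of du, Im (d u) = d^c u / 2. *)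
Definition dc (R : realType) m (u : 'rV[R]_(m + m) -> R) (x : 'rV[R]_(m + m)) :
  'cV[R]_(m + m) := - (Jmx R m *m grad u x).

Definition cplx_row (R : realType) (w : R[i]) : 'rV[R]_(1 + 1) :=
  row_mx (complex.Re w)%:M (complex.Im w)%:M.

(** (x, w) in C^m x C, as a point of C^(m+1). *)
Definition cplx_join (R : realType) m (x : 'rV[R]_(m + m)) (w : R[i]) :
  'rV[R]_((m + 1) + (m + 1)) :=
  row_mx (row_mx (lsubmx x) (complex.Re w)%:M)
         (row_mx (rsubmx x) (complex.Im w)%:M).

Definition normsq (R : realType) (w : R[i]) : R :=
  complex.Re w ^+ 2 + complex.Im w ^+ 2.

(** * Complex manifolds *)

(** phi restricts to a homeomorphism from the open set D onto an open subset
    of R^n, with inverse psi. *)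
Definition homeo_chart (R : realType) n (T : topologicalType) (D : set T)
    (phi : T -> 'rV[R]_n) (psi : 'rV[R]_n -> T) :=
  [/\ open D, open (phi @` D), (forall p, D p -> psi (phi p) = p),
      (forall p, D p -> {for p, continuous phi}) &
      (forall x, (phi @` D) x -> {for x, continuous psi})].

Record cmanifold (R : realType) (m : nat) := CManifold {
  points :> topologicalType;
  chart : Type;
  dom : chart -> set points;
  coord : chart -> points -> 'rV[R]_(m + m);
  param : chart -> 'rV[R]_(m + m) -> points;
  cm_hausdorff : hausdorff_space points;
  cm_second_countable : @second_countable points;
  cm_cover : forall p, exists a, dom a p;
  cm_chart : forall a, homeo_chart (dom a) (coord a) (param a);
  cm_transition : forall a b,
    holomorphic_on (coord a @` (dom a `&` dom b)) (coord b \o param a)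
}.

Section OnManifold.
Context (R : realType) (m : nat) (X : cmanifold R m).
Implicit Types (a b : chart X).

Definition cdom a : set 'rV[R]_(m + m) := coord a @` dom a.

(** A (not necessarily listed) holomorphic chart of X. *)
Definition holomorphic_chart (D : set X) (phi : X -> 'rV[R]_(m + m))
    (psi : 'rV[R]_(m + m) -> X) :=
  homeo_chart D phi psi /\
  forall a, holomorphic_on (phi @` (D `&` dom a)) (coord a \o psi) /\
            holomorphic_on (coord a @` (D `&` dom a)) (phi \o param a).

Definition smooth_fun_on (D : set X) (u : X -> R) :=
  forall a, smooth_on (coord a @` (dom a `&` D)) (u \o param a).

Definition holomorphic_fun_on (D : set X) (w : X -> R[i]) :=
  forall a, holomorphic_on (coord a @` (dom a `&` D))
              (fun x => cplx_row (w (param a x))).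

(** Tensor fields are given by their components in every chart; only the
    values on [cdom a] are meaningful. *)
Definition form1 := chart X -> 'rV[R]_(m + m) -> 'cV[R]_(m + m).
Definition tensor2 := chart X -> 'rV[R]_(m + m) -> 'M[R]_(m + m).

Definition smooth_form1 (beta : form1) :=
  (forall a i, smooth_on (cdom a) (fun x => beta a x i 0)) /\
  (forall a b p, dom a p -> dom b p ->
     beta a (coord a p) =
       jacobian (coord b \o param a) (coord a p) *m beta b (coord b p)).

Definition smooth_tensor2 (T : tensor2) :=
  (forall a i j, smooth_on (cdom a) (fun x => T a x i j)) /\
  (forall a b p, dom a p -> dom b p ->
     T a (coord a p) =
       jacobian (coord b \o param a) (coord a p) *m T b (coord b p)
         *m (jacobian (coord b \o param a) (coord a p))^T).

Definition closed2form (w : tensor2) :=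
  [/\ smooth_tensor2 w,
      (forall a x, cdom a x -> (w a x)^T = - w a x) &
      (forall a, closed_form2 (cdom a) (w a))].

Definition cohomologous (w w' : tensor2) :=
  exists beta : form1, smooth_form1 beta /\
    forall a x, cdom a x -> w' a x - w a x = extd (beta a) x.

Definition derham_class (w : tensor2) : set tensor2 :=
  [set w' | closed2form w' /\ cohomologous w w'].

(** The 2-form omega = g(J., .). *)
Definition kform (g : tensor2) : tensor2 := fun a x => Jmx R m *m g a x.

Definition kahler (g : tensor2) :=
  [/\ smooth_tensor2 g,
      (forall a x, cdom a x -> (g a x)^T = g a x),
      (forall a x (v : 'rV[R]_(m + m)), cdom a x -> v != 0 ->
         0 < (v *m g a x *m v^T) 0 0),
      (forall a x, cdom a x -> Jmx R m *m g a x *m (Jmx R m)^T = g a x) &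
      closed2form (kform g)].

Definition const_scal (g : tensor2) (c : R) :=
  forall a x, cdom a x -> scal (g a) x = c.

(** J grad_g f, in the chart a. *)
Definition Jgrad (g : tensor2) (f : X -> R) a (x : 'rV[R]_(m + m)) :
  'rV[R]_(m + m) :=
  (grad (f \o param a) x)^T *m invmx (g a x) *m Jmx R m.

Definition killing_potential (g : tensor2) (f : X -> R) :=
  smooth_fun_on setT f /\
  forall a x, cdom a x -> killing_at (g a) (Jgrad g f a) x.

Definition conformally_Einstein_Maxwell (g : tensor2) :=
  exists f : X -> R,
    [/\ killing_potential g f, (forall p, 0 < f p) &
        exists c, const_scal (fun a x => (f (param a x)) ^- 2 *: g a x) c].

(** * Holomorphic line bundles

    A line bundle is given by nowhere zero local holomorphic frames s_i over
    the members of an open cover, with s_j = g_ij s_i; equivalently the fibre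
    coordinates satisfy v_i = g_ij v_j. *)
Record line_bundle := LineBundle {
  frame : Type;
  fdom : frame -> set X;
  trans : frame -> frame -> X -> R[i];
  lb_open : forall i, open (fdom i);
  lb_cover : forall p, exists i, fdom i p;
  lb_holomorphic : forall i j,
    holomorphic_fun_on (fdom i `&` fdom j) (trans i j);
  lb_neq0 : forall i j p, fdom i p -> fdom j p -> trans i j p != 0;
  lb_cocycle : forall i j k p, fdom i p -> fdom j p -> fdom k p ->
    trans i j p * trans j k p = trans i k p
}.

(** [H i] is the squared length of the frame s_i. *)
Definition hermitian_metric (E : line_bundle) (H : frame E -> X -> R) :=
  [/\ (forall i, smooth_fun_on (fdom i) (H i)),
      (forall i p, fdom i p -> 0 < H i p) &
      (forall i j p, fdom i p -> fdom j p ->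
         H j p = normsq (trans i j p) * H i p)].

(** The Chern connection form in the frame s_i is A = (d log H_i)^(1,0), with
    curvature F = dA purely imaginary; so Im A = d^c log H_i / 2 and the Chern
    form i F / 2pi is - d (Im A) / 2pi. *)
Definition chern_form (E : line_bundle) (H : frame E -> X -> R) (F : tensor2) :=
  forall a i p, dom a p -> fdom i p ->
    F a (coord a p) = - (2 * pi)^-1 *:
      extd (fun x => 2^-1 *: dc (fun y => ln (H i (param a y))) x) (coord a p).

(** c_1(E) = [w] in real de Rham cohomology (Chern-Weil). *)
Definition first_chern_class_is (E : line_bundle) (w : tensor2) :=
  exists (H : frame E -> X -> R) (F : tensor2),
    [/\ hermitian_metric H, chern_form H F, closed2form F & derham_class F w].

End OnManifold.

(** * The ruled manifold P(O + E) and its admissible metrics *)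

(** A complex manifold over S identified with P(O + E).  A point over p is a
    line [u : v], with v expressed in the frame s_i of E; [fib i true] is the
    affine coordinate v/u, undefined on the infinity section
    [sect true] = {u = 0}, and [fib i false] is u/v, undefined on the zero
    section [sect false] = {v = 0}. *)
Record proj_bundle (R : realType) m (S : cmanifold R m) (E : line_bundle S) :=
ProjBundle {
  total :> cmanifold R (m + 1);
  proj : total -> S;
  sect : bool -> set total;
  fib : frame E -> bool -> total -> R[i];
  pb_disjoint : forall q, ~ (sect true q /\ sect false q);
  pb_chart : forall (a : chart S) i s, exists psi,
    let D := [set q | dom a (proj q) /\ fdom i (proj q)] `\` sect s in
    let phi := fun q => cplx_join (coord a (proj q)) (fib i s q) in
    holomorphic_chart D phi psi /\
    phi @` D = [set y | exists p w,
                  [/\ dom a p, fdom i p & y = cplx_join (coord a p) w]];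
  pb_zero : forall i s q, fdom i (proj q) -> ~ sect s q ->
    (fib i s q = 0 <-> sect (~~ s) q);
  pb_inv : forall i q, fdom i (proj q) -> ~ sect true q -> ~ sect false q ->
    fib i false q = (fib i true q)^-1;
  pb_trans : forall i j q, fdom i (proj q) -> fdom j (proj q) ->
    ~ sect true q -> fib i true q = trans i j (proj q) * fib j true q
}.

Section Admissible.
Context (R : realType) (m : nat) (S : cmanifold R m) (gS : tensor2 S).
Context (E : line_bundle S) (M : proj_bundle E).
Implicit Types (a : chart S) (b : chart M) (i : frame E).

(** Pull-back by the projection of a 2-tensor on S, from the chart a to b. *)
Definition pullback2 a b (T : tensor2 S) (y : 'rV[R]_((m + 1) + (m + 1))) :
  'M[R]_((m + 1) + (m + 1)) :=
  let p := proj (param b y) in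
  let P := jacobian (fun y' => coord a (proj (param b y'))) y in
  P *m T a (coord a p) *m P^T.

(** k is the value at y of K, the generator of [u : v] |-> [e^(it) u : v]:
    it is vertical and the affine coordinate w = v/u satisfies dw(K) = - i w. *)
Definition is_K a b i (y k : 'rV[R]_((m + 1) + (m + 1))) :=
  let w := fun y' => fib i true (param b y') in
  [/\ k *m jacobian (fun y' => coord a (proj (param b y'))) y = 0,
      k *m grad (fun y' => complex.Re (w y')) y = (complex.Im (w y))%:M &
      k *m grad (fun y' => complex.Im (w y')) y = (- complex.Re (w y))%:M].

(** The Chern connection of H is dw/w + A on E minus its zero section, with A
    as in [chern_form]; its imaginary part takes the value -1 on K, and theta
    is the opposite: theta = - Im (dw/w) - Im A. *)
Definition theta_form (H : frame E -> S -> R) b i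
    (y : 'rV[R]_((m + 1) + (m + 1))) : 'cV[R]_((m + 1) + (m + 1)) :=
  let w := fun y' => fib i true (param b y') in
  let re := fun y' => complex.Re (w y') in
  let im := fun y' => complex.Im (w y') in
  - ((normsq (w y))^-1 *: (re y *: grad im y - im y *: grad re y))
  - 2^-1 *: dc (fun y' => ln (H i (proj (param b y')))) y.

(** Smoothness on [-1, 1] is expressed by a smooth extension to R. *)
Definition momentum_profile (Theta : R -> R) :=
  [/\ (forall k t, derivable (derive1n k Theta) t 1),
      (forall t, -1 < t < 1 -> 0 < Theta t),
      Theta (-1) = 0 /\ Theta 1 = 0 &
      derive1 Theta (-1) = 2 /\ derive1 Theta 1 = -2].

Definition admissible (x : R) (g : tensor2 M) :=
  kahler g /\
  exists (H : frame E -> S -> R) (Theta : R -> R) (z : M -> R),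
  [/\ hermitian_metric H, momentum_profile Theta,
      smooth_fun_on setT z, (forall q, -1 <= z q <= 1) &
      forall a b i q, dom b q -> dom a (proj q) -> fdom i (proj q) ->
        ~ sect true q -> ~ sect false q ->
        let y := coord b q in
        let theta := theta_form H b i in
        let dz := grad (z \o param b) y in
        let base := (1 + x * z q) / x in
        [/\ extd theta y = pullback2 a b (kform gS) y,
            - (Jmx R (m + 1) *m dz) = Theta (z q) *: theta y,
            g b y = base *: pullback2 a b gS y
                    + (Theta (z q))^-1 *: (dz *m dz^T)
                    + Theta (z q) *: (theta y *m (theta y)^T),
            kform g b y = base *: pullback2 a b (kform gS) y
                          + (dz *m (theta y)^T - theta y *m dz^T) &
            forall k, is_K a b i y k ->
              k *m kform g b y = - dz^T /\ k *m theta y = 1%:M]].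

(** Omega is the class Omega_x of the admissible metrics with parameter x. *)
Definition admissible_class (x : R) (Omega : set (tensor2 M)) :=
  exists g, admissible x g /\ Omega = derham_class (kform g).

End Admissible.

(* Main.v *)
(* Off the zero and infinity sections an admissible metric is a Calabi ansatz in
   the coframe (pull-back of the base coordinates, dz, theta).  For f = 1 + r z
   and Theta = F / (1 + x z)^2, the scalar curvature of f^-2 g is the constant c
   if and only if
     f^2 F'' - 10 r f F' + 30 r^2 F = f^2 x s (1 + x z) - c (1 + x z)^2,
   where s is the scalar curvature of the base.  With y = (z + r) / (1 + r z) and
   F = f^6 phi(y) this becomes phi'' = m (S - C m), with m a product of two
   positive affine functions and S >= 0 proportional to s.  The boundary
   conditions determine C and leave one equation for r, which changes sign on
   [-1, 1].  Positivity of phi follows from the quasi-concavity of m and S >= 0.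

   To stay in the given class, start from any of its admissible metrics, with
   momentum z0 and profile Theta0, and solve psi' Theta0 = Theta o psi on a
   neighbourhood of [-1, 1].  The metric with momentum z = psi(z0), the same
   connection and the profile Theta has Kaehler form omega0 + d (chi(z0) theta0),
   where theta0 = - J dz0 and chi Theta0 = psi - id, so it is globally defined and
   cohomologous to the given one.  All identities are checked off the two
   sections, whose complement is dense. *)
Require Import Defs.
From HB Require Import structures.
From mathcomp Require Import all_boot all_order all_algebra.
From mathcomp Require Import all_classical all_reals all_analysis.
From mathcomp Require Import complex ring lra.
Set Implicit Arguments.
Unset Strict Implicit.
Unset Printing Implicit Defensive.
Import Order.TTheory GRing.Theory Num.Theory.
Import numFieldNormedType.Exports.
Local Open Scope classical_set_scope.
Local Open Scope ring_scope.
Local Notation coord := Defs.coord.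
Local Notation proj := Defs.proj.

(** * Functions of class C^k *)

(** The substitution F = f^6 phi(y) is dictated by the operator f^2 F'' - 10 r f F' + 30 r^2 F: it
    maps f^k to r^2 (k - 5)(k - 6) f^k and annihilates f^5 times every affine function. Dividing by
    f^6 and taking a quotient y of affine functions as variable therefore leaves phi'' alone; the
    chosen y also fixes -1 and 1. On M the obstacle is that theta and 1 / Theta are singular along
    the two sections. The new metric is therefore not defined by the ansatz but as psi'(z0) g0 +
    lambda(z0) p, where p is the pull-back of gS and lambda is smooth: a combination of global
    tensors, smooth across the sections at once. The ansatz is recovered off the sections. This
    needs psi and chi to be smooth beyond -1 and 1, where the equation for psi is singular. Each
    profile is brought to the normal form 1 - T^2 by a T with T' Theta = 1 - T^2, and psi is the
    inverse of one such T composed with the other; the common end slopes 2 and -2 make this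
    possible. *)

Lemma differentiable_row (R : realType) (V : normedModType R) n
    (f : V -> 'rV[R]_n) (x : V) :
  (forall j, differentiable (fun y => f y 0 j) x) -> differentiable f x.
Proof.
move=> df.
have -> : f = \sum_j (fun y => f y 0 j *: delta_mx 0 j).
  by apply/funext => y; rewrite fct_sumE -row_sum_delta.
by apply: differentiable_sum => j; apply: differentiableZl.
Qed.

Lemma linear_row_continuous (R : realType) n (W : normedModType R)
    (L : {linear 'rV[R]_n -> W}) : continuous L.
Proof.
move=> u; apply: differentiable_continuous.
have -> : (L : _ -> _) = \sum_j (fun v : 'rV[R]_n => v 0 j *: L (delta_mx 0 j)).
  apply/funext => v; rewrite fct_sumE {1}(row_sum_delta v) linear_sum.
  by apply: eq_bigr => j _; rewrite linearZ.
by apply: differentiable_sum => j; apply/differentiableZl/differentiable_coord.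
Qed.

Lemma near_eq_differentiable (R : realType) (V W : normedModType R)
    (f g : V -> W) (x : V) :
  {near x, f =1 g} -> differentiable f x -> differentiable g x.
Proof.
move=> fg df; have fgx := nbhs_singleton fg.
have dfx := diff_locally df.
have dgx : g \o shift x = cst (g x) + 'd f x +o_ 0 id.
  apply/eqaddoP => e e0; move/eqaddoP : dfx => /(_ e e0).
  have : \forall h \near (0 : V), f (h + x) = g (h + x).
    by rewrite (near_shift x) /=; near do rewrite /= sub0r addrNK.
  apply: filterS2 => h fgh.
  by rewrite /= -[(_ \o _ - _) h]/(f (h + x) - (f x + 'd f x h)) fgh fgx.
have cf := diff_continuous df.
by apply/diff_locallyP; rewrite (diff_unique cf dgx).
Unshelve. all: by end_near. Qed.

Section Ck.
Context (R : realType) (V : normedModType R).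
Implicit Types (f g : V -> R) (U : set V).

(** Level [0] already asks for differentiability, so all derivatives up to order [n] are
    differentiable. Directions range over the whole normed space, which lets one notion serve both
    functions on charts and functions of a real variable. *)
Fixpoint Ck n U f : Prop :=
  (forall x, U x -> differentiable f x) /\
  (if n is n'.+1 then forall v, Ck n' U ('D_v f) else True).

Definition Cinf U f := forall n, Ck n U f.

Lemma Ck_diff n U f x : Ck n U f -> U x -> differentiable f x.
Proof. by case: n => [|n] [df _]; apply: df. Qed.

Lemma CkS n U f : Ck n.+1 U f -> Ck n U f.
Proof.
elim: n f => [|n IH] f [df dvf]; first by split.
by split=> // v; apply: IH.
Qed.

Lemma sub_Ck n U U' f : U' `<=` U -> Ck n U f -> Ck n U' f.
Proof.
move=> UU; elim: n f => [|n IH] f [df dvf]; split=> //;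
  try by move=> x /UU/df.
by move=> v; exact: IH (dvf v).
Qed.

Lemma eq_derive_open U f g v x : open U -> {in U, f =1 g} -> U x ->
  'D_v f x = 'D_v g x.
Proof.
move=> oU fg Ux; apply: near_eq_derive.
have : nbhs x U by apply: open_nbhs_nbhs.
by apply: filterS => y Uy; apply: fg; rewrite inE.
Qed.

Lemma eq_differentiable_open U f g x : open U -> {in U, f =1 g} -> U x ->
  differentiable f x -> differentiable g x.
Proof.
move=> oU fg Ux; apply: near_eq_differentiable.
have : nbhs x U by apply: open_nbhs_nbhs.
by apply: filterS => y Uy; apply: fg; rewrite inE.
Qed.

Lemma eq_Ck n U f g : open U -> {in U, f =1 g} -> Ck n U f -> Ck n U g.
Proof.
move=> oU; elim: n f g => [|n IH] f g fg [df dvf]; split=> //;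
  try by move=> x Ux; exact: (eq_differentiable_open oU fg Ux (df _ Ux)).
by move=> v; apply: IH (dvf v) => x; rewrite inE => Ux; apply: eq_derive_open oU fg Ux.
Qed.

Lemma Ck_cst n U (c : R) : Ck n U (cst c).
Proof.
elim: n c => [|n IH] c; split=> // v.
by rewrite (_ : 'D_v _ = cst 0) //; apply/funext => x; rewrite derive_cst.
Qed.

Lemma CkD n U f g : open U -> Ck n U f -> Ck n U g -> Ck n U (fun x => f x + g x).
Proof.
move=> oU; elim: n f g => [|n IH] f g [df dvf] [dg dvg]; split=> //;
  try by move=> x Ux; apply: differentiableD; [apply: df|apply: dg].
move=> v; apply: (eq_Ck oU _ (IH _ _ (dvf v) (dvg v))) => x; rewrite inE => Ux.
by rewrite deriveD //; apply: diff_derivable; [apply: df|apply: dg].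
Qed.

Lemma CkM n U f g : open U -> Ck n U f -> Ck n U g -> Ck n U (fun x => f x * g x).
Proof.
move=> oU; elim: n f g => [|n IH] f g Cf Cg; have [df dvf] := Cf;
    have [dg dvg] := Cg; split=> //;
  try by move=> x Ux; apply: differentiableM; [apply: df|apply: dg].
move=> v; have fD := IH _ _ (CkS Cf) (dvg v); have gD := IH _ _ (CkS Cg) (dvf v).
apply: (eq_Ck oU _ (CkD oU fD gD)) => x; rewrite inE => Ux.
by rewrite deriveM //; apply: diff_derivable; [apply: df|apply: dg].
Qed.

Lemma CkN n U f : open U -> Ck n U f -> Ck n U (fun x => - f x).
Proof.
move=> oU Cf; apply: (eq_Ck oU _ (CkM oU (@Ck_cst n U (-1)) Cf)) => x _.
by rewrite /cst mulN1r.
Qed.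

Lemma CkB n U f g : open U -> Ck n U f -> Ck n U g -> Ck n U (fun x => f x - g x).
Proof. by move=> oU Cf Cg; apply/CkD/CkN. Qed.

Lemma Ck_sum n U (I : Type) (s : seq I) (P : pred I) (F : I -> V -> R) : open U ->
  (forall i, P i -> Ck n U (F i)) -> Ck n U (fun x => \sum_(i <- s | P i) F i x).
Proof.
move=> oU CF; elim: s => [|i s IH].
  by apply: (eq_Ck oU _ (@Ck_cst n U 0)) => x _; rewrite big_nil.
case Pi : (P i); last first.
  by apply: (eq_Ck oU _ IH) => x _; rewrite big_cons Pi.
by apply: (eq_Ck oU _ (CkD oU (CF _ Pi) IH)) => x _; rewrite big_cons Pi.
Qed.

Lemma Ck_prod n U (I : Type) (s : seq I) (P : pred I) (F : I -> V -> R) : open U ->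
  (forall i, P i -> Ck n U (F i)) -> Ck n U (fun x => \prod_(i <- s | P i) F i x).
Proof.
move=> oU CF; elim: s => [|i s IH].
  by apply: (eq_Ck oU _ (@Ck_cst n U 1)) => x _; rewrite big_nil.
case Pi : (P i); last first.
  by apply: (eq_Ck oU _ IH) => x _; rewrite big_cons Pi.
by apply: (eq_Ck oU _ (CkM oU (CF _ Pi) IH)) => x _; rewrite big_cons Pi.
Qed.

Lemma CkX n U f k : open U -> Ck n U f -> Ck n U (fun x => f x ^+ k).
Proof.
move=> oU Cf; elim: k => [|k IH].
  by apply: (eq_Ck oU _ (@Ck_cst n U 1)) => x _; rewrite expr0.
by apply: (eq_Ck oU _ (CkM oU Cf IH)) => x _; rewrite exprS.
Qed.

Lemma CkV n U f : open U -> (forall x, U x -> f x != 0) -> Ck n U f ->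
  Ck n U (fun x => (f x)^-1).
Proof.
move=> oU f0; elim: n => [|n IH] Cf; have [df dvf] := Cf; split=> //;
  try by move=> x Ux; apply: differentiableV; [apply: df|apply: f0].
move=> v; have Cfi := IH (CkS Cf).
apply: (eq_Ck oU _ (CkN oU (CkM oU (CkX 2 oU Cfi) (dvf v)))) => x; rewrite inE => Ux.
by rewrite deriveV ?f0 //; [rewrite exprVn scaleNr|apply/diff_derivable/df].
Qed.

End Ck.

Lemma derive_comp1 (R : realType) (V : normedModType R) (F : R -> R) (f : V -> R)
    (x v : V) : differentiable f x -> differentiable F (f x) ->
  'D_v (F \o f) x = 'D_1 F (f x) * 'D_v f x.
Proof.
move=> df dF; rewrite deriveE; last exact: differentiable_comp.
rewrite diff_comp //= deriveE // deriveE // -[X in 'd F _ X = _]mulr1.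
by rewrite [LHS]linearZ mulrC.
Qed.

Lemma Ck_comp1 (R : realType) (V : normedModType R) n (U : set V) (W : set R)
    (F : R -> R) (f : V -> R) : open U -> (forall x, U x -> W (f x)) ->
  Ck n W F -> Ck n U f -> Ck n U (F \o f).
Proof.
move=> oU UW; elim: n F f UW => [|n IH] F f UW CF Cf; have [dF dvF] := CF;
    have [df dvf] := Cf; split=> //;
  try by move=> x Ux; apply: differentiable_comp; [apply: df|apply/dF/UW].
move=> v; apply: (eq_Ck oU _ (CkM oU (IH _ _ UW (dvF 1) (CkS Cf)) (dvf v))) => x.
by rewrite inE => Ux; rewrite derive_comp1 //; [apply: df|apply/dF/UW].
Qed.

Lemma derive_partial (R : realType) n (f : 'rV[R]_n -> R) (x v : 'rV[R]_n) :
  differentiable f x -> 'D_v f x = \sum_i v 0 i * partial i f x.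
Proof.
move=> df; rewrite deriveE // {1}(row_sum_delta v) linear_sum.
by apply: eq_bigr => i _; rewrite linearZ /partial deriveE.
Qed.

Lemma derive_comp_row (R : realType) (V : normedModType R) n (F : 'rV[R]_n -> R)
    (f : V -> 'rV[R]_n) (x v : V) : (forall j, differentiable (fun y => f y 0 j) x) ->
    differentiable F (f x) ->
  'D_v (F \o f) x = \sum_j 'D_v (fun y => f y 0 j) x * partial j F (f x).
Proof.
move=> df dF; have dfx := differentiable_row df.
rewrite deriveE; last exact: differentiable_comp.
rewrite diff_comp //= -deriveE // derive_partial //; apply: eq_bigr => j _.
rewrite -deriveE // derive_mx ?mxE //; exact: diff_derivable.
Qed.

Lemma Ck_comp_row (R : realType) (V : normedModType R) n k (U : set V)
    (W : set 'rV[R]_k) (F : 'rV[R]_k -> R) (f : V -> 'rV[R]_k) : open U ->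
    (forall x, U x -> W (f x)) -> Ck n W F ->
  (forall j, Ck n U (fun x => f x 0 j)) -> Ck n U (F \o f).
Proof.
move=> oU UW; elim: n F => [|n IH] F CF Cf; have [dF dvF] := CF.
  split=> // x Ux; apply: differentiable_comp; last exact/dF/UW.
  by apply: differentiable_row => j; have [df _] := Cf j; apply: df.
split=> [x Ux|v].
  apply: differentiable_comp; last exact/dF/UW.
  by apply: differentiable_row => j; have [df _] := Cf j; apply: df.
have CS j : Ck n U (fun x => f x 0 j) by apply/CkS/Cf.
have CT j : Ck n U (fun x => 'D_v (fun y => f y 0 j) x * partial j F (f x)).
  by apply: (CkM oU); [have [_] := Cf j; apply|apply: (IH (partial j F)) => //; apply: dvF].
have CTs := @Ck_sum _ _ n U _ (index_enum 'I_k) xpredT _ oU (fun j _ => CT j).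
apply: (eq_Ck oU _ CTs) => x; rewrite inE => Ux.
rewrite derive_comp_row //; last exact/dF/UW.
by move=> j; have [df _] := Cf j; apply: df.
Qed.

Section SmoothOn.
Context (R : realType) (n : nat).
Implicit Types (U : set 'rV[R]_n) (f g : 'rV[R]_n -> R).

Lemma Ck_foldr_partial U f s k : Ck (size s + k) U f ->
  Ck k U (foldr (@partial R n) f s).
Proof.
elim: s k => [//|i s IH] k Cf.
have /IH [_ dvf] : Ck (size s + k.+1) U f by rewrite -addSnnS.
exact: dvf.
Qed.

Lemma smooth_on_partial U f i : smooth_on U f -> smooth_on U (partial i f).
Proof. by move=> sf s x Ux; rewrite -foldr_rcons; apply: sf. Qed.

Lemma smooth_onP U f : open U -> smooth_on U f <-> Cinf U f.
Proof.
move=> oU; split=> [sf k|Cf s x Ux]; last first.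
  exact: (Ck_diff (Ck_foldr_partial (Cf (size s + 0)%N)) Ux).
elim: k f sf => [|k IH] f sf; first by split=> // x Ux; apply: (sf [::]).
split=> [x Ux|v]; first exact: (sf [::]).
have Ci i : Ck k U (fun x => v 0 i * partial i f x).
  by apply: (CkM oU); [exact: Ck_cst|apply/IH/smooth_on_partial].
have Cs := @Ck_sum _ _ k U _ (index_enum 'I_n) xpredT _ oU (fun i _ => Ci i).
apply: (eq_Ck oU _ Cs) => x; rewrite inE => Ux.
by rewrite derive_partial //; apply: (sf [::]).
Qed.

End SmoothOn.

Lemma Cinf_derive1n (R : realType) (U : set R) (F : R -> R) : open U ->
  Cinf U F <-> (forall k t, U t -> derivable (derive1n k F) t 1).
Proof.
move=> oU; split=> [CF k t Ut|dF n].
  suff H l : Ck l U (derive1n k F).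
    by apply/derivable1_diffP; apply: (Ck_diff (H 0%N) Ut).
  elim: k l => [|k IH] l; first exact: CF.
  rewrite derive1nS (_ : derive1 _ = 'D_1 (derive1n k F)); last first.
    by apply/funext => x; rewrite derive1E.
  by have [_] := IH l.+1; apply.
suff H k : Ck n U (derive1n k F) by apply: (H 0%N).
elim: n k => [|n IH] k; split=> //; try by move=> x Ux; apply/derivable1_diffP/dF.
move=> v; apply: (eq_Ck oU _ (CkM oU (@Ck_cst _ _ n U v) (IH k.+1))) => x.
rewrite inE => Ux; rewrite derive1nS derive1E.
have df : differentiable (derive1n k F) x by apply/derivable1_diffP/dF.
by rewrite !deriveE // -[X in _ = 'd _ _ X]mulr1 [RHS]linearZ.
Qed.

(** * Symmetry of second derivatives *)

Lemma is_derive_line (R : realType) (V : normedModType R) (f : V -> R)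
    (y u : V) (s : R) : differentiable f (y + s *: u) ->
  is_derive s 1 (fun s => f (y + s *: u)) ('D_u f (y + s *: u)).
Proof.
move=> df.
have dl : is_diff s (fun s : R => y + s *: u) (0 + *:%R^~ u).
  exact: is_diffD.
have dc : is_diff s (f \o (fun s : R => y + s *: u))
    ('d f (y + s *: u) \o (0 + *:%R^~ u)).
  by apply: is_diff_comp; apply: differentiableP.
have dfc := @ex_diff _ _ _ _ _ _ _ dc.
apply: DeriveDef; first exact: diff_derivable.
rewrite deriveE // (@diff_val _ _ _ _ _ _ _ dc) /= deriveE //.
by rewrite -[X in 'd _ _ X]/(0 + 1 *: u) add0r scale1r.
Qed.

Section Young.
Context (R : realType) (V : normedModType R).

(** Young's form of the symmetry of second derivatives: only ['D_u f] is differentiated again, and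
    only at [x]. The second difference is symmetric in [u] and [v], so comparing the two estimates
    gives [derive_swap]. *)
Lemma second_difference (f : V -> R) (x u v : V) (e : R) : 0 < e ->
  (\forall y \near x, differentiable f y) -> differentiable ('D_u f) x ->
  \forall h \near (0 : R)^'+,
    `|f (x + h *: u + h *: v) - f (x + h *: u) - f (x + h *: v) + f x
      - h ^+ 2 * 'D_v ('D_u f) x| <= e * h ^+ 2.
Proof.
move=> e0 df dp; set p := 'D_u f.
(* For 0 <= s <= h the vectors s u + h v and s u have norms summing to at most h N, so a first-order
   error of e / N becomes e h^2; the summand 1 keeps N positive. *)
pose N := 1 + (`|u| + `|v|) + `|u|.
have N0 : 0 < N by rewrite /N -addrA ltr_wpDr // !addr_ge0.
have /nbhs_ballP[d1 d10 D1] := df.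
have /diff_locally/eqaddoP/(_ (e / N)) := dp.
rewrite divr_gt0 // => /(_ isT)/nbhs_ballP[d2 d20 D2].
have r_le k : `|k| < d2 -> `|p (x + k) - p x - 'd p x k| <= e / N * `|k|.
  move=> kd; have := D2 k; rewrite -ball_normE /= sub0r normrN => /(_ kd).
  rewrite -[X in `|X|]/(p (k + x) - (p x + 'd p x k)).
  by rewrite opprD addrA (addrC k).
have f_diff k : `|k| < d1 -> differentiable f (x + k).
  by move=> kd; apply: D1; rewrite -ball_normE /= opprD addrA subrr sub0r normrN.
near=> h.
have h0 : 0 < h by [].
have hd : h * (`|u| + `|v|) < Num.min d1 d2.
  apply: (@le_lt_trans _ _ (h * N)).
    by rewrite ler_pM2l // /N -addrA addrC -addrA lerDl addr_ge0.
  by rewrite -ltr_pdivlMr //; near: h; apply: nbhs_right_lt; rewrite divr_gt0 // lt_min d10.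
have sn s : 0 <= s <= h -> `|s *: u| <= h * `|u|.
  by move=> /andP[s0 sh]; rewrite normrZ ger0_norm // ler_wpM2r.
have sv s : 0 <= s <= h -> `|s *: u + h *: v| <= h * (`|u| + `|v|).
  move=> sh; apply: (le_trans (ler_normD _ _)); rewrite mulrDr lerD ?sn //.
  by rewrite normrZ gtr0_norm.
have su s : 0 <= s <= h -> `|s *: u| <= h * (`|u| + `|v|).
  by move=> sh; apply: (le_trans (sn _ sh)); rewrite ler_pM2l // lerDl.
move: hd; rewrite lt_min => /andP[hd1 hd2].
(* The mean value theorem along [u] replaces the second difference by a first difference of
   ['D_u f], which is then linearised at [x]. *)
pose g s := f (x + h *: v + s *: u) - f (x + s *: u).
have dg s : 0 <= s <= h -> is_derive s 1 g (p (x + h *: v + s *: u) - p (x + s *: u)).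
  move=> sh; apply: is_deriveB; apply: is_derive_line.
    rewrite -addrA addrC (addrC _ x) (addrC (h *: v)); apply: f_diff.
    exact: le_lt_trans (sv _ sh) hd1.
  by apply: f_diff; apply: le_lt_trans (su _ sh) hd1.
have [||c] := @MVT R g (fun s => p (x + h *: v + s *: u) - p (x + s *: u)) 0 h h0.
- by move=> s; rewrite in_itv /= => /andP[/ltW s0 /ltW sh]; apply: dg; rewrite s0.
- apply: derivable_within_continuous => s; rewrite in_itv /= => sh.
  by have [] := dg s sh.
rewrite in_itv /= => /andP[/ltW c0 /ltW ch]; have cI : 0 <= c <= h by rewrite c0.
rewrite subr0 => gE.
have -> : f (x + h *: u + h *: v) - f (x + h *: u) - f (x + h *: v) + f x = g h - g 0.
  rewrite /g scale0r !addr0 (addrAC x (h *: v)).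
  by rewrite opprB -!addrA; congr (_ + (_ + _)); rewrite addrC.
rewrite gE deriveE //.
have -> : (p (x + h *: v + c *: u) - p (x + c *: u)) * h - h ^+ 2 * 'd p x v =
   h * ((p (x + (c *: u + h *: v)) - p x - 'd p x (c *: u + h *: v))
   - (p (x + c *: u) - p x - 'd p x (c *: u))).
    have -> : 'd p x (c *: u + h *: v) = 'd p x (c *: u) + h * 'd p x v.
    by rewrite linearD; congr (_ + _); exact: linearZ.
  rewrite -[x + h *: v + c *: u]addrA (addrC (h *: v)).
  move: (p _) (p _) (p _) ('d p x v) ('d p x _) => p1 p2 p3 d1v d2v; ring.
rewrite normrM gtr0_norm // expr2 mulrCA ler_pM2l //.
apply: (le_trans (ler_normB _ _)).
have := r_le _ (le_lt_trans (sv _ cI) hd2); have := r_le _ (le_lt_trans (su _ cI) hd2).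
move=> r1 r2; apply: (le_trans (lerD r2 r1)).
rewrite -mulrDr -mulrA ler_pM2l // ler_pdivrMl //.
apply: (le_trans (lerD (sv _ cI) (sn _ cI))).
by rewrite -mulrDr mulrC ler_pM2r // /N lerD2r lerDr.
Unshelve. all: by end_near. Qed.

Lemma derive_swap (f : V -> R) (x u v : V) :
  (\forall y \near x, differentiable f y) ->
  differentiable ('D_u f) x -> differentiable ('D_v f) x ->
  'D_v ('D_u f) x = 'D_u ('D_v f) x.
Proof.
move=> df du dv; apply/eqP; rewrite -subr_eq0 -normr_le0.
apply/ler_addgt0Pl => e e0; rewrite addr0.
have e2 : 0 < e / 2 by rewrite divr_gt0.
have F1 := @second_difference f x u v _ e2 df du.
have F2 := @second_difference f x v u _ e2 df dv.
have F0 : \forall h \near (0 : R)^'+, 0 < h by exact: nbhs_right_gt.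
have [h [[H1 H2] hgt0]] := filter_ex (filterI (filterI F1 F2) F0).
have h0 : 0 < h ^+ 2 by rewrite exprn_gt0.
rewrite -(ler_pM2l h0) -{1}(gtr0_norm h0) -normrM.
move: H1 H2; rewrite (addrAC x (h *: v)).
set a := f _; set b := f _; set c := f _; set d := f _.
set D1 := 'D_v _ x; set D2 := 'D_u _ x => H1 H2.
have -> : h ^+ 2 * (D1 - D2) = (a - c - b + d - h ^+ 2 * D2) - (a - b - c + d - h ^+ 2 * D1).
  by clear H1 H2; move: D1 D2 a b c d => D1 D2 a b c d; ring.
apply: (le_trans (ler_normB _ _)); apply: (le_trans (lerD H2 H1)).
by rewrite -mulrDl -splitr mulrC.
Qed.

End Young.

Lemma partial_swap (R : realType) n (U : set 'rV[R]_n) f (x : 'rV[R]_n) i j :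
  open U -> U x -> Cinf U f -> partial i (partial j f) x = partial j (partial i f) x.
Proof.
move=> oU Ux Cf; have [_ dvf] := Cf 1%N.
have df : \forall y \near x, differentiable f y.
  have : nbhs x U by apply: open_nbhs_nbhs.
  by apply: filterS => y Uy; exact: (Ck_diff (Cf 0%N) Uy).
exact: (derive_swap df ((dvf _).1 x Ux) ((dvf _).1 x Ux)).
Qed.

Lemma Cinf_partial (R : realType) n (U : set 'rV[R]_n) (f : 'rV[R]_n -> R) i :
  Cinf U f -> Cinf U (partial i f).
Proof. by move=> Cf k; have [_ dvf] := Cf k.+1; apply: dvf. Qed.

(** * Calculus on the line *)

Lemma is_derive1P (R : realType) (f : R -> R) (a L : R) :
  (forall e, 0 < e -> \forall t \near a, `|f t - f a - (t - a) * L| <= e * `|t - a|) ->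
  is_derive a 1 f L.
Proof.
move=> H.
have cv : (fun h => h^-1 *: ((f \o shift a) (h *: (1 : R)) - f a)) @ 0^' --> L.
  apply/cvgrPdist_le => e e0.
  have := H _ e0; rewrite (near_shift 0 a) subr0 => H0.
  have : \forall h \near (0 : R)^', h != 0 /\
      `|f (h + a) - f a - h * L| <= e * `|h|.
    have n0 : \forall h \near (0 : R)^', h != 0 by exact: nbhs_dnbhs_neq.
    have H1 : \forall h \near (0 : R)^',
        `|f (h + a) - f a - (h + a - a) * L| <= e * `|h + a - a| by exact: nbhs_dnbhs.
    move: n0 H1; apply: filterS2 => h hn0.
    by rewrite addrK.
  apply: filterS => h [h0 hle].
  rewrite /= /GRing.scale /= mulr1.
  rewrite -(ler_pM2r (_ : 0 < `|h|)) ?normr_gt0 // -normrM mulrBl mulrAC mulVf // mul1r.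
  by rewrite distrC mulrC.
by apply: DeriveDef; [apply/cvg_ex; exists L|apply: cvg_lim].
Qed.

Section Derive1.
Context (R : realType) (t : R).
Implicit Types (f g : R -> R).

Lemma der_eq f d d' : is_derive t 1 f d -> d = d' -> is_derive t 1 f d'.
Proof. by move=> H <-. Qed.

Lemma derD f g df dg : is_derive t 1 f df -> is_derive t 1 g dg ->
  is_derive t 1 (fun s => f s + g s) (df + dg).
Proof. by move=> Hf Hg; exact: is_deriveD. Qed.

Lemma derB f g df dg : is_derive t 1 f df -> is_derive t 1 g dg ->
  is_derive t 1 (fun s => f s - g s) (df - dg).
Proof. by move=> Hf Hg; exact: is_deriveB. Qed.

Lemma derM f g df dg : is_derive t 1 f df -> is_derive t 1 g dg ->
  is_derive t 1 (fun s => f s * g s) (df * g t + f t * dg).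
Proof.
move=> Hf Hg; apply: (der_eq (is_deriveM Hf Hg)).
by rewrite addrC /GRing.scale /= mulrC.
Qed.

Lemma derZ c f df : is_derive t 1 f df -> is_derive t 1 (fun s => c * f s) (c * df).
Proof. by move=> Hf; exact: is_deriveZ. Qed.

Lemma der_cst c : is_derive t 1 (fun=> c : R) 0.
Proof. exact: is_derive_cst. Qed.

Lemma der_id : is_derive t 1 (fun s : R => s) 1.
Proof. exact: is_derive_id. Qed.

Lemma derV f df : f t != 0 -> is_derive t 1 f df ->
  is_derive t 1 (fun s => (f s)^-1) (- df / f t ^+ 2).
Proof.
move=> f0 Hf; have Hv : derivable f t 1 by [].
apply: DeriveDef; first exact: derivableV.
by rewrite deriveV // derive_val /GRing.scale /= !mulNr mulrC.
Qed.

Lemma derX f df k : is_derive t 1 f df ->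
  is_derive t 1 (fun s => f s ^+ k) (k%:R * f t ^+ k.-1 * df).
Proof.
move=> Hf; elim: k => [|k IH].
  by under eq_fun do rewrite expr0; rewrite !mul0r; exact: der_cst.
under eq_fun do rewrite exprS.
apply: (der_eq (derM Hf IH)); case: k {IH} => [|k] /=.
  by rewrite expr0 !mul1r mul0r mulr1 mul0r mulr0 addr0.
by rewrite -[k.+2%:R]natr1 exprS; ring.
Qed.

Lemma der_comp f g df dg : is_derive t 1 f df -> is_derive (f t) 1 g dg ->
  is_derive t 1 (fun s => g (f s)) (dg * df).
Proof.
move=> Hf Hg.
have df' : differentiable f t by apply/derivable1_diffP.
have dg' : differentiable g (f t) by apply/derivable1_diffP.
apply: DeriveDef; first by apply/derivable1_diffP; exact: differentiable_comp.
by rewrite [LHS](derive_comp1 _ df' dg') !derive_val.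
Qed.

Lemma der_near f g d : (\forall s \near t, f s = g s) -> is_derive t 1 f d -> is_derive t 1 g d.
Proof.
move=> fg Hf; apply: DeriveDef; first by apply: near_eq_derivable fg _.
by rewrite -(near_eq_derive _ fg) derive_val.
Qed.

Lemma der_open (V : set R) f g d : open V -> V t -> (forall s, V s -> f s = g s) ->
  is_derive t 1 f d -> is_derive t 1 g d.
Proof.
move=> oV Vt fg; apply: der_near.
have : nbhs t V by exact: open_nbhs_nbhs.
by apply: filterS.
Qed.

Lemma der_Cinf (V : set R) f : Cinf V f -> V t -> is_derive t 1 f ('D_1 f t).
Proof.
move=> sf Vt; have df : differentiable f t by exact: (Ck_diff (sf 0%N) Vt).
by apply: DeriveDef => //; exact: diff_derivable.
Qed.
End Derive1.

Lemma Cinf_D1 (R : realType) (V : set R) (f : R -> R) : Cinf V f -> Cinf V ('D_1 f).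
Proof. by move=> sf k; have [_ H] := sf k.+1; exact: H. Qed.

Lemma Ck_der (R : realType) (V : set R) (f df : R -> R) k : open V ->
  (forall t, V t -> is_derive t 1 f (df t)) -> Ck k V df -> Ck k.+1 V f.
Proof.
move=> oV Hf Cdf.
have dif t : V t -> differentiable f t.
  by move=> Vt; have Hft := Hf t Vt; apply/derivable1_diffP.
split=> // v; apply: (eq_Ck oV _ (CkM oV (@Ck_cst _ _ k V v) Cdf)) => t; rewrite inE => Vt.
have Hft := Hf t Vt; have <- : 'D_1 f t = df t by rewrite derive_val.
rewrite (deriveE _ (dif t Vt)) (deriveE v (dif t Vt)).
have -> : 'd f t v = 'd f t (v *: 1) by rewrite /GRing.scale /= mulr1.
by rewrite [RHS]linearZ.
Qed.

(** * Hadamard's lemma: division of a smooth function by its zeros *)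

Section Hadamard.
Context (R : realType) (V : set R) (a : R).
Hypotheses (oV : open V) (Va : V a).

(** Here h(t) is the mean of s^n u(a + s (t - a)) over s in [0, 1], described without integrals by
    means of the primitive [G] of (t - a)^n u(t) that vanishes at [a]. The point [a] is the only one
    where the quotient rule does not apply. *)
Lemma hadamard_derive_at n (u G h : R -> R) : Cinf V u ->
  (forall t, V t -> is_derive t 1 G ((t - a) ^+ n * u t)) -> G a = 0 ->
  (forall t, V t -> (t - a) ^+ n.+1 * h t = G t) -> h a = u a / n.+1%:R ->
  is_derive a 1 h ('D_1 u a / n.+2%:R).
Proof.
move=> su dG Ga hG ha; apply: is_derive1P => e e0.
have du : differentiable u a by exact: (Ck_diff (su 0%N) Va).
have n1 : n.+1%:R != 0 :> R by rewrite pnatr_eq0.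
have n2 : n.+2%:R != 0 :> R by rewrite pnatr_eq0.
pose A := u a; pose B := 'D_1 u a.
have /nbhs_ballP[d1 d10 D1] : nbhs a V by exact: open_nbhs_nbhs.
have /derivable_nbhsP/eqaddoP/(_ e e0)/nbhs_ballP[d2 d20 D2] : derivable u a 1.
  exact: diff_derivable.
have u_le t : `|t - a| < d2 -> `|u t - A - (t - a) * B| <= e * `|t - a|.
  move=> td; have := D2 (t - a); rewrite -ball_normE /= sub0r normrN => /(_ td).
  rewrite -[X in `|X|]/(u ((t - a) *: 1 + a) - (u a + (t - a) *: B)).
  by rewrite /GRing.scale /= mulr1 subrK opprD addrA.
(* Subtracting the primitives of the Taylor part of (t - a)^n u leaves a function whose derivative
   is (t - a)^n times the first-order remainder of [u]; the mean value theorem transfers the bound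
   on that remainder to [h]. *)
pose g t := G t - (t - a) ^+ n.+1 * (A / n.+1%:R) - (t - a) ^+ n.+2 * (B / n.+2%:R).
have dg t : V t -> is_derive t 1 g ((t - a) ^+ n * (u t - A - (t - a) * B)).
  move=> Vt.
  have dX k c : is_derive t 1 (fun t => (t - a) ^+ k.+1 * (c / k.+1%:R)) ((t - a) ^+ k * c).
    have k0 : k.+1%:R != 0 :> R by rewrite pnatr_eq0.
    apply: (der_eq (derM (derX k.+1 (derB (der_id t) (der_cst t a))) (der_cst t _))).
    rewrite /= mulr0 addr0 subr0 mulr1; move: (k.+1%:R) k0 => K K0.
    by move: ((t - a) ^+ k) => p; field.
  apply: (der_eq (derB (derB (dG t Vt) (dX n A)) (dX n.+1 B))).
  by rewrite exprSr; ring.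
have ga0 : g a = 0 by rewrite /g Ga subrr !expr0n /= !mul0r !subr0.
near=> t.
have [->|ta] := eqVneq t a; first by rewrite !subrr mul0r subr0 normr0 mulr0.
have td : `|t - a| < Num.min d1 d2.
  near: t; apply/nbhs_ballP; exists (Num.min d1 d2); first by rewrite /= lt_min d10.
  by move=> s; rewrite -ball_normE /= distrC.
move: td; rewrite lt_min => /andP[td1 td2].
have inV s : `|s - a| <= `|t - a| -> V s.
  by move=> sa; apply: D1; rewrite -ball_normE /= distrC (le_lt_trans sa).
have [c ca gE] : exists2 c, `|c - a| <= `|t - a| &
    g t - g a = (c - a) ^+ n * (u c - A - (c - a) * B) * (t - a).
  have mvt x y : x < y -> (forall s, x <= s <= y -> V s) ->
    exists2 c, x <= c <= y & g y - g x = (c - a) ^+ n * (u c - A - (c - a) * B) * (y - x).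
    move=> xy xyV.
    have [||c] := @MVT R g (fun c => (c - a) ^+ n * (u c - A - (c - a) * B)) x y xy.
    - move=> s; rewrite in_itv /= => /andP[/ltW s0 /ltW sh]; apply: dg.
      by apply: xyV; rewrite s0.
    - apply: derivable_within_continuous => s; rewrite in_itv /= => sh.
      by have := dg s (xyV s sh).
    by rewrite in_itv /= => /andP[/ltW c0 /ltW c1] E; exists c => //; rewrite c0.
  move: ta; rewrite neq_lt => /orP[ta|ta].
    have [s sta|c cta E] := mvt t a ta.
      apply: inV; case/andP: sta => ts sa.
      by rewrite ler0_norm ?subr_le0 // ler0_norm ?subr_le0 ?(ltW ta) // lerN2 lerD2r.
    exists c; last by rewrite -[LHS]opprB E; ring.
    case/andP: cta => ts sa.
    by rewrite ler0_norm ?subr_le0 // ler0_norm ?subr_le0 ?(ltW ta) // lerN2 lerD2r.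
  have [s sta|c cta E] := mvt a t ta.
    apply: inV; case/andP: sta => ts sa.
    by rewrite ger0_norm ?subr_ge0 // ger0_norm ?subr_ge0 ?(ltW ta) // lerD2r.
  exists c => //; case/andP: cta => ts sa.
  by rewrite ger0_norm ?subr_ge0 // ger0_norm ?subr_ge0 ?(ltW ta) // lerD2r.
have tX : 0 < `|t - a| ^+ n.+1 by rewrite exprn_gt0 // normr_gt0 subr_eq0.
rewrite -(ler_pM2l tX) -normrX -normrM.
have -> : (t - a) ^+ n.+1 * (h t - h a - (t - a) * (B / n.+2%:R)) = g t - g a.
  rewrite ga0 subr0 /g -hG; last exact: inV.
  by rewrite ha -/A (exprS _ n.+1); ring.
rewrite gE !normrM !normrX exprSr -!mulrA ler_pM //.
- by rewrite lerXn2r ?nnegrE.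
- rewrite mulrC ler_pM //; apply: le_trans (u_le c (le_lt_trans ca td2)) _.
  by rewrite ler_pM2l.
Unshelve. all: by end_near. Qed.

Let derivative_formula n (u G h : R -> R) t : V t ->
  (forall t, V t -> is_derive t 1 G ((t - a) ^+ n * u t)) ->
  (forall t, V t -> (t - a) ^+ n.+1 * h t = G t) -> t != a ->
  is_derive t 1 h (((t - a) ^+ n.+1 * u t - n.+1%:R * G t) / (t - a) ^+ n.+2).
Proof.
move=> Vt dG hG ta; have ta0 : t - a != 0 by rewrite subr_eq0.
pose V' := V `&` [set s | s != a].
have olt : open [set s : R | s < a] by exact: open_lt.
have ogt : open [set s : R | a < s] by exact: open_gt.
have oV' : open V'.
  have -> : V' = V `&` ([set s : R | s < a] `|` [set s | a < s]).
    by apply/seteqP; split=> s [Vs /= sa]; split=> //=; move: sa; rewrite neq_lt => /orP.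
  by apply: openI => //; apply: openU.
have X0 : (t - a) ^+ n.+1 != 0 by rewrite expf_neq0.
have dq := derM (dG t Vt) (@derV R t (fun s => (s - a) ^+ n.+1) _ X0
  (derX n.+1 (derB (der_id t) (der_cst t a)))).
apply: (@der_open R t V' (fun s => G s * ((s - a) ^+ n.+1)^-1)) => //.
  by move=> s [Vs /= sa]; rewrite -hG // mulrC mulKf // expf_neq0 // subr_eq0.
apply: (der_eq dq); rewrite /= subr0 mulr1 (exprS _ n.+1) (exprS _ n).
have p0 : (t - a) ^+ n != 0 by rewrite expf_neq0.
move: (n.+1%:R) ((t - a) ^+ n) p0 (t - a) ta0 => m p p0 x x0; field.
by rewrite expf_neq0 x0.
Qed.

(** The hypotheses are stable under differentiation: (t - a)^(n+2) h' = (t - a)^(n+1) u - (n+1) G,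
    and the right side is the primitive of (t - a)^(n+1) u'. So the induction on [k] raises [n] and
    replaces [u] by its derivative. *)
Lemma hadamard_Ck k n (u G h : R -> R) : Cinf V u ->
  (forall t, V t -> is_derive t 1 G ((t - a) ^+ n * u t)) -> G a = 0 ->
  (forall t, V t -> (t - a) ^+ n.+1 * h t = G t) -> h a = u a / n.+1%:R ->
  Ck k V h.
Proof.
elim: k n u G h => [|k IH] n u G h su dG Ga hG ha.
  split=> // t Vt; apply/derivable1_diffP.
  have [->|ta] := eqVneq t a.
    by have := hadamard_derive_at su dG Ga hG ha.
  by have := derivative_formula Vt dG hG ta.
pose G2 t := (t - a) ^+ n.+1 * u t - n.+1%:R * G t.
pose h2 t := if t == a then 'D_1 u a / n.+2%:R else G2 t / (t - a) ^+ n.+2.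
apply: (@Ck_der _ V h h2) => // [t Vt|].
  rewrite /h2; have [->|ta] := eqVneq t a; first exact: hadamard_derive_at su dG Ga hG ha.
  exact: derivative_formula.
apply: (IH n.+1 ('D_1 u) G2 h2).
- exact: Cinf_D1.
- move=> t Vt.
  have dX := derX n.+1 (derB (der_id t) (der_cst t a)).
  apply: (der_eq (derB (derM dX (der_Cinf su Vt)) (derZ n.+1%:R (dG t Vt)))).
  by rewrite /= subr0 mulr1; ring.
- by rewrite /G2 subrr expr0n /= mul0r Ga mulr0 subrr.
- move=> t Vt; rewrite /h2; case: eqVneq => [->|ta].
    by rewrite /G2 subrr !expr0n /= !mul0r Ga mulr0 subrr.
  by rewrite mulrC divfK // expf_neq0 // subr_eq0.
- by rewrite /h2 eqxx.
Qed.

Lemma hadamard (f : R -> R) : Cinf V f -> f a = 0 ->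
  exists h, [/\ Cinf V h, (forall t, V t -> f t = (t - a) * h t) & h a = 'D_1 f a].
Proof.
move=> sf fa.
pose h t := if t == a then 'D_1 f a else f t / (t - a).
have hE t : (t - a) * h t = f t.
  rewrite /h; case: eqVneq => [->|ta]; first by rewrite subrr mul0r fa.
  by rewrite mulrC divfK // subr_eq0.
exists h; split=> //; last by rewrite /h eqxx.
move=> k; apply: (@hadamard_Ck k 0 ('D_1 f) f h) => //.
- exact: Cinf_D1.
- by move=> t Vt; rewrite expr0 mul1r; exact: der_Cinf sf Vt.
- by move=> t _; rewrite expr1 hE.
- by rewrite /h eqxx divr1.
Qed.
End Hadamard.

Lemma expR_Ck (R : realType) k : Ck k setT (@expR R).
Proof.
elim: k => [|k IH]; first by split=> // t _; apply/derivable1_diffP; exact: derivable_expR.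
by apply: (@Ck_der _ setT expR expR k openT _ IH) => t _; exact: is_derive_expR.
Qed.

(** * Open neighbourhoods of [-1, 1] *)

Section Interval.
Context (R : realType).

(** The momentum takes its values in the closed interval, while the differential calculus is done on
    open sets; everything composed with a momentum must be smooth on some [J d]. *)
Definition J (d : R) : set R := [set t | -1 - d < t < 1 + d].

Lemma open_J d : open (J d).
Proof.
rewrite (_ : J d = [set` `]-1 - d, 1 + d[]); first exact: interval_open.
by apply/seteqP; split=> t /=; rewrite in_itv.
Qed.

Lemma J_cc d t : 0 < d -> -1 <= t <= 1 -> J d t.
Proof. by rewrite /J /=; lra. Qed.

Lemma sub_J d d' : d <= d' -> J d `<=` J d'.
Proof. by rewrite /J => dd t /=; lra. Qed.

Lemma near_J (P : R -> Prop) (d0 : R) : 0 < d0 ->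
  (forall t, -1 < t < 1 -> P t) -> (\forall t \near (-1 : R), P t) ->
  (\forall t \near (1 : R), P t) -> exists2 d, 0 < d <= d0 & forall t, J d t -> P t.
Proof.
move=> d00 Pin /nbhs_ballP[d1 /= d10 D1] /nbhs_ballP[d2 /= d20 D2].
pose d := Num.min d0 (Num.min d1 d2).
have dp : 0 < d by rewrite !lt_min d00 d10.
have [dd0 dd1 dd2] : [/\ d <= d0, d <= d1 & d <= d2].
  by rewrite !ge_min !lexx !orbT.
exists d; first by rewrite dp.
move=> t /= /andP[t1 t2].
have [tl|tl] := leP t (-1).
  apply: D1; rewrite /ball /= distrC ler0_norm ?subr_le0 //; lra.
have [tr|tr] := leP 1 t; last by apply: Pin; rewrite tl.
by apply: D2; rewrite /ball /= distrC ger0_norm ?subr_ge0 //; lra.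
Qed.

Lemma antiderivative d (f : R -> R) : 0 < d -> Cinf (J d) f ->
  exists I, forall t, J (d / 2) t -> is_derive t 1 I (f t).
Proof.
(* Integration starts at a point of [J d] left of -1; halving [d] keeps the segment compact inside
   [J d]. *)
move=> d0 sf; pose l := -1 - d / 2; pose r := 1 + d / 2.
have lrJ t : l <= t <= r -> J d t by rewrite /J /l /r /=; lra.
have cf t : J d t -> {for t, continuous f}.
  by move=> Jt; apply: differentiable_continuous; exact: (Ck_diff (sf 0%N) Jt).
have intf : (@lebesgue_measure R).-integrable `[l, r] (EFin \o f).
  apply: continuous_compact_integrable; first exact: segment_compact.
  apply: continuous_in_subspaceT => t; rewrite inE /= in_itv /= => /lrJ.
  exact: cf.
exists (fun x => (\int[@lebesgue_measure R]_(t in [set` `[l, x]]) (f t))%R).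
move=> t /= /andP[tl tr].
have [||dF FE] := @continuous_FTC1_closed R f l t r tr intf _ _; first exact: tl.
  by apply/cf/lrJ; rewrite /l /r !ltW.
by apply: DeriveDef; [exact: dF|rewrite -derive1E; exact: FE].
Qed.
End Interval.

(** * Curvature in a moving frame *)

Section MatrixDerivative.
Context (R : realType) (N : nat).
Implicit Types (x : 'rV[R]_N) (i j : 'I_N) (f g : 'rV[R]_N -> R) (U : set 'rV[R]_N).

Definition mdiff p q (F : 'rV[R]_N -> 'M[R]_(p, q)) x :=
  forall a b, differentiable (fun y => F y a b) x.

Definition mCinf p q U (F : 'rV[R]_N -> 'M[R]_(p, q)) :=
  forall a b, Cinf U (fun y => F y a b).

Definition dmx p q i (F : 'rV[R]_N -> 'M[R]_(p, q)) x : 'M[R]_(p, q) :=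
  \matrix_(a, b) partial i (fun y => F y a b) x.

Lemma mCinf_diff p q U (F : 'rV[R]_N -> 'M[R]_(p, q)) x :
  mCinf U F -> U x -> mdiff F x.
Proof. by move=> CF Ux a b; exact: (Ck_diff (CF a b 0%N) Ux). Qed.

Lemma partialD f g i x : differentiable f x -> differentiable g x ->
  partial i (fun y => f y + g y) x = partial i f x + partial i g x.
Proof. by move=> df dg; apply: deriveD; apply: diff_derivable. Qed.

Lemma partialM f g i x : differentiable f x -> differentiable g x ->
  partial i (fun y => f y * g y) x = partial i f x * g x + f x * partial i g x.
Proof.
move=> df dg; rewrite [LHS]deriveM; try exact: diff_derivable.
by rewrite addrC /partial /GRing.scale /= mulrC.
Qed.

Lemma partialN f i x : differentiable f x ->
  partial i (fun y => - f y) x = - partial i f x.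
Proof. by move=> df; apply: deriveN; apply: diff_derivable. Qed.

Lemma eq_partial U f g i x : open U -> {in U, f =1 g} -> U x ->
  partial i f x = partial i g x.
Proof. exact: eq_derive_open. Qed.

Lemma differentiable_bigsum (I : Type) (s : seq I) (f : I -> 'rV[R]_N -> R) x :
  (forall k, differentiable (f k) x) ->
  differentiable (fun y => \sum_(k <- s) f k y) x.
Proof.
move=> df; elim: s => [|k s IH].
  rewrite (_ : (fun y => _) = cst 0); first exact: differentiable_cst.
  by apply/funext => y; rewrite big_nil.
under eq_fun do rewrite big_cons.
exact: differentiableD.
Qed.

Lemma partial_sum (I : Type) (s : seq I) (f : I -> 'rV[R]_N -> R) i x :
  (forall k, differentiable (f k) x) ->
  partial i (fun y => \sum_(k <- s) f k y) x = \sum_(k <- s) partial i (f k) x.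
Proof.
move=> df; elim: s => [|k s IH].
  rewrite big_nil (_ : (fun y => _) = cst 0); last by apply/funext => y; rewrite big_nil.
  by rewrite /partial derive_cst.
rewrite big_cons -IH -partialD //; last exact: differentiable_bigsum.
by congr partial; apply/funext => y; rewrite big_cons.
Qed.

Lemma eq_dmx p q U (F H : 'rV[R]_N -> 'M[R]_(p, q)) i x :
  open U -> {in U, F =1 H} -> U x -> dmx i F x = dmx i H x.
Proof.
move=> oU FH Ux; apply/matrixP => a b; rewrite !mxE.
by apply: (eq_partial _ oU _ Ux) => y Uy; rewrite FH.
Qed.

Lemma mdiffM p q r (F : 'rV[R]_N -> 'M[R]_(p, q)) (H : 'rV[R]_N -> 'M[R]_(q, r)) x :
  mdiff F x -> mdiff H x -> mdiff (fun y => F y *m H y) x.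
Proof.
move=> dF dH a b; under eq_fun do rewrite mxE.
by apply: differentiable_bigsum => k; apply: differentiableM.
Qed.

Lemma mdiff_tr p q (F : 'rV[R]_N -> 'M[R]_(p, q)) x :
  mdiff F x -> mdiff (fun y => (F y)^T) x.
Proof. by move=> dF a b; under eq_fun do rewrite mxE. Qed.

Lemma dmxM p q r (F : 'rV[R]_N -> 'M[R]_(p, q)) (H : 'rV[R]_N -> 'M[R]_(q, r)) i x :
  mdiff F x -> mdiff H x ->
  dmx i (fun y => F y *m H y) x = dmx i F x *m H x + F x *m dmx i H x.
Proof.
move=> dF dH; apply/matrixP => a b; rewrite !mxE.
under eq_fun do rewrite mxE.
rewrite partial_sum; last by move=> k; apply: differentiableM.
rewrite -big_split; apply: eq_bigr => k _ /=.
by rewrite partialM // !mxE.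
Qed.

Lemma dmxD p q (F H : 'rV[R]_N -> 'M[R]_(p, q)) i x :
  mdiff F x -> mdiff H x -> dmx i (fun y => F y + H y) x = dmx i F x + dmx i H x.
Proof.
move=> dF dH; apply/matrixP => a b; rewrite !mxE; under eq_fun do rewrite mxE.
exact: partialD.
Qed.

Lemma dmx_tr p q (F : 'rV[R]_N -> 'M[R]_(p, q)) i x :
  dmx i (fun y => (F y)^T) x = (dmx i F x)^T.
Proof. by apply/matrixP => a b; rewrite !mxE; under eq_fun do rewrite mxE. Qed.

Lemma mCinfM p q r U (F : 'rV[R]_N -> 'M[R]_(p, q)) (H : 'rV[R]_N -> 'M[R]_(q, r)) :
  open U -> mCinf U F -> mCinf U H -> mCinf U (fun y => F y *m H y).
Proof.
move=> oU CF CH a b n; under eq_fun do rewrite mxE.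
by apply: Ck_sum => // k _; apply: CkM => //; [apply: CF|apply: CH].
Qed.

Lemma mCinfD p q U (F H : 'rV[R]_N -> 'M[R]_(p, q)) :
  open U -> mCinf U F -> mCinf U H -> mCinf U (fun y => F y + H y).
Proof.
move=> oU CF CH a b n; under eq_fun do rewrite mxE.
by apply: CkD => //; [apply: CF|apply: CH].
Qed.

Lemma mCinfN p q U (F : 'rV[R]_N -> 'M[R]_(p, q)) :
  open U -> mCinf U F -> mCinf U (fun y => - F y).
Proof.
by move=> oU CF a b n; under eq_fun do rewrite mxE; apply: CkN => //; apply: CF.
Qed.

Lemma mCinfZ p q U f (F : 'rV[R]_N -> 'M[R]_(p, q)) :
  open U -> Cinf U f -> mCinf U F -> mCinf U (fun y => f y *: F y).
Proof.
move=> oU Cf CF a b n; under eq_fun do rewrite mxE.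
by apply: CkM => //; apply: CF.
Qed.

Lemma mCinf_cst p q U (A : 'M[R]_(p, q)) : mCinf U (fun=> A).
Proof. by move=> a b n; apply: Ck_cst. Qed.

Lemma mCinf_tr p q U (F : 'rV[R]_N -> 'M[R]_(p, q)) :
  mCinf U F -> mCinf U (fun y => (F y)^T).
Proof. by move=> CF a b n; under eq_fun do rewrite mxE; apply: CF. Qed.

Lemma mCinf_dmx p q U (F : 'rV[R]_N -> 'M[R]_(p, q)) i :
  mCinf U F -> mCinf U (dmx i F).
Proof.
move=> CF a b n; under eq_fun do rewrite mxE.
exact: (Cinf_partial i (CF a b) n).
Qed.

Lemma mCinf_sum p q U (I : Type) (s : seq I) (F : I -> 'rV[R]_N -> 'M[R]_(p, q)) :
  open U -> (forall k, mCinf U (F k)) -> mCinf U (fun y => \sum_(k <- s) F k y).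
Proof.
move=> oU CF a b n; under eq_fun do rewrite summxE.
by apply: Ck_sum => // k _; apply: CF.
Qed.

Lemma Cinf_det p U (F : 'rV[R]_N -> 'M[R]_p) :
  open U -> mCinf U F -> Cinf U (fun y => \det (F y)).
Proof.
move=> oU CF n; apply: Ck_sum => // s _; apply: CkM => //; first exact: Ck_cst.
by apply: Ck_prod => // k _; apply: CF.
Qed.

Lemma mCinf_inv p U (F : 'rV[R]_N -> 'M[R]_p) :
  open U -> (forall y, U y -> F y \in unitmx) -> mCinf U F ->
  mCinf U (fun y => invmx (F y)).
Proof.
move=> oU Fu CF a b n.
apply: (@eq_Ck _ _ n U (fun y => (\det (F y))^-1 * cofactor (F y) b a)) => //.
  by move=> y; rewrite inE => Uy; rewrite /invmx Fu // !mxE.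
apply: CkM => //.
  apply: CkV => //; last exact: Cinf_det.
  by move=> y /Fu; rewrite unitmxE unitfE.
apply: CkM => //; first exact: Ck_cst.
apply: Cinf_det => // c d m; under eq_fun do rewrite !mxE.
exact: CF.
Qed.

End MatrixDerivative.

(** The hypotheses are the two mixed derivatives of dC = Gam C - C Om. [D] stands for the second
    derivatives of [C], equal in both orders, so it cancels and the curvature of one connection is
    carried to that of the other. *)
Lemma gauge_curvature (R : comRingType) N K (D : 'M[R]_(N, K)) (C : 'M[R]_(N, K))
    (Gi Gj dGij dGji : 'M[R]_N) (Oi Oj dOij dOji : 'M[R]_K) :
  dGij *m C + Gj *m (Gi *m C - C *m Oi) = D + ((Gi *m C - C *m Oi) *m Oj + C *m dOij) ->
  dGji *m C + Gi *m (Gj *m C - C *m Oj) = D + ((Gj *m C - C *m Oj) *m Oi + C *m dOji) ->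
  (dGij - dGji + Gj *m Gi - Gi *m Gj) *m C = C *m (dOij - dOji + Oj *m Oi - Oi *m Oj).
Proof.
move=> /(canRL (addrK _)) Hij /(canRL (addrK _)) Hji.
rewrite !mulmxDl !mulNmx Hij Hji ?(mulmxDr, mulmxN, mulmxDl, mulNmx, mulmxA).
move: (Gj *m Gi *m C) (Gi *m Gj *m C) => X1 X2.
move: (C *m Oi *m Oj) (C *m Oj *m Oi) (Gi *m C *m Oj) (Gj *m C *m Oi) => X3 X4 X5 X6.
move: (C *m dOij) (C *m dOji) => X7 X8.
by apply/matrixP => a b; rewrite !mxE; ring.
Qed.

(** * The Levi-Civita connection read in a coframe *)

Section MovingFrame.
Context (R : realType) (N K : nat) (U : set 'rV[R]_N).
Context (G : 'rV[R]_N -> 'M[R]_N) (C : 'rV[R]_N -> 'M[R]_(N, K)).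
Context (B : 'rV[R]_N -> 'M[R]_(K, N)) (Gh : 'rV[R]_N -> 'M[R]_K).
Context (Gm : 'I_K -> 'rV[R]_N -> 'M[R]_K).
Hypotheses (oU : open U) (CB : forall y, U y -> C y *m B y = 1%:M)
  (BC : forall y, U y -> B y *m C y = 1%:M)
  (GE : forall y, U y -> G y = C y *m Gh y *m (C y)^T)
  (Gu : forall y, U y -> Gh y \in unitmx)
  (Gs : forall y, U y -> (Gh y)^T = Gh y)
  (sC : mCinf U C) (sB : mCinf U B) (sG : mCinf U Gh) (sGm : forall a, mCinf U (Gm a)).
Hypothesis torsion_free : forall y i j c, U y ->
  partial i (fun y => C y j c) y - partial j (fun y => C y i c) y =
  - \sum_a \sum_b C y i a * C y j b * (Gm a y b c - Gm b y a c).
Hypothesis metric_compatible : forall y k, U y ->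
  dmx k Gh y = \sum_a C y k a *: (Gm a y *m Gh y + Gh y *m (Gm a y)^T).

(** With e the frame dual to the coframe [C], the number [Gm a y b c] is the coefficient of e_c in
    the derivative of e_b along e_a. [Om i] is this connection in the coordinate direction i, and
    [Gam i] is the same connection in the coordinate frame, with entry (j, k) equal to
    Gamma^k_ij. *)
Let Om i y := \sum_a C y i a *: Gm a y.
Let Gam i y := (dmx i C y + C y *m Om i y) *m B y.

Let sOm i : mCinf U (Om i).
Proof. by apply: mCinf_sum => // a; apply: mCinfZ => //; apply: sC. Qed.

Let sGam i : mCinf U (Gam i).
Proof. by apply: mCinfM => //; apply: mCinfD => //; [apply: mCinf_dmx|apply: mCinfM]. Qed.

Let GamC i y : U y -> Gam i y *m C y = dmx i C y + C y *m Om i y.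
Proof. by move=> Uy; rewrite /Gam -mulmxA BC // mulmx1. Qed.

Let COmE i j c y :
  (C y *m Om i y) j c = \sum_a \sum_b C y i a * C y j b * Gm a y b c.
Proof.
rewrite mxE exchange_big; apply: eq_bigr => b _ /=.
rewrite summxE mulr_sumr; apply: eq_bigr => a _.
by rewrite !mxE mulrCA mulrA.
Qed.

Let Gam_sym i j y k : U y -> Gam i y j k = Gam j y i k.
Proof.
move=> Uy; rewrite /Gam !mxE; apply: eq_bigr => c _; congr (_ * _).
rewrite mxE [RHS]mxE !COmE [X in X + _]mxE [X in _ = X + _]mxE.
have -> : \sum_a \sum_b C y j a * C y i b * Gm a y b c =
    \sum_a \sum_b C y i a * C y j b * Gm b y a c.
  by rewrite exchange_big; apply: eq_bigr => a _; apply: eq_bigr => b _; rewrite (mulrC (C y j b)).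
have tf := torsion_free i j c Uy.
have aux (X Y S1 S2 : R) : X - Y = - (S1 - S2) -> X + S1 = Y + S2.
  by move=> /eqP; rewrite subr_eq => /eqP ->; ring.
apply: aux; move: tf; under eq_bigr => a _.
  under eq_bigr => b _ do rewrite mulrBr.
  rewrite sumrB; over.
by rewrite sumrB.
Qed.

Let dG k y : U y -> dmx k G y = Gam k y *m G y + (Gam k y *m G y)^T.
Proof.
move=> Uy.
have dC := mCinf_diff sC Uy; have dGh := mCinf_diff sG Uy.
rewrite (@eq_dmx _ _ _ _ U _ (fun y => C y *m Gh y *m (C y)^T)) //; last first.
  by move=> z; rewrite inE => Uz; apply: GE.
rewrite !dmxM ?dmx_tr //; first last.
- exact: mdiff_tr.
- exact: mdiffM.
have -> : dmx k Gh y = Om k y *m Gh y + Gh y *m (Om k y)^T.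
  rewrite metric_compatible // mulmx_suml linear_sum mulmx_sumr -big_split /=.
  apply: eq_bigr => a _; rewrite linearZ /= -scalemxAl -scalemxAr.
  by rewrite scalerDr.
have -> : Gam k y *m G y = (dmx k C y + C y *m Om k y) *m Gh y *m (C y)^T.
  by rewrite GE // /Gam !mulmxA -(mulmxA _ (B y)) BC // mulmx1.
have trD : (dmx k C y + C y *m Om k y)^T = (dmx k C y)^T + (Om k y)^T *m (C y)^T.
  by rewrite -trmx_mul; exact: linearD.
rewrite !trmx_mul Gs // trmxK trD.
rewrite ?mulmxDl ?mulmxDr ?mulmxA ?mulmxDl ?mulmxDr ?mulmxA.
move: (_ *m _) (_ *m _) (_ *m _) (_ *m _) => X1 X2 X3 X4.
by rewrite -!addrA (addrC X2).
Qed.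

Let G_sym y : U y -> (G y)^T = G y.
Proof. by move=> Uy; rewrite GE // !trmx_mul trmxK Gs // mulmxA. Qed.

Let Gi y := (B y)^T *m invmx (Gh y) *m B y.

Let invG y : U y -> invmx (G y) = Gi y.
Proof.
move=> Uy.
have GGi : G y *m Gi y = 1%:M.
  rewrite GE // /Gi !mulmxA -(mulmxA _ (C y)^T) -trmx_mul BC // trmx1 mulmx1.
  by rewrite -(mulmxA _ (Gh y)) mulmxV ?Gu // mulmx1 CB.
have [Gun _] := mulmx1_unit GGi.
by rewrite -[RHS](mulKmx Gun) GGi mulmx1.
Qed.

(** Uniqueness of the Levi-Civita connection: by symmetry and metric compatibility of [Gam], the
    three derivatives of the metric add up to twice one lowered symbol. *)
Let christoffelE i j k y : U y -> christoffel G k i j y = Gam i y j k.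
Proof.
move=> Uy; rewrite /christoffel.
have dGE a b c : partial a (fun z => G z b c) y =
    (Gam a y *m G y) b c + (Gam a y *m G y) c b.
  by have /matrixP/(_ b c) := dG a Uy; rewrite !mxE.
have LS a b c : (Gam a y *m G y) b c = (Gam b y *m G y) a c.
  by rewrite !mxE; apply: eq_bigr => l _; rewrite Gam_sym.
under eq_bigr => l _.
  rewrite !dGE (LS j i l) (LS l i j) (LS l j i).
  rewrite (_ : _ - _ = 2 * (Gam i y *m G y) j l); last by ring.
  rewrite mulrCA; over.
rewrite -mulr_sumr mulKf ?pnatr_eq0 //.
have Gun : G y \in unitmx.
  have [] // := @mulmx1_unit _ _ (G y) (Gi y).
  rewrite GE // /Gi !mulmxA -(mulmxA _ (C y)^T) -trmx_mul BC // trmx1 mulmx1.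
  by rewrite -(mulmxA _ (Gh y)) mulmxV ?Gu // mulmx1 CB.
rewrite -[in RHS](mulmxK Gun (Gam i y)) mxE; apply: eq_bigr => l _.
by rewrite mulrC; congr (_ * _); rewrite -[in LHS](G_sym Uy) -trmx_inv mxE.
Qed.

Let Rm i j y := dmx i (Gam j) y - dmx j (Gam i) y
  + Gam j y *m Gam i y - Gam i y *m Gam j y.

Let ricciE j k y : U y -> ricci G j k y = \sum_i Rm i j y k i.
Proof.
move=> Uy; rewrite /ricci.
have dchr a b c l : partial l (christoffel G a b c) y = dmx l (Gam b) y c a.
  rewrite mxE; apply: (eq_partial _ oU _ Uy) => z; rewrite inE => Uz.
  by rewrite christoffelE.
rewrite -big_split; apply: eq_bigr => i _ /=.
have subE (P Q : 'M[R]_N) : (P - Q) k i = P k i - Q k i by rewrite !mxE.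
have addE (P Q : 'M[R]_N) : (P + Q) k i = P k i + Q k i by rewrite mxE.
have mulE a b : (Gam a y *m Gam b y) k i = \sum_l christoffel G i b l y * christoffel G l a k y.
  by rewrite mxE; apply: eq_bigr => l _; rewrite !christoffelE // mulrC.
by rewrite !dchr /Rm subE addE subE !mulE sumrB addrA.
Qed.

Let Rh i j y := dmx i (Om j) y - dmx j (Om i) y + Om j y *m Om i y - Om i y *m Om j y.

Let ddC i j y : U y -> dmx i (dmx j C) y = dmx j (dmx i C) y.
Proof.
move=> Uy; apply/matrixP => a b; rewrite [LHS]mxE [RHS]mxE.
have dE l : (fun z => dmx l C z a b) = partial l (fun z => C z a b).
  by apply/funext => z; rewrite mxE.
rewrite !dE; exact: (partial_swap _ _ oU Uy (sC a b)).
Qed.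

Let dGamC i j y : U y -> dmx i (Gam j) y *m C y + Gam j y *m dmx i C y =
  dmx i (dmx j C) y + (dmx i C y *m Om j y + C y *m dmx i (Om j) y).
Proof.
move=> Uy.
have dC := mCinf_diff sC Uy.
have dGa := mCinf_diff (sGam j) Uy; have dO := mCinf_diff (sOm j) Uy.
have ddCj := mCinf_diff (mCinf_dmx j sC) Uy.
rewrite -dmxM // -dmxM // -dmxD //; last exact: mdiffM.
by apply: (eq_dmx _ oU _ Uy) => z; rewrite inE => Uz; rewrite GamC.
Qed.

Let RmC i j y : U y -> Rm i j y *m C y = C y *m Rh i j y.
Proof.
move=> Uy.
have dCE k : dmx k C y = Gam k y *m C y - C y *m Om k y by rewrite (GamC k Uy) addrK.
have Hij := dGamC i j Uy; have Hji := dGamC j i Uy.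
rewrite (ddC j i Uy) in Hji; rewrite (dCE i) in Hij; rewrite (dCE j) in Hji.
exact: gauge_curvature Hij Hji.
Qed.

Context (y : 'rV[R]_N) (Uy : U y) (D : 'I_K -> 'I_K -> 'M[R]_K).
Hypothesis dGmE : forall i b, dmx i (Gm b) y = \sum_a C y i a *: D a b.

(** The curvature endomorphism of (e_a, e_b), acting on row vectors, whence the order of the
    products. [D a b] is the derivative of [Gm b] along e_a, and the last sum is the bracket
    [e_a, e_b] as given by the vanishing torsion. *)
Definition frame_curvature a b : 'M[R]_K :=
  D a b - D b a + Gm b y *m Gm a y - Gm a y *m Gm b y
  - \sum_d (Gm a y b d - Gm b y a d) *: Gm d y.

Let dOm i j : dmx i (Om j) y =
  \sum_d partial i (fun z => C z j d) y *: Gm d y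
  + \sum_a \sum_b (C y i a * C y j b) *: D a b.
Proof.
have -> : \sum_a \sum_b (C y i a * C y j b) *: D a b = \sum_b C y j b *: dmx i (Gm b) y.
  rewrite exchange_big; apply: eq_bigr => b _ /=; rewrite dGmE scaler_sumr.
  by apply: eq_bigr => a _; rewrite scalerA mulrC.
rewrite -big_split /=; apply/matrixP => p q.
rewrite summxE mxE.
have OmE : (fun z => Om j z p q) = (fun z => \sum_a C z j a * Gm a z p q).
  by apply/funext => z; rewrite /Om summxE; apply: eq_bigr => a _; rewrite mxE.
have dG' a : differentiable (fun z => Gm a z p q) y by exact: (mCinf_diff (@sGm a) Uy).
have dC' a : differentiable (fun z => C z j a) y by exact: (mCinf_diff sC Uy).
rewrite OmE partial_sum; last by move=> a; apply: differentiableM.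
by apply: eq_bigr => a _; rewrite partialM // !mxE.
Qed.

Let RhE i j : Rh i j y = \sum_a \sum_b (C y i a * C y j b) *: frame_curvature a b.
Proof.
rewrite /Rh !dOm.
have -> : \sum_a \sum_b (C y j a * C y i b) *: D a b =
    \sum_a \sum_b (C y i a * C y j b) *: D b a.
  rewrite exchange_big; apply: eq_bigr => a _; apply: eq_bigr => b _.
  by rewrite mulrC.
have OmM k l : Om k y *m Om l y = \sum_b \sum_a (C y l a * C y k b) *: (Gm b y *m Gm a y).
  rewrite mulmx_suml; apply: eq_bigr => b _; rewrite mulmx_sumr; apply: eq_bigr => a _.
  by rewrite -scalemxAl -scalemxAr scalerA mulrC.
have -> : Om j y *m Om i y = \sum_a \sum_b (C y i a * C y j b) *: (Gm b y *m Gm a y).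
  by rewrite OmM exchange_big.
have -> : Om i y *m Om j y = \sum_a \sum_b (C y i a * C y j b) *: (Gm a y *m Gm b y).
  rewrite OmM; apply: eq_bigr => a _; apply: eq_bigr => b _.
  by rewrite (mulrC (C y j b)).
have tors : \sum_d partial i (fun z => C z j d) y *: Gm d y -
    \sum_d partial j (fun z => C z i d) y *: Gm d y =
    - \sum_a \sum_b (C y i a * C y j b) *: \sum_d (Gm a y b d - Gm b y a d) *: Gm d y.
  have -> : \sum_a \sum_b (C y i a * C y j b) *: \sum_d (Gm a y b d - Gm b y a d) *: Gm d y =
      \sum_d (\sum_a \sum_b C y i a * C y j b * (Gm a y b d - Gm b y a d)) *: Gm d y.
    under [RHS]eq_bigr => d _ do rewrite scaler_suml.
    rewrite [RHS]exchange_big; apply: eq_bigr => a _ /=.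
    under [RHS]eq_bigr => d _ do rewrite scaler_suml.
    rewrite [RHS]exchange_big; apply: eq_bigr => b _ /=.
    by rewrite scaler_sumr; apply: eq_bigr => d _; rewrite scalerA.
  rewrite -sumrB -sumrN; apply: eq_bigr => d _.
  by rewrite -scalerBl torsion_free // scaleNr.
have -> : \sum_a \sum_b (C y i a * C y j b) *: frame_curvature a b =
    \sum_a \sum_b (C y i a * C y j b) *: D a b -
    \sum_a \sum_b (C y i a * C y j b) *: D b a +
    \sum_a \sum_b (C y i a * C y j b) *: (Gm b y *m Gm a y) -
    \sum_a \sum_b (C y i a * C y j b) *: (Gm a y *m Gm b y) -
    \sum_a \sum_b (C y i a * C y j b) *: \sum_d (Gm a y b d - Gm b y a d) *: Gm d y.
  rewrite -!(sumrB, big_split) /=; apply: eq_bigr => a _.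
  rewrite -!(sumrB, big_split) /=; apply: eq_bigr => b _.
  by rewrite -!(scalerBr, scalerDr).
set S := \sum_a \sum_b _ *: \sum_d _ in tors *.
rewrite -[in RHS]tors.
move: (\sum_d partial i _ _ *: _) (\sum_d partial j _ _ *: _) => T1 T2.
move: (\sum_a \sum_b _ *: D a b) (\sum_a \sum_b _ *: D b a) => D1 D2.
move: (\sum_a \sum_b _ *: (Gm b y *m Gm a y)) (\sum_a \sum_b _ *: (Gm a y *m Gm b y)) => P1 P2.
by apply/matrixP => a b; rewrite !mxE; ring.
Qed.

(** Coordinate curvature is the frame curvature conjugated by [C] and [B], and the double trace does
    not see the change of frame. The scalar curvature thus becomes algebraic in the connection
    coefficients and their frame derivatives. *)
Lemma moving_frame_scal :
  scal G y = \sum_a \sum_b (invmx (Gh y) *m frame_curvature a b) b a.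
Proof.
have RmE i j : Rm i j y = C y *m Rh i j y *m B y.
  by rewrite -RmC // -mulmxA CB // mulmx1.
have scalE : scal G y = \sum_i \sum_j ((B y)^T *m invmx (Gh y) *m Rh i j y *m B y) j i.
  rewrite /scal; under eq_bigr => j _.
    under eq_bigr => k _ do rewrite ricciE // mulr_sumr.
    rewrite exchange_big /=; over.
  rewrite exchange_big; apply: eq_bigr => i _; apply: eq_bigr => j _ /=.
  have -> : (B y)^T *m invmx (Gh y) *m Rh i j y *m B y = invmx (G y) *m Rm i j y.
    by rewrite RmE invG // /Gi !mulmxA -(mulmxA _ (B y) (C y)) BC // mulmx1.
  by rewrite mxE.
rewrite scalE.
have entry i j a b : ((B y)^T *m invmx (Gh y) *m ((C y i a * C y j b) *: frame_curvature a b) *m B y) j i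
   = C y j b * ((B y)^T *m invmx (Gh y) *m frame_curvature a b *m B y) j i * C y i a.
  by rewrite -scalemxAr -scalemxAl mxE -mulrA mulrC.
under eq_bigr => i _.
  under eq_bigr => j _.
    rewrite RhE mulmx_sumr mulmx_suml summxE.
    under eq_bigr => a _.
      rewrite mulmx_sumr mulmx_suml summxE.
      under eq_bigr => b _ do rewrite entry.
      over.
    over.
  rewrite exchange_big /=; over.
rewrite exchange_big; apply: eq_bigr => a _ /=.
under eq_bigr => i _ do rewrite exchange_big /=.
rewrite exchange_big; apply: eq_bigr => b _ /=.
have -> : invmx (Gh y) *m frame_curvature a b =
    (C y)^T *m ((B y)^T *m invmx (Gh y) *m frame_curvature a b *m B y) *m C y.
  by rewrite !mulmxA -trmx_mul BC // trmx1 mul1mx -mulmxA BC // mulmx1.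
rewrite [RHS]mxE; apply: eq_bigr => i _.
rewrite [in RHS]mxE mulr_suml; apply: eq_bigr => j _.
by rewrite [(C y)^T _ _]mxE.
Qed.

End MovingFrame.

(** * Levi-Civita connection of the base *)

Section Christoffel.
Context (R : realType) (n : nat) (W : set 'rV[R]_n) (g : 'rV[R]_n -> 'M[R]_n).
Hypotheses (gs : forall x, W x -> (g x)^T = g x) (oW : open W)
  (gu : forall x, W x -> g x \in unitmx) (sg : mCinf W g).

Let dgs i j k x : W x -> partial k (fun y => g y i j) x = partial k (fun y => g y j i) x.
Proof.
move=> Wx; apply: (eq_partial _ oW _ Wx) => y; rewrite inE => Wy.
by rewrite -{1}(gs Wy) mxE.
Qed.

Lemma christoffel_sym k i j x : W x -> christoffel g k i j x = christoffel g k j i x.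
Proof.
move=> Wx; rewrite /christoffel; congr (_ * _); apply: eq_bigr => l _; congr (_ * _).
by rewrite (dgs i j l Wx) [X in X - _]addrC.
Qed.

Lemma christoffel_metric k i j x : W x ->
  partial k (fun y => g y i j) x =
  \sum_l (christoffel g l k i x * g x l j + christoffel g l k j x * g x i l).
Proof.
move=> Wx.
have iS a b : invmx (g x) a b = invmx (g x) b a.
  by rewrite -{1}(gs Wx) -trmx_inv mxE.
have lower a b c : \sum_l christoffel g l a b x * g x l c =
    2^-1 * (partial a (fun y => g y b c) x + partial b (fun y => g y a c) x
     - partial c (fun y => g y a b) x).
  pose v := \row_m (partial a (fun y => g y b m) x + partial b (fun y => g y a m) x
     - partial m (fun y => g y a b) x).
  have -> : \sum_l christoffel g l a b x * g x l c =
      2^-1 * (v *m invmx (g x) *m g x) 0 c.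
    rewrite mxE mulr_sumr; apply: eq_bigr => l _.
    rewrite /christoffel -mulrA; congr (_ * (_ * _)).
    rewrite mxE; apply: eq_bigr => m _.
    by rewrite mulrC iS [in RHS]mxE.
  by rewrite mulmxKV ?gu // mxE.
rewrite big_split /= lower.
have -> : \sum_l christoffel g l k j x * g x i l = \sum_l christoffel g l k j x * g x l i.
  by apply: eq_bigr => l _; rewrite -[in LHS](gs Wx) mxE.
rewrite lower (dgs j i k Wx).
set p := partial k _ _; set q := partial _ _ _; set r := partial _ _ _.
rewrite -mulrDr (_ : _ + _ = 2 * p); last by ring.
by rewrite mulKf ?pnatr_eq0.
Qed.

Lemma Cinf_christoffel k i j : Cinf W (christoffel g k i j).
Proof.
move=> m; apply: CkM => //; first exact: Ck_cst.
apply: Ck_sum => // l _; apply: CkM => //; first exact: (mCinf_inv oW gu sg).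
have pc a b c : Ck m W (partial a (fun y => g y b c)) by exact: (Cinf_partial a (sg b c) m).
by apply: CkB => //; apply: CkD.
Qed.

Lemma Cinf_scal : Cinf W (scal g).
Proof.
move=> m; apply: Ck_sum => // j _; apply: Ck_sum => // k _.
apply: CkM => //; first exact: (mCinf_inv oW gu sg).
have pc a b c d : Ck m W (partial d (christoffel g a b c)).
  exact: (Cinf_partial d (@Cinf_christoffel a b c) m).
apply: CkD => //.
  by apply: Ck_sum => // i _; apply: CkB.
apply: Ck_sum => // i _; apply: Ck_sum => // l _.
by apply: CkB => //; apply: CkM => //; exact: Cinf_christoffel.
Qed.
End Christoffel.

Section SplitIndex.
Context (n : nat).

(** Index of the coframe of the ansatz: base directions, then [true] for dz and [false] for
    theta. *)
Definition split2 (a : 'I_(n + 2)) : 'I_n + bool :=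
  match fintype.split a with inl m => inl m | inr s => inr (s == 0) end.

Lemma sum_split2 (R : nmodType) (f : 'I_n + bool -> R) :
  \sum_a f (split2 a) = \sum_m f (inl m) + (f (inr true) + f (inr false)).
Proof.
rewrite big_split_ord /=; congr (_ + _).
  by apply: eq_bigr => m _; rewrite /split2 (fintype.unsplitK (inl m)).
rewrite !big_ord_recl big_ord0 addr0.
by rewrite /split2 !(fintype.unsplitK (inr _)).
Qed.
End SplitIndex.

(** * Scalar curvature of the Calabi ansatz *)

Lemma sum_deltal (R : comPzRingType) n (f : 'I_n -> R) c m :
  \sum_k c * (m == k)%:R * f k = c * f m.
Proof.
rewrite (bigD1 m) //= eqxx mulr1 big1 ?addr0 // => k.
by rewrite eq_sym => /negPf ->; rewrite mulr0 mul0r.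
Qed.

Lemma sum_deltar (R : comPzRingType) n (f : 'I_n -> R) c m :
  \sum_k f k * (c * (m == k)%:R) = c * f m.
Proof. by rewrite -[RHS]sum_deltal; apply: eq_bigr => k _; rewrite mulrC. Qed.

Section CalabiCurvature.
Context (R : realType) (N n : nat) (U : set 'rV[R]_N) (W : set 'rV[R]_n) (I : set R).
Context (F : 'rV[R]_N -> 'rV[R]_n) (z : 'rV[R]_N -> R) (th : 'rV[R]_N -> 'cV[R]_N).
Context (g : 'rV[R]_n -> 'M[R]_n) (J : 'M[R]_n).
Hypotheses (oU : open U) (oW : open W)
  (FW : forall y, U y -> W (F y)) (zI : forall y, U y -> I (z y))
  (sF : forall m, Cinf U (fun y => F y 0 m)) (sz : Cinf U z) (sth : mCinf U th)
  (gs : forall x, W x -> (g x)^T = g x) (gu : forall x, W x -> g x \in unitmx)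
  (sg : mCinf W g).
Hypotheses (Jg : forall x, W x -> (J *m g x)^T = - (J *m g x))
  (JJ : J *m J = - 1%:M) (trJ : \tr J = 0).
Hypothesis dth : forall y i j, U y -> extd th y i j =
  \sum_m \sum_v partial i (fun y => F y 0 m) y * partial j (fun y => F y 0 v) y
    * (J *m g (F y)) m v.

Context (al be ga a1 qb e b1 c1 d1 uno : R -> R).
Hypotheses (sal : Cinf I al) (sbe : Cinf I be) (sga : Cinf I ga) (sa1 : Cinf I a1)
  (sqb : Cinf I qb) (se : Cinf I e) (sb1 : Cinf I b1) (sc1 : Cinf I c1) (sd1 : Cinf I d1).
Hypotheses (al0 : forall t, I t -> al t != 0) (be0 : forall t, I t -> be t != 0)
  (ga0 : forall t, I t -> ga t != 0)
  (a1E : forall t, I t -> 'D_1 al t = 2 * a1 t * al t)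
  (qbE : forall t, I t -> 'D_1 al t = 2 * qb t * be t)
  (eE : forall t, I t -> ga t = 2 * e t * al t)
  (b1E : forall t, I t -> 'D_1 be t = 2 * b1 t * be t)
  (c1E : forall t, I t -> 'D_1 ga t = 2 * c1 t * ga t)
  (d1E : forall t, I t -> 'D_1 ga t = 2 * d1 t * be t).

(* Opaque names for a constant function, the Christoffel symbols of the base and
   the partial derivatives on the base, which the unifier must not unfold. *)
Context (chr : 'I_n -> 'I_n -> 'I_n -> 'rV[R]_n -> R)
  (pd : 'I_n -> ('rV[R]_n -> R) -> 'rV[R]_n -> R).
Hypotheses (unoE : uno = cst 1) (chrE : chr = christoffel g) (pdE : pd = @partial R n).

Let uno_mul t u : uno t * u = u.
Proof. by rewrite unoE mul1r. Qed.

Local Notation I3 := ('I_n + bool)%type.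

Definition cof i y (a : I3) : R := match a with
  | inl m => partial i (fun y => F y 0 m) y
  | inr true => partial i z y
  | inr false => th y i 0
  end.

(** Each connection coefficient is a function of z ([gamw]) times a function on the base ([gamu]).
    The Koszul formula gives a1 = al' / 2 al, qb = al' / 2 be, e = ga / 2 al, b1 = be' / 2 be, c1 =
    ga' / 2 ga, d1 = ga' / 2 be, and the constant 1/2 comes from d theta. The quotients enter
    through product equations only, which keeps the verification free of division. *)
Definition gamw (a b c : I3) : R -> R := match a, b, c with
  | inl _, inl _, inl _ => uno
  | inl _, inl _, inr true => qb
  | inl _, inl _, inr false => cst (2^-1)
  | inl _, inr true, inl _ | inr true, inl _, inl _ => a1
  | inl _, inr false, inl _ | inr false, inl _, inl _ => e
  | inr true, inr true, inr true => b1
  | inr true, inr false, inr false | inr false, inr true, inr false => c1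
  | inr false, inr false, inr true => d1
  | _, _, _ => cst 0
  end.

Definition gamu (a b c : I3) : 'rV[R]_n -> R := match a, b, c with
  | inl m, inl v, inl r => chr r m v
  | inl m, inl v, inr true => fun x => - g x m v
  | inl m, inl v, inr false => fun x => - (J *m g x) m v
  | inl m, inr true, inl r | inr true, inl m, inl r => cst (m == r)%:R
  | inl m, inr false, inl r | inr false, inl m, inl r => cst (J m r)
  | inr false, inr false, inr true => cst (-1)
  | _, _, _ => cst 1
  end.

Definition gam y a b c : R := gamw a b c (z y) * gamu a b c (F y).

Definition ghw (b c : I3) : R -> R := match b, c with
  | inl _, inl _ => al
  | inr true, inr true => be
  | inr false, inr false => ga
  | _, _ => cst 0
  end.

Definition ghu (b c : I3) : 'rV[R]_n -> R := match b, c with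
  | inl m, inl v => fun x => g x m v
  | _, _ => cst 1
  end.

Definition gh y b c : R := ghw b c (z y) * ghu b c (F y).

(** The derivative of w(z) u(F) along the frame vector [a]; it vanishes for the vector dual to
    theta, on which dz and dF are zero. *)
Definition dd (w : R -> R) (u : 'rV[R]_n -> R) y (a : I3) : R := match a with
  | inl m => w (z y) * pd m u (F y)
  | inr true => 'D_1 w (z y) * u (F y)
  | inr false => 0
  end.

Definition calabi_coframe y : 'M[R]_(N, n + 2) := \matrix_(i, a) cof i y (split2 a).
Definition calabi_frame_metric y : 'M[R]_(n + 2) :=
  \matrix_(a, b) gh y (split2 a) (split2 b).
Definition calabi_connection (a : 'I_(n + 2)) y : 'M[R]_(n + 2) :=
  \matrix_(b, c) gam y (split2 a) (split2 b) (split2 c).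

Lemma Cinf_gamw a b c : Cinf I (gamw a b c).
Proof. by rewrite /gamw unoE; case: a b c => [m|[]] [v|[]] [r|[]] //= k; apply: Ck_cst. Qed.

Lemma Cinf_gamu a b c : Cinf W (gamu a b c).
Proof.
rewrite /gamu chrE; case: a b c => [m|[]] [v|[]] [r|[]] //=; try (by move=> k; apply: Ck_cst).
- exact: Cinf_christoffel.
- by move=> k; apply: CkN => //; apply: sg.
- by move=> k; apply: CkN => //; apply: (mCinfM oW (mCinf_cst W J) sg).
Qed.

Lemma Cinf_sep w u : Cinf I w -> Cinf W u -> Cinf U (fun y => w (z y) * u (F y)).
Proof.
move=> sw su k; apply: CkM => //.
  exact: (Ck_comp1 oU zI (sw k) (sz k)).
exact: (Ck_comp_row oU FW (su k) (fun j => sF j k)).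
Qed.

Lemma partial_sep w u i y : Cinf I w -> Cinf W u -> U y ->
  partial i (fun y => w (z y) * u (F y)) y =
  \sum_(a < n + 2) cof i y (split2 a) * dd w u y (split2 a).
Proof.
move=> sw su Uy.
have dz := Ck_diff (sz 0%N) Uy; have dF m := Ck_diff (sF m 0%N) Uy.
have dw := Ck_diff (sw 0%N) (zI Uy); have du := Ck_diff (su 0%N) (FW Uy).
have dwz : differentiable (w \o z) y by exact: differentiable_comp.
have duF : differentiable (u \o F) y.
  by apply: differentiable_comp => //; apply: differentiable_row.
rewrite (@partialM _ _ (w \o z) (u \o F)) //.
rewrite [partial i (w \o z) y]derive_comp1 // [partial i (u \o F) y]derive_comp_row //.
rewrite (sum_split2 (fun a => cof i y a * dd w u y a)) /= pdE mulr0 addr0 addrC; congr (_ + _); last by rewrite mulrAC mulrC mulrA.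
rewrite mulr_sumr; apply: eq_bigr => m _; rewrite mulrCA; congr (_ * _).
Qed.

Lemma Cinf_ghw b c : Cinf I (ghw b c).
Proof. by case: b c => [m|[]] [v|[]] //= k; apply: Ck_cst. Qed.

Lemma Cinf_ghu b c : Cinf W (ghu b c).
Proof. by case: b c => [m|[]] [v|[]] //=; try (by move=> k; apply: Ck_cst). Qed.

Lemma mCinf_calabi_coframe : mCinf U calabi_coframe.
Proof.
move=> i a; under eq_fun do rewrite mxE.
case: (split2 a) => [m|[]] /=; last exact: sth.
- exact: (Cinf_partial i (sF m)).
- exact: (Cinf_partial i sz).
Qed.

Lemma mCinf_calabi_frame_metric : mCinf U calabi_frame_metric.
Proof.
move=> a b; under eq_fun do rewrite mxE.
by apply: Cinf_sep; [apply: Cinf_ghw|apply: Cinf_ghu].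
Qed.

Lemma mCinf_calabi_connection a : mCinf U (calabi_connection a).
Proof.
move=> b c; under eq_fun do rewrite mxE.
by apply: Cinf_sep; [apply: Cinf_gamw|apply: Cinf_gamu].
Qed.

Let g_sym x m v : W x -> g x m v = g x v m.
Proof. by move=> Wx; rewrite -{1}(gs Wx) mxE. Qed.

Let Jg_skew x m v : W x -> (J *m g x) v m = - (J *m g x) m v.
Proof. by move=> Wx; have /matrixP/(_ m v) := Jg Wx; rewrite mxE [RHS]mxE. Qed.

(** Of the coframe only theta fails to be closed, so the only asymmetric coefficient is the theta
    component for two horizontal vectors, where the difference reproduces [dth]. *)
Lemma gam_torsion y a b c : U y -> gam y a b c - gam y b a c =
  match a, b, c with inl m, inl v, inr false => - (J *m g (F y)) m v | _, _, _ => 0 end.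
Proof.
move=> Uy; have Wy := FW Uy; rewrite /gam.
case: a b c => [m|[]] [v|[]] [r|[]]; rewrite /gamw /gamu /cst ?subrr //.
- by rewrite chrE (christoffel_sym gs oW r m v Wy) subrr.
- by rewrite (g_sym _ _ Wy) subrr.
- rewrite (Jg_skew m v Wy); move: ((J *m g (F y)) m v) => t.
  have half2 : 2^-1 + 2^-1 = 1 :> R by field.
  by rewrite opprK mulrN -opprD -mulrDl half2 mul1r.
Qed.

Lemma gam_metric y a b c : U y -> dd (ghw b c) (ghu b c) y a =
  (\sum_m (gam y a b (inl m) * gh y (inl m) c + gh y b (inl m) * gam y a c (inl m)))
  + (gam y a b (inr true) * gh y (inr true) c + gh y b (inr true) * gam y a c (inr true)
    + (gam y a b (inr false) * gh y (inr false) c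
       + gh y b (inr false) * gam y a c (inr false))).
Proof.
move=> Uy; have Wy := FW Uy; have Iy := zI Uy.
have two0 : 2 != 0 :> R by rewrite pnatr_eq0.
have qa : qb (z y) * be (z y) = a1 (z y) * al (z y).
  by apply: (mulfI two0); rewrite !mulrA -qbE // -a1E.
have cd : c1 (z y) * ga (z y) = d1 (z y) * be (z y).
  by apply: (mulfI two0); rewrite !mulrA -c1E // -d1E.
have D0 w v : 'D_v (cst w) (z y) = 0 :> R by rewrite derive_cst.
have P0 w m : pd m (cst w) (F y) = 0 :> R by rewrite pdE /partial derive_cst.
case: a b c => [m|[]] [v|[]] [r|[]]; rewrite /gam /gh /dd /gamw /gamu /ghw /ghu;
  rewrite ?D0 ?P0; rewrite /cst ?uno_mul;
  under eq_bigr => k _ do rewrite ?(mul0r, mulr0, add0r, addr0, uno_mul, mulr1);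
  rewrite ?big1_eq ?(mul0r, mulr0, add0r, addr0, uno_mul, mulr1) //.
- rewrite pdE chrE (christoffel_metric gs oW gu m v r Wy) mulr_sumr; apply: eq_bigr => k _.
  ring.
- by rewrite sum_deltar (g_sym v m Wy); ring: qa.
- have -> : \sum_k al (z y) * g (F y) v k * (e (z y) * J m k) =
      e (z y) * al (z y) * (J *m g (F y)) m v.
    rewrite mxE mulr_sumr; apply: eq_bigr => k _; rewrite (g_sym v k Wy); ring.
  by rewrite (eE Iy); move: ((J *m _) m v) => t; field.
- by rewrite sum_deltal; ring: qa.
- have -> : \sum_k e (z y) * J m k * (al (z y) * g (F y) k r) =
      e (z y) * al (z y) * (J *m g (F y)) m r.
    rewrite mxE mulr_sumr; apply: eq_bigr => k _; ring.
  by rewrite (eE Iy); move: ((J *m _) m r) => t; field.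
- by rewrite big_split /= sum_deltal sum_deltar (a1E Iy); ring.
- by rewrite (b1E Iy); ring.
- by rewrite (c1E Iy); ring.
- have -> : \sum_k (e (z y) * J v k * (al (z y) * g (F y) k r) +
     al (z y) * g (F y) v k * (e (z y) * J r k)) =
     e (z y) * al (z y) * ((J *m g (F y)) v r + (J *m g (F y)) r v).
    rewrite !mxE -big_split mulr_sumr /=; apply: eq_bigr => k _; rewrite (g_sym v k Wy); ring.
  by rewrite (Jg_skew v r Wy) subrr mulr0.
- by ring: cd.
- by ring: cd.
Qed.

Definition sum3 (f : I3 -> R) : R := \sum_m f (inl m) + (f (inr true) + f (inr false)).

Definition fcur y a b c d : R :=
  dd (gamw b c d) (gamu b c d) y a - dd (gamw a c d) (gamu a c d) y b
  + sum3 (fun k => gam y b c k * gam y a k d - gam y a c k * gam y b k d)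
  - sum3 (fun k => (gam y a b k - gam y b a k) * gam y k c d).

Lemma torsion_sum y a b c d : U y ->
  sum3 (fun k => (gam y a b k - gam y b a k) * gam y k c d) =
  match a, b with
  | inl m, inl v => - (J *m g (F y)) m v * gam y (inr false) c d
  | _, _ => 0 end.
Proof.
move=> Uy; rewrite /sum3 big1 ?add0r => [|m _]; last first.
  by rewrite gam_torsion //; case: a b => [?|[]] [?|[]]; rewrite mul0r.
by rewrite !gam_torsion //; case: a b => [?|[]] [?|[]]; rewrite !mul0r !add0r.
Qed.

Let Duno y : 'D_1 uno (z y) = 0.
Proof. by rewrite unoE derive_cst. Qed.

Let D0 y (w v : R) : 'D_v (cst w) (z y) = 0 :> R.
Proof. by rewrite derive_cst. Qed.

Let P0 y (w : R) m : pd m (cst w) (F y) = 0 :> R.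
Proof. by rewrite pdE /partial derive_cst. Qed.

Local Ltac fcur_simpl :=
  rewrite /fcur; match goal with H : U _ |- _ => rewrite (torsion_sum _ _ _ _ H) end;
  rewrite /sum3 /gam /dd /gamw /gamu ?D0 ?P0 ?Duno /cst;
  under eq_bigr => k _ do
    rewrite ?(mul0r, mulr0, subr0, sub0r, add0r, addr0, uno_mul, mulr1, oppr0);
  rewrite ?big1_eq ?(mul0r, mulr0, subr0, sub0r, add0r, addr0, uno_mul, mulr1, oppr0).

(** A summand of the horizontal Ricci tensor. The terms in [chr] and [pd] sum to the Ricci tensor of
    the base, those in [qb] and [a1] come from the dependence of the horizontal metric on z, and
    those in [e] from d theta. *)
Let fcur_l y r m v : U y -> fcur y (inl r) (inl m) (inl v) (inl r) =
  pd r (chr r m v) (F y) - pd m (chr r r v) (F y)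
  + \sum_k (chr r r k (F y) * chr k m v (F y) -
             chr r m k (F y) * chr k r v (F y))
  - qb (z y) * a1 (z y) * g (F y) m v + qb (z y) * a1 (z y) * ((m == r)%:R * g (F y) r v)
  - 2^-1 * e (z y) * (J *m g (F y)) m v * J r r
  + 2^-1 * e (z y) * (J m r * (J *m g (F y)) r v)
  + e (z y) * (J v r * (J *m g (F y)) r m).
Proof.
move=> Uy.
(* The claimed value is set aside under a name, so that the simplification acts on the curvature
   component alone. *)
move Erhs : (X in _ = X) => rhs; have {}Erhs := conj Erhs Logic.I.
fcur_simpl.
rewrite -Erhs.1 {rhs Erhs}.
rewrite (eqxx r).
under eq_bigr => k _ do rewrite (mulrC (chr k m v _)) (mulrC (chr k r v _)).
rewrite mulr1n; move: ((J *m _) _ _) ((J *m _) _ _) ((J *m _) _ _) => j1 j2 j3; by move: (\sum_k _) (pd _ _ _) (pd _ _ _) => S p q; ring.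
Qed.

(** After summation tr J = 0 and J^2 = -1 turn every term in [e] into a multiple of the base metric,
    their total being -e g. *)
Let ric_base y m v : U y -> sum3 (fun a => fcur y a (inl m) (inl v) a) =
  ricci g m v (F y) - g (F y) m v * ('D_1 qb (z y)
    + (n%:R * a1 (z y) + b1 (z y) + c1 (z y)) * qb (z y)
    - 2 * a1 (z y) * qb (z y) + e (z y)).
Proof.
move=> Uy; have Wy := FW Uy; rewrite /sum3.
have -> : fcur y (inr true) (inl m) (inl v) (inr true) =
    - ('D_1 qb (z y) + b1 (z y) * qb (z y)) * g (F y) m v + a1 (z y) * qb (z y) * g (F y) m v.
  move Erhs : (X in _ = X) => rhs; have {}Erhs := conj Erhs Logic.I; fcur_simpl; rewrite -Erhs.1 {rhs Erhs}.
  rewrite [X in _ + (X + _)](_ : _ = a1 (z y) * (qb (z y) * g (F y) m v)); last first.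
    rewrite -(sum_deltal (fun k => qb (z y) * g (F y) m k)).
    by apply: eq_bigr => k _; ring.
  by ring.
have -> : fcur y (inr false) (inl m) (inl v) (inr false) =
    2^-1 * e (z y) * g (F y) m v - qb (z y) * c1 (z y) * g (F y) m v.
  move Erhs : (X in _ = X) => rhs; have {}Erhs := conj Erhs Logic.I; fcur_simpl; rewrite -Erhs.1 {rhs Erhs}.
  rewrite [X in X + _](_ : _ = - (2^-1 * e (z y)) * (J *m (J *m g (F y))) v m); last first.
    rewrite mxE mulr_sumr; apply: eq_bigr => k _; rewrite (Jg_skew k m Wy).
    by move: ((J *m _) k m) => t; ring.
  by rewrite mulmxA JJ mulNmx mul1mx mxE (g_sym v m Wy); ring.
under eq_bigr => r _ do rewrite fcur_l //.
rewrite !(sumrB, big_split) /= -!mulr_sumr.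
have -> : \sum_r (m == r)%:R * g (F y) r v = g (F y) m v.
  have := sum_deltal (fun r => g (F y) r v) 1 m; rewrite mul1r => <-.
  by apply: eq_bigr => k _; rewrite mul1r.
have -> : \sum_r J r r = 0 by exact: trJ.
have -> : \sum_r J m r * (J *m g (F y)) r v = - g (F y) m v.
  by have := congr1 (fun A => (A *m g (F y)) m v) JJ; rewrite -mulmxA mulNmx mul1mx mxE [RHS]mxE.
have -> : \sum_r J v r * (J *m g (F y)) r m = - g (F y) m v.
  have := congr1 (fun A => (A *m g (F y)) v m) JJ; rewrite -mulmxA mulNmx mul1mx mxE [RHS]mxE.
  by rewrite (g_sym v m Wy).
rewrite sumr_const card_ord -[_ *+ n]mulr_natr /ricci -pdE -chrE sumrB.
move: (\sum_i pd i _ _) (\sum_i pd m _ _) (\sum_i \sum_l _) => S1 S2 S3.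
by field.
Qed.

Let ric_z y : U y -> sum3 (fun a => fcur y a (inr true) (inr true) a) =
  - n%:R * 'D_1 a1 (z y) - n%:R * a1 (z y) ^+ 2 + n%:R * a1 (z y) * b1 (z y)
  - 'D_1 c1 (z y) + b1 (z y) * c1 (z y) - c1 (z y) ^+ 2.
Proof.
move=> Uy; rewrite /sum3.
have -> : fcur y (inr true) (inr true) (inr true) (inr true) = 0.
  by fcur_simpl; ring.
have -> : fcur y (inr false) (inr true) (inr true) (inr false) =
    - 'D_1 c1 (z y) + b1 (z y) * c1 (z y) - c1 (z y) ^+ 2.
  move Erhs : (X in _ = X) => rhs; have {}Erhs := conj Erhs Logic.I.
  by fcur_simpl; rewrite -Erhs.1 {rhs Erhs}; ring.
have fl m : fcur y (inl m) (inr true) (inr true) (inl m) =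
    - 'D_1 a1 (z y) - a1 (z y) ^+ 2 + b1 (z y) * a1 (z y).
  move Erhs : (X in _ = X) => rhs; have {}Erhs := conj Erhs Logic.I.
  fcur_simpl; rewrite -Erhs.1 {rhs Erhs} eqxx mulr1n.
  rewrite [X in _ + (X + _)](_ : _ = - a1 (z y) ^+ 2); first by ring.
  have := sum_deltal (fun k => - (a1 (z y) * (k == m)%:R)) (a1 (z y)) m.
  rewrite eqxx mulr1n => sE; have -> : - a1 (z y) ^+ 2 = a1 (z y) * - (a1 (z y) * 1) by ring.
  by rewrite -sE; apply: eq_bigr => k _; ring.
under eq_bigr => m _ do rewrite fl.
by rewrite sumr_const card_ord -[_ *+ n]mulr_natr; ring.
Qed.

Let ric_t y : U y -> sum3 (fun a => fcur y a (inr false) (inr false) a) =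
  n%:R * e (z y) ^+ 2 - n%:R * a1 (z y) * d1 (z y)
  - 'D_1 d1 (z y) - b1 (z y) * d1 (z y) + c1 (z y) * d1 (z y).
Proof.
move=> Uy; rewrite /sum3.
have -> : fcur y (inr false) (inr false) (inr false) (inr false) = 0.
  by fcur_simpl; ring.
have -> : fcur y (inr true) (inr false) (inr false) (inr true) =
    - 'D_1 d1 (z y) - b1 (z y) * d1 (z y) + c1 (z y) * d1 (z y).
  move Erhs : (X in _ = X) => rhs; have {}Erhs := conj Erhs Logic.I.
  by fcur_simpl; rewrite -Erhs.1 {rhs Erhs}; ring.
have fl m : fcur y (inl m) (inr false) (inr false) (inl m) =
    - e (z y) ^+ 2 * (J *m J) m m - a1 (z y) * d1 (z y).
  move Erhs : (X in _ = X) => rhs; have {}Erhs := conj Erhs Logic.I.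
  fcur_simpl; rewrite -Erhs.1 {rhs Erhs} eqxx mulr1n.
  rewrite [X in X + _](_ : _ = - e (z y) ^+ 2 * (J *m J) m m); first by ring.
  by rewrite mxE mulr_sumr; apply: eq_bigr => k _; ring.
under eq_bigr => m _ do rewrite fl JJ mxE mxE eqxx mulr1n.
by rewrite sumr_const card_ord -[_ *+ n]mulr_natr; ring.
Qed.

Lemma split2_inj : injective (@split2 n).
Proof.
move=> a b; rewrite /split2 -{2}(fintype.splitK a) -{2}(fintype.splitK b).
case: (fintype.split a) => [i|i]; case: (fintype.split b) => [j|j] //= [].
  by move=> ->.
have S2 (k : 'I_2) : k = 0 \/ k = 1.
  by case: k => [[|[|]]] // ?; [left|right]; apply/val_inj.
by case: (S2 i) => ->; case: (S2 j) => ->.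
Qed.

Let gih y (b c : I3) : R := match b, c with
  | inl m, inl v => (al (z y))^-1 * invmx (g (F y)) m v
  | inr true, inr true => (be (z y))^-1
  | inr false, inr false => (ga (z y))^-1
  | _, _ => 0
  end.

Let frame_inv y : U y ->
  (\matrix_(a, b) gih y (split2 a) (split2 b)) *m calabi_frame_metric y = 1%:M.
Proof.
move=> Uy; have Iy := zI Uy; have Wy := FW Uy; apply/matrixP => a c; rewrite !mxE.
under eq_bigr => b _ do rewrite !mxE.
rewrite (sum_split2 (fun b => gih y (split2 a) b * gh y b (split2 c))).
have -> : (a == c) = (split2 a == split2 c) by rewrite (inj_eq split2_inj).
move: (split2 a) (split2 c) => {a c} a c; rewrite /gh.
case: a c => [m|[]] [v|[]]; rewrite /gih /ghw /ghu /cst.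
all: try by rewrite ?big1 ?(mul0r, mulr0, addr0, add0r, mulr1) // => k _;
  rewrite ?(mul0r, mulr0).
- have -> : (inl m == inl v :> I3) = (m == v) by [].
  have := congr1 (fun A : 'M[R]_n => A m v) (mulVmx (gu Wy)); rewrite !mxE => <-.
  rewrite !mul0r !addr0; apply: eq_bigr => k _.
  by rewrite -mulrA [_ * (al _ * _)]mulrCA !mulrA mulVf ?al0 // mul1r.
- rewrite big1 ?(mul0r, addr0, add0r, mulr1) ?mulVf ?be0 // => k _.
- rewrite big1 ?(mul0r, addr0, add0r, mulr1) ?mulVf ?ga0 // => k _.
Qed.

Context (B : 'rV[R]_N -> 'M[R]_(n + 2, N)).
Hypotheses (CB : forall y, U y -> calabi_coframe y *m B y = 1%:M)
  (BC : forall y, U y -> B y *m calabi_coframe y = 1%:M) (sB : mCinf U B).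

(** The frame metric is block diagonal, so only the three diagonal blocks of the Ricci tensor
    contribute. The base dimension stays free here; the value 4 enters with [weights_scal]. *)
Lemma calabi_scal G y : (forall y, U y ->
    G y = calabi_coframe y *m calabi_frame_metric y *m (calabi_coframe y)^T) -> U y ->
  scal G y = (al (z y))^-1 * (scal g (F y) - n%:R * ('D_1 qb (z y)
    + (n%:R * a1 (z y) + b1 (z y) + c1 (z y)) * qb (z y)
    - 2 * a1 (z y) * qb (z y) + e (z y)))
  + (be (z y))^-1 * (- n%:R * 'D_1 a1 (z y) - n%:R * a1 (z y) ^+ 2
      + n%:R * a1 (z y) * b1 (z y)
      - 'D_1 c1 (z y) + b1 (z y) * c1 (z y) - c1 (z y) ^+ 2)
  + (ga (z y))^-1 * (n%:R * e (z y) ^+ 2 - n%:R * a1 (z y) * d1 (z y)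
      - 'D_1 d1 (z y) - b1 (z y) * d1 (z y) + c1 (z y) * d1 (z y)).
Proof.
move=> GE Uy.
have ghs x : U x -> (calabi_frame_metric x)^T = calabi_frame_metric x.
  move=> Ux; apply/matrixP => a c; rewrite !mxE /gh.
  case: (split2 a) (split2 c) => [m|[]] [v|[]] //=.
  by rewrite (g_sym v m (FW Ux)).
have ghun x : U x -> calabi_frame_metric x \in unitmx.
  by move=> Ux; have [] := mulmx1_unit (frame_inv Ux).
pose D a b : 'M[R]_(n + 2) := \matrix_(c, d)
  dd (gamw (split2 b) (split2 c) (split2 d)) (gamu (split2 b) (split2 c) (split2 d)) y (split2 a).
have tf x i j c : U x ->
    partial i (fun y => calabi_coframe y j c) x - partial j (fun y => calabi_coframe y i c) x =
    - \sum_a \sum_b calabi_coframe x i a * calabi_coframe x j b *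
        (calabi_connection a x b c - calabi_connection b x a c).
  move=> Ux.
  have -> : \sum_a \sum_b calabi_coframe x i a * calabi_coframe x j b *
      (calabi_connection a x b c - calabi_connection b x a c) =
    \sum_(a < n + 2) \sum_(b < n + 2) cof i x (split2 a) * cof j x (split2 b) *
      (gam x (split2 a) (split2 b) (split2 c) - gam x (split2 b) (split2 a) (split2 c)).
    by apply: eq_bigr => a _; apply: eq_bigr => b _; rewrite !mxE.
  have CE k : (fun y => calabi_coframe y k c) = (fun y => cof k y (split2 c)).
    by apply/funext => x'; rewrite mxE.
  rewrite !CE {CE}; move: (split2 c) => {}c.
  rewrite (sum_split2 (fun a => \sum_(b < n + 2) cof i x a * cof j x (split2 b) *
    (gam x a (split2 b) c - gam x (split2 b) a c))).
  under eq_bigr => m _.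
    rewrite (sum_split2 (fun b => cof i x (inl m) * cof j x b * (gam x (inl m) b c - gam x b (inl m) c))).
    rewrite !gam_torsion // !mulr0 !addr0.
    under eq_bigr => v _ do rewrite gam_torsion //.
    over.
  rewrite [X in - (_ + (X + _))]big1 ?add0r => [|b _]; last first.
    by rewrite gam_torsion // mulr0.
  rewrite [X in - (_ + X)]big1 ?addr0 => [|b _]; last first.
    by rewrite gam_torsion // mulr0.
  case: c => [r|[]] /=.
  - rewrite (partial_swap _ _ oU Ux (sF r)) subrr big1 ?oppr0 // => m _.
    by rewrite big1 // => v _; rewrite mulr0.
  - rewrite (partial_swap _ _ oU Ux sz) subrr big1 ?oppr0 // => m _.
    by rewrite big1 // => v _; rewrite mulr0.
  - have := dth i j Ux; rewrite mxE => ->; rewrite -sumrN; apply: eq_bigr => m _.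
    by rewrite -sumrN; apply: eq_bigr => v _; rewrite mulrN opprK.
have mc x k : U x -> dmx k calabi_frame_metric x = \sum_a calabi_coframe x k a *:
    (calabi_connection a x *m calabi_frame_metric x
     + calabi_frame_metric x *m (calabi_connection a x)^T).
  move=> Ux; apply/matrixP => b c; rewrite mxE summxE.
  have -> : (fun y => calabi_frame_metric y b c) = (fun y => gh y (split2 b) (split2 c)).
    by apply/funext => x'; rewrite mxE.
  rewrite (partial_sep k (Cinf_ghw _ _) (Cinf_ghu _ _) Ux); apply: eq_bigr => a _.
  rewrite gam_metric // !mxE; congr (_ * _).
  rewrite -big_split /=.
  rewrite -(sum_split2 (fun d => gam x (split2 a) (split2 b) d * gh x d (split2 c)
     + gh x (split2 b) d * gam x (split2 a) (split2 c) d)).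
  by apply: eq_bigr => d _; rewrite !mxE.
have dGE i b : dmx i (calabi_connection b) y = \sum_a calabi_coframe y i a *: D a b.
  apply/matrixP => c d; rewrite mxE summxE.
  have -> : (fun y => calabi_connection b y c d) =
      (fun y => gam y (split2 b) (split2 c) (split2 d)).
    by apply/funext => x'; rewrite mxE.
  rewrite (partial_sep i (Cinf_gamw _ _ _) (Cinf_gamu _ _ _) Uy); apply: eq_bigr => a _.
  by rewrite !mxE.
rewrite (moving_frame_scal oU CB BC GE ghun ghs mCinf_calabi_coframe sB
  mCinf_calabi_frame_metric mCinf_calabi_connection tf mc Uy dGE).
have fcE a b c d : frame_curvature calabi_connection y D a b c d =
    fcur y (split2 a) (split2 b) (split2 c) (split2 d).
  rewrite /frame_curvature /fcur.
  have subE (P Q : 'M[R]_(n + 2)) : (P - Q) c d = P c d - Q c d by rewrite !mxE.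
  have addE (P Q : 'M[R]_(n + 2)) : (P + Q) c d = P c d + Q c d by rewrite mxE.
  rewrite !subE addE subE [D a b c d]mxE [D b a c d]mxE; congr (_ - _).
    rewrite -addrA; congr (_ + _); rewrite /sum3 -(sum_split2 (fun k => gam y (split2 b) (split2 c) k * gam y (split2 a) k (split2 d)
      - gam y (split2 a) (split2 c) k * gam y (split2 b) k (split2 d))).
    by rewrite !mxE -sumrB; apply: eq_bigr => k _; rewrite !mxE.
  rewrite summxE /sum3 -(sum_split2 (fun k => (gam y (split2 a) (split2 b) k
     - gam y (split2 b) (split2 a) k) * gam y k (split2 c) (split2 d))).
  by apply: eq_bigr => k _; rewrite !mxE.
have giE : invmx (calabi_frame_metric y) = \matrix_(a, b) gih y (split2 a) (split2 b).
  have [_ gu'] := mulmx1_unit (frame_inv Uy).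
  by rewrite -[RHS](mulmxK gu') frame_inv // mul1mx.
have -> : \sum_a \sum_b (invmx (calabi_frame_metric y) *m
    frame_curvature calabi_connection y D a b) b a =
  \sum_(b < n + 2) \sum_(c < n + 2) gih y (split2 b) (split2 c) *
     sum3 (fun a => fcur y a (split2 b) (split2 c) a).
  rewrite exchange_big; apply: eq_bigr => b _ /=.
  under eq_bigr => a _ do rewrite mxE.
  rewrite exchange_big; apply: eq_bigr => c _ /=.
  rewrite /sum3 -(sum_split2 (fun a => fcur y a (split2 b) (split2 c) a)) mulr_sumr.
  by apply: eq_bigr => a _; rewrite fcE giE mxE.
pose ric b c := sum3 (fun a => fcur y a b c a).
rewrite (sum_split2 (fun b => \sum_(c < n + 2) gih y b (split2 c) * ric b (split2 c))).
have row b : \sum_(c < n + 2) gih y b (split2 c) * ric b (split2 c) =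
    \sum_m gih y b (inl m) * ric b (inl m) +
    (gih y b (inr true) * ric b (inr true) + gih y b (inr false) * ric b (inr false)).
  exact: (sum_split2 (fun c => gih y b c * ric b c)).
rewrite !row /=.
rewrite [X in _ + ((X + _) + _)]big1 => [|k _]; last by rewrite mul0r.
rewrite [X in _ + (_ + (X + _))]big1 => [|k _]; last by rewrite mul0r.
have rz : ric (inr true) (inr true) = _ := ric_z Uy.
have rt : ric (inr false) (inr false) = _ := ric_t Uy.
rewrite !(mul0r, addr0, add0r) rz rt -[RHS]addrA; congr (_ + _).
set T := (X in n%:R * X).
have base m : \sum_(c < n + 2) gih y (inl m) (split2 c) * ric (inl m) (split2 c) =
    (al (z y))^-1 * (\sum_v invmx (g (F y)) m v * ricci g m v (F y)
      - T * \sum_v invmx (g (F y)) m v * g (F y) v m).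
  rewrite row /= !mul0r !addr0 mulr_sumr -sumrB mulr_sumr; apply: eq_bigr => v _.
  by rewrite /ric ric_base // (g_sym v m (FW Uy)) -/T; ring.
under eq_bigr => m _ do rewrite base.
rewrite -mulr_sumr sumrB -mulr_sumr. congr (_ * (_ - _)).
rewrite mulrC; congr (_ * _).
have := mxtrace1 R n; rewrite -(mulVmx (gu (FW Uy))) => <-.
by apply: eq_bigr => m _; rewrite mxE.
Qed.

End CalabiCurvature.

(** * Momentum profiles and their changes of variable *)

Section Profile.
Context (R : realType).
Implicit Types (d t : R) (Th : R -> R).

Definition profile_on d Th :=
  [/\ Cinf (J d) Th, (forall t, -1 < t < 1 -> 0 < Th t), Th (-1) = 0 /\ Th 1 = 0
    & 'D_1 Th (-1) = 2 /\ 'D_1 Th 1 = -2].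

Lemma hadamard2 d f : 0 < d -> Cinf (J d) f -> f (-1) = 0 -> f 1 = 0 ->
  exists q, [/\ Cinf (J d) q, (forall t, J d t -> f t = (1 - t ^+ 2) * q t),
    q (-1) = 'D_1 f (-1) / 2 & q 1 = - 'D_1 f 1 / 2].
Proof.
move=> d0 sf f0 f1.
have JN1 : J d (-1) by apply: J_cc => //; lra.
have J1 : J d 1 by apply: J_cc => //; lra.
have [h1 [sh1 h1E h1a]] := hadamard (@open_J R d) JN1 sf f0.
have h11 : h1 1 = 0.
  have /eqP := h1E 1 J1; rewrite f1 eq_sym mulf_eq0 opprK => /orP[|/eqP//].
  by rewrite -mulr2n pnatr_eq0.
have [h2 [sh2 h2E h2a]] := hadamard (@open_J R d) J1 sh1 h11.
exists (fun t => - h2 t); split.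
- by move=> k; apply: (CkN (@open_J R d)); apply: sh2.
- by move=> t Jt; rewrite h1E // h2E //; ring.
- by rewrite -h1a h2E //; field.
- have dh := derM (derB (der_id 1) (der_cst 1 (-1))) (der_Cinf sh1 J1).
  have -> : 'D_1 f 1 = 2 * h2 1.
    have : is_derive (1 : R) (1 : R) f (2 * h2 1).
      apply: (der_open (@open_J R d) J1 (f := fun t => (t - -1) * h1 t)).
        by move=> s Js; rewrite h1E.
      by apply: (der_eq dh); rewrite h11 -h2a mulr0 add0r opprK.
    by move=> H; rewrite derive_val.
  by field.
Qed.

Lemma continuous_near (f : R -> R) (a : R) d : Cinf (J d) f -> J d a -> 0 < f a ->
  \forall t \near a, 0 < f t.
Proof.
move=> sf Ja fa; have df : differentiable f a by exact: (Ck_diff (sf 0%N) Ja).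
exact: (cvgr_gt _ (differentiable_continuous df)).
Qed.

(** The slopes 2 and -2 say exactly that the quotient [v] equals 1 at both ends, so 1 - v is
    divisible by 1 - t^2 in turn. This second division makes 1 / Th - 1 / (1 - t^2) smooth. *)
Lemma profile_factor d Th : 0 < d -> profile_on d Th -> exists d' v q,
  [/\ 0 < d' <= d, Cinf (J d') v, Cinf (J d') q, (forall t, J d' t -> 0 < v t) &
   (forall t, J d' t -> Th t = (1 - t ^+ 2) * v t /\ 1 - v t = (1 - t ^+ 2) * q t)].
Proof.
move=> d0 [sT Tpos [T0 T1] [dT0 dT1]].
have [v [sv vE va vb]] := hadamard2 d0 sT T0 T1.
have v0 : v (-1) = 1 by rewrite va dT0 divff ?pnatr_eq0.
have v1 : v 1 = 1 by rewrite vb dT1 opprK divff ?pnatr_eq0.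
have sv1 : Cinf (J d) (fun t => 1 - v t).
  by move=> k; apply: (CkB (@open_J R d)); [exact: Ck_cst|exact: sv].
have [||q [sq qE _ _]] := hadamard2 d0 sv1; rewrite ?v0 ?v1 ?subrr //.
have JN1 : J d (-1) by apply: J_cc => //; lra.
have J1 : J d 1 by apply: J_cc => //; lra.
have [t tI|||d' d'0 vpos] := @near_J R (fun t => 0 < v t) d d0.
- have Jt : J d t by apply: J_cc => //; case/andP: tI => ? ?; rewrite !ltW.
  have := Tpos t tI; rewrite vE // pmulr_rgt0 //.
  by case/andP: tI => a b; have -> : 1 - t ^+ 2 = (1 - t) * (1 + t) by [ring]; rewrite mulr_gt0 //; lra.
- by apply: (continuous_near sv JN1); rewrite v0.
- by apply: (continuous_near sv J1); rewrite v1.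
have sJ : J d' `<=` J d by apply: sub_J; case/andP: d'0.
exists d', v, q; split=> //; try by move=> k; apply: (sub_Ck sJ).
by move=> t /sJ Jt; rewrite -vE // -qE.
Qed.

(** The equation says that log((1 + T) / (1 - T)) is a primitive of 2 / Th. Subtracting log((1 + t)
    / (1 - t)) leaves the smooth integrand 2 q / v, called [eta]. With [E] the exponential of its
    primitive, (1 + T) / (1 - T) = E (1 + t) / (1 - t); solved for T, this is the quotient of [N] by
    [D], smooth across -1 and 1. *)
Lemma profile_normalize d Th : 0 < d -> profile_on d Th -> exists d' T,
  [/\ 0 < d' <= d, Cinf (J d') T, (forall t, J d' t -> 0 < 'D_1 T t),
      T (-1) = -1 /\ T 1 = 1
    & (forall t, J d' t -> 'D_1 T t * Th t = 1 - T t ^+ 2)].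
Proof.
move=> d0 pT; have [d1 [v [q [/andP[d10 d1d] sv sq vpos vq]]]] := profile_factor d0 pT.
have oJ := @open_J R d1.
have v0 t : J d1 t -> v t != 0 by move=> /vpos/lt0r_neq0.
pose eta t := 2 * (q t * (v t)^-1).
have seta : Cinf (J d1) eta.
  move=> k; apply: (CkM oJ); first exact: Ck_cst.
  by apply: (CkM oJ); [exact: sq|apply: (CkV oJ) => //; exact: sv].
have [I dI] := antiderivative d10 seta.
pose d2 := d1 / 2; have d20 : 0 < d2 by rewrite divr_gt0.
have J21 : J d2 `<=` J d1 by apply: sub_J; rewrite /d2; lra.
have oJ2 := @open_J R d2.
have sI : Cinf (J d2) I.
  move=> [|k]; last by apply: (Ck_der oJ2 dI); apply: (sub_Ck J21).
  by split=> // t Jt; apply/derivable1_diffP; have := dI t Jt.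
pose E t := expR (I t).
have dE t : J d2 t -> is_derive t 1 E (E t * eta t).
  by move=> Jt; exact: der_comp (dI t Jt) (is_derive_expR _).
have sE : Cinf (J d2) E.
  move=> k; exact: (Ck_comp1 (W := setT) oJ2 (fun _ _ => Logic.I) (expR_Ck R k) (sI k)).
pose N t := (1 + t) * E t - (1 - t); pose D t := (1 + t) * E t + (1 - t).
have sid k U : Ck k U (fun t : R => t).
  case: k => [|k]; first by split=> // t _; apply/derivable1_diffP.
  have := @Ck_der R setT (fun t : R => t) (cst 1) k openT (fun t _ => der_id t) (Ck_cst _ _ _).
  by apply: sub_Ck.
have sA k : Ck k (J d2) (fun t => (1 + t) * E t).
  apply: (CkM oJ2); last exact: sE.
  by apply: (CkD oJ2); [exact: Ck_cst|exact: sid].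
have sB k : Ck k (J d2) (fun t : R => 1 - t).
  by apply: (CkB oJ2); [exact: Ck_cst|exact: sid].
have sD : Cinf (J d2) D by move=> k; apply: (CkD oJ2).
have sN : Cinf (J d2) N by move=> k; apply: (CkB oJ2).
have JN1 : J d2 (-1) by apply: J_cc => //; lra.
have J1 : J d2 1 by apply: J_cc => //; lra.
have DN1 : D (-1) = 2 by rewrite /D subrr mul0r; ring.
have D1 : D 1 = 2 * E 1 by rewrite /D; ring.
have [t /andP[ta tb]|||d3 /andP[d30 d32] Dpos] := @near_J R (fun t => 0 < D t) d2 d20.
- by rewrite /D addr_gt0 ?mulr_gt0 ?expR_gt0 //; lra.
- by apply: (continuous_near sD JN1); rewrite DN1.
- by apply: (continuous_near sD J1); rewrite D1 mulr_gt0 // expR_gt0.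
have J32 : J d3 `<=` J d2 by exact: sub_J.
have oJ3 := @open_J R d3.
have D0 t : J d3 t -> D t != 0 by move=> /Dpos/lt0r_neq0.
exists d3, (fun t => N t * (D t)^-1).
have dT t : J d3 t -> is_derive t 1 (fun t => N t * (D t)^-1) (4 * E t / (v t * D t ^+ 2)).
  move=> Jt; have Jt2 := J32 _ Jt; have Jt1 := J21 _ Jt2.
  have dA := derM (derD (der_cst t 1) (der_id t)) (dE t Jt2).
  have dB := derB (der_cst t 1) (der_id t).
  apply: (der_eq (derM (derB dA dB) (derV (D0 t Jt) (derD dA dB)))).
  have [_ vq'] := vq t Jt1; have := v0 t Jt1; have := D0 t Jt.
  have etaE : (1 - t ^+ 2) * eta t = 2 * (1 - v t) / v t.
    by rewrite vq' /eta; field; exact: v0.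
  move: etaE; rewrite /N /D; move: (E t) (eta t) (v t) => e h w hE D0' w0.
  set D' := (1 + t) * e + (1 - t) in D0' *.
  have -> : forall a b c : R, a * D'^-1 + b * (- c / D' ^+ 2) = (a * D' - b * c) / D' ^+ 2.
    by move=> a b c; field.
  have -> : ((0 + 1) * e + (1 + t) * (e * h) - (0 - 1)) * D'
      - ((1 + t) * e - (1 - t)) * ((0 + 1) * e + (1 + t) * (e * h) + (0 - 1)) =
      2 * e * (2 + (1 - t ^+ 2) * h) by rewrite /D'; ring.
  by rewrite hE; move: D' D0' => D' D0'; field; rewrite w0 D0'.
split.
- by rewrite d30 (le_trans d32) // (le_trans _ d1d) // /d2; lra.
- move=> k; apply: (CkM oJ3); first by apply: (sub_Ck J32).
  by apply: (CkV oJ3) => //; apply: (sub_Ck J32).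
- move=> t Jt; have Ht := dT t Jt; rewrite derive_val.
  have vp := vpos t (J21 _ (J32 _ Jt)); have Dp := Dpos t Jt.
  by rewrite divr_gt0 ?mulr_gt0 ?expR_gt0 ?exprn_gt0.
- by rewrite /N /D; split; field; rewrite ?gt_eqF ?expR_gt0.
- move=> t Jt; have Ht := dT t Jt; rewrite derive_val.
  have [-> _] := vq t (J21 _ (J32 _ Jt)); have := v0 t (J21 _ (J32 _ Jt)); have := D0 t Jt.
  rewrite /N /D; move: (E t) (v t) => e w D0' w0; field.
  by rewrite D0' w0.
Qed.

Lemma J_increasing d (T : R -> R) : Cinf (J d) T ->
  (forall t, J d t -> 0 < 'D_1 T t) ->
  forall s t, J d s -> J d t -> s < t -> T s < T t.
Proof.
move=> sT Tpos s t Js Jt st.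
have inJ c : s <= c <= t -> J d c.
  by move: Js Jt; rewrite /J /= => /andP[? _] /andP[_ ?] /andP[? ?]; lra.
have [||c] := @MVT R T ('D_1 T) s t st.
- move=> c; rewrite in_itv /= => /andP[/ltW sc /ltW ct].
  by apply: (der_Cinf sT); apply: inJ; rewrite sc.
- apply: derivable_within_continuous => c; rewrite in_itv /= => /inJ Jc.
  by have := der_Cinf sT Jc.
rewrite in_itv /= => /andP[/ltW sc /ltW ct] E.
rewrite -subr_gt0 E mulr_gt0 ?subr_gt0 //; apply: Tpos; apply: inJ.
by rewrite sc.
Qed.

(** Bootstrap: k' = 1 / (T' o k), so each order of regularity of [k] yields the next one. *)
Lemma inverse_Cinf d d' (T : R -> R) : 0 < d -> Cinf (J d) T ->
  (forall t, J d t -> 0 < 'D_1 T t) ->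
  (forall s, J d' s -> exists2 t, J d t & T t = s) ->
  exists k, [/\ Cinf (J d') k, (forall s, J d' s -> J d (k s) /\ T (k s) = s) &
    (forall t, J d t -> J d' (T t) -> k (T t) = t)].
Proof.
move=> d0 sT Tpos onto.
have mono := J_increasing sT Tpos.
have inj s t : J d s -> J d t -> T s = T t -> s = t.
  move=> Js Jt E; have [st|ts|//] := ltgtP s t.
    by have := mono _ _ Js Jt st; rewrite E ltxx.
  by have := mono _ _ Jt Js ts; rewrite E ltxx.
have [k kP] : exists k, forall s, J d' s -> J d (k s) /\ T (k s) = s.
  have ex s : exists t, J d' s -> J d t /\ T t = s.
    have [Js|nJ] := pselect (J d' s); last by exists 0.
    by have [t Jt Tt] := onto s Js; exists t.
  by exists (fun s => projT1 (cid (ex s))) => s; exact: projT2 (cid (ex s)).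
have kT t : J d t -> J d' (T t) -> k (T t) = t.
  by move=> Jt JT; have [Jk E] := kP _ JT; apply: inj.
exists k; split=> //.
have dk s : J d' s -> is_derive s 1 k ('D_1 T (k s))^-1.
  move=> Js; have [Jk Tk] := kP s Js.
  have nJ : \forall t \near k s, J d t.
    by apply: open_nbhs_nbhs; split=> //; exact: open_J.
  have cT t : J d t -> {for t, continuous T}.
    by move=> Jt; apply: differentiable_continuous; exact: (Ck_diff (sT 0%N) Jt).
  rewrite -{1}Tk; apply: is_derive_inverse.
  - have nJ' : \forall t \near k s, J d' (T t).
      apply: (cT _ Jk); rewrite Tk; apply: open_nbhs_nbhs; split=> //; exact: open_J.
    by move: nJ nJ'; apply: filterS2 => t; exact: kT.
  - by move: nJ; apply: filterS => t; exact: cT.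
  - exact: der_Cinf sT Jk.
  - by rewrite gt_eqF // Tpos.
have oJ := @open_J R.
elim=> [|n IH].
  by split=> // s Js; apply/derivable1_diffP; have := dk s Js.
apply: (Ck_der (oJ d') dk).
apply: (Ck_comp1 (W := J d) (F := fun t => ('D_1 T t)^-1) (oJ d')) IH.
  by move=> s /kP[].
apply: (CkV (oJ d)); last exact: (Cinf_D1 sT n).
by move=> t /Tpos/lt0r_neq0.
Qed.

Lemma J_nondecreasing d (T : R -> R) : Cinf (J d) T ->
  (forall t, J d t -> 0 < 'D_1 T t) ->
  forall s t, J d s -> J d t -> s <= t -> T s <= T t.
Proof.
move=> sT Tpos s t Js Jt; rewrite le_eqVlt => /orP[/eqP -> //|st].
exact/ltW/(J_increasing sT Tpos).
Qed.

(** With T0 and T1 the normalisations of the two profiles, psi is the inverse of T1 composed with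
    T0. Since psi fixes -1 and 1, psi - id is divisible by 1 - t^2 just as [Th0] is, so their
    quotient chi is smooth. *)
Lemma profile_change d (Th0 Th : R -> R) : 0 < d ->
  profile_on d Th0 -> profile_on d Th ->
  exists d' psi chi,
  [/\ 0 < d' <= d, Cinf (J d') psi, Cinf (J d') chi,
      (forall t, -1 <= t <= 1 -> -1 <= psi t <= 1) &
      forall t, J d' t -> [/\ 0 < 'D_1 psi t, 'D_1 psi t * Th0 t = Th (psi t)
        & chi t * Th0 t = psi t - t]].
Proof.
move=> d0 p0 p1.
have [e0 [T0 [/andP[e00 e0d] sT0 T0pos [T0a T0b] T0E]]] := profile_normalize d0 p0.
have [e1 [T1 [/andP[e10 e1d] sT1 T1pos [T1a T1b] T1E]]] := profile_normalize d0 p1.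
have oJ := @open_J R.
have JN1 e : 0 < e -> J e (-1) by move=> ep; apply: J_cc => //; lra.
have J1 e : 0 < e -> J e 1 by move=> ep; apply: J_cc => //; lra.
pose l := -1 - e1 / 2; pose r := 1 + e1 / 2.
have [Jl Jr] : J e1 l /\ J e1 r by rewrite /J /l /r /=; split; lra.
have mono := J_increasing sT1 T1pos.
have le_l : T1 l < -1 by rewrite -T1a; apply: mono => //; [exact: JN1|rewrite /l; lra].
have le_r : 1 < T1 r by rewrite -T1b; apply: mono => //; [exact: J1|rewrite /r; lra].
(* The margin by which T1 leaves [-1, 1] at [l] and [r]; by the intermediate value theorem T1
   reaches all of [J e2]. *)
pose e2 := Num.min (-1 - T1 l) (T1 r - 1).
have e20 : 0 < e2 by rewrite lt_min; apply/andP; split; lra.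
have cT1 t : J e1 t -> {for t, continuous T1}.
  by move=> Jt; apply: differentiable_continuous; exact: (Ck_diff (sT1 0%N) Jt).
have lrJ c : l <= c <= r -> J e1 c.
  by move: Jl Jr; rewrite /J /= => /andP[? _] /andP[_ ?] /andP[? ?]; lra.
have onto s : J e2 s -> exists2 t, J e1 t & T1 t = s.
  move=> /andP[sl sr].
  have [ |||c] := @IVT R T1 l r s.
  - by rewrite /l /r; lra.
  - apply: continuous_in_subspaceT => c; rewrite inE /= in_itv /= => /lrJ; exact: cT1.
  - have e2l : e2 <= -1 - T1 l by rewrite ge_min lexx.
    have e2r : e2 <= T1 r - 1 by rewrite ge_min lexx orbT.
    by rewrite min_l ?max_r; lra.
  by rewrite in_itv /= => /lrJ Jc E; exists c.
have [k [sk kP kT]] := inverse_Cinf e10 sT1 T1pos onto.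
have T0cc t : -1 <= t <= 1 -> -1 <= T0 t <= 1.
  move=> tI; have Jt := J_cc e00 tI; case/andP: tI => ta tb.
  rewrite -T0a -{2}T0b !(J_nondecreasing sT0 T0pos) //; [exact: JN1|exact: J1].
have cT0 t : J e0 t -> {for t, continuous T0}.
  by move=> Jt; apply: differentiable_continuous; exact: (Ck_diff (sT0 0%N) Jt).
have nJ2 t : J e0 t -> J e2 (T0 t) -> \forall s \near t, J e2 (T0 s).
  by move=> Jt Je; apply: (cT0 _ Jt); apply: open_nbhs_nbhs.
have [t /andP[ta tb]|||e3 /andP[e30 e3e] T0J] := @near_J R (fun t => J e2 (T0 t)) e0 e00.
- by apply: (J_cc e20); apply: T0cc; rewrite !ltW.
- by apply: nJ2; [exact: JN1|rewrite T0a; exact: JN1].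
- by apply: nJ2; [exact: J1|rewrite T0b; exact: J1].
have J30 : J e3 `<=` J e0 by exact: sub_J.
pose psi t := k (T0 t).
have spsi : Cinf (J e3) psi.
  move=> n; apply: (Ck_comp1 (oJ e3) T0J (sk n)); exact: (sub_Ck J30).
have psia : psi (-1) = -1.
  by rewrite /psi T0a -T1a kT // ?T1a; exact: JN1.
have psib : psi 1 = 1.
  by rewrite /psi T0b -T1b kT // ?T1b; exact: J1.
have psiE t : J e3 t -> 'D_1 psi t * 'D_1 T1 (psi t) = 'D_1 T0 t.
  move=> Jt; have [Jp _] := kP _ (T0J _ Jt).
  have H1 := der_comp (der_Cinf spsi Jt) (der_Cinf sT1 Jp).
  have H2 : is_derive t 1 T0 ('D_1 T1 (psi t) * 'D_1 psi t).
    apply: (der_open (oJ e3) Jt _ H1) => s Js.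
    by have [_ ->] := kP _ (T0J _ Js).
  by rewrite [RHS]derive_val mulrC.
have psi_pos t : J e3 t -> 0 < 'D_1 psi t.
  move=> Jt; have [Jp _] := kP _ (T0J _ Jt).
  by rewrite -(pmulr_lgt0 _ (T1pos _ Jp)) psiE // T0pos //; exact: J30.
have [d1 [v [q [/andP[d10 d1d] sv _ vpos vE]]]] := profile_factor d0 p0.
have sid n U : Ck n U (fun t : R => t).
  case: n => [|n]; first by split=> // t _; apply/derivable1_diffP.
  have := @Ck_der R setT (fun t : R => t) (cst 1) n openT (fun t _ => der_id t) (Ck_cst _ _ _).
  by apply: sub_Ck.
have spt : Cinf (J e3) (fun t => psi t - t).
  by move=> n; apply: (CkB (oJ e3)); [exact: spsi|exact: sid].
have pt0 : psi (-1) - -1 = 0 by rewrite psia subrr.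
have pt1 : psi 1 - 1 = 0 by rewrite psib subrr.
have [p [sp pE _ _]] := hadamard2 e30 spt pt0 pt1.
pose e4 := Num.min e3 d1.
have [e43 e41] : e4 <= e3 /\ e4 <= d1 by rewrite !ge_min !lexx orbT.
have [J43 J41] : J e4 `<=` J e3 /\ J e4 `<=` J d1 by split; apply: sub_J.
exists e4, psi, (fun t => p t * (v t)^-1); split.
- by rewrite lt_min e30 d10 /= (le_trans e41).
- by move=> n; exact: (sub_Ck J43 (spsi n)).
- move=> n; apply: (CkM (oJ e4)); first exact: (sub_Ck J43 (sp n)).
  apply: (CkV (oJ e4)); last exact: (sub_Ck J41 (sv n)).
  by move=> t /J41/vpos/lt0r_neq0.
- move=> t tI; have Jt := J_cc e30 tI; case/andP: tI => ta tb.
  have ndec s u : J e3 s -> J e3 u -> s <= u -> psi s <= psi u := J_nondecreasing spsi psi_pos (t := u).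
  have pa : psi (-1) <= psi t by apply: ndec => //; exact: JN1.
  have pb : psi t <= psi 1 by apply: ndec => //; exact: J1.
  by move: pa pb; rewrite psia psib => -> ->.
- move=> t Jt; have [J3t J1t] := (J43 _ Jt, J41 _ Jt); split.
  + exact: psi_pos.
  + have [Jp Tp] := kP _ (T0J _ J3t).
    have T1' : 'D_1 T1 (psi t) != 0 by rewrite gt_eqF // T1pos.
    apply: (mulfI T1'); rewrite (T1E _ Jp) mulrA [_ * 'D_1 psi t]mulrC (psiE _ J3t) T0E; last exact: J30.
    by rewrite /psi Tp.
  + have [-> _] := vE t J1t; rewrite (pE t J3t).
    by have := vpos t J1t => /lt0r_neq0; move: (v t) (p t) => w u w0; field.
Qed.
End Profile.

(** * A positive extension of 1 + x z *)

Section Flat.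
Context (R : realType).

(** The powers t^-k are carried along to make the family closed under differentiation: the
    derivative of [flat k] combines [flat k.+1] and [flat k.+2], and smoothness is a plain
    induction. *)
Definition flat k (t : R) : R := if 0 < t then t^-1 ^+ k * expR (- t^-1) else 0.

(** The term of order k + 2 in the exponential series at 1 / t gives a quadratic bound, hence
    derivative 0 at the origin. *)
Lemma flat_le k t : 0 < t -> flat k t <= (k.+2)`!%:R * t ^+ 2.
Proof.
move=> t0; rewrite /flat t0 expRN ler_pdivrMr ?expR_gt0 //.
have ti : 0 <= t^-1 by rewrite invr_ge0 ltW.
have f0 : 0 < (k.+2)`!%:R :> R by rewrite ltr0n fact_gt0.
have H : (t^-1) ^+ k.+2 <= (k.+2)`!%:R * expR t^-1.
  rewrite mulrC -ler_pdivrMr //; apply: le_trans (expR_ge1Dxn k.+1 ti).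
  by rewrite lerDr.
have -> : t^-1 ^+ k = t ^+ 2 * (t^-1 ^+ k.+2).
  have tn0 : t != 0 by rewrite gt_eqF.
  by rewrite [RHS]mulrC -[k.+2]addn2 exprD -mulrA -(exprMn 2 t^-1 t) mulVf // expr1n mulr1.
by rewrite -[leRHS]mulrA [leRHS]mulrCA ler_pM2l ?exprn_gt0.
Qed.

Lemma flat_ge0 k t : 0 <= flat k t.
Proof.
by rewrite /flat; case: ifP => // t0; rewrite mulr_ge0 ?expR_ge0 // exprn_ge0 // invr_ge0 ltW.
Qed.

Lemma is_derive_flat k (t : R) : is_derive t (1 : R) (flat k) (- k%:R * flat k.+1 t + flat k.+2 t).
Proof.
have [t0|t0|->] := ltgtP t 0.
- have -> : - k%:R * flat k.+1 t + flat k.+2 t = 0.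
    by rewrite /flat ltNge (ltW t0) /= mulr0 addr0.
  have ot : open [set s : R | s < 0] by exact: open_lt.
  apply: (der_open ot t0 (f := cst 0)) (der_cst _ _) => s /= s0.
  by rewrite /flat ltNge (ltW s0).
- have ot : open [set s : R | 0 < s] by exact: open_gt.
  have tn0 : t != 0 by rewrite gt_eqF.
  apply: (der_open ot t0 (f := fun s => s^-1 ^+ k * expR (- s^-1))).
    by move=> s /= s0; rewrite /flat s0.
  have dV : is_derive t 1 (fun s : R => s^-1) (- t^-1 ^+ 2).
    by apply: (der_eq (derV tn0 (der_id t))); rewrite exprVn mulN1r.
  have dN : is_derive t 1 (fun s => - s^-1) (t^-1 ^+ 2).
    apply: (der_open (V := setT) openT Logic.I (f := fun s => -1 * s^-1)).
      by move=> s _; rewrite mulN1r.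
    by apply: (der_eq (derZ (-1) dV)); ring.
  have dE := der_comp dN (is_derive_expR (- t^-1)).
  apply: (der_eq (derM (derX k dV) dE)); rewrite /flat t0.
  move: (expR (- t^-1)) => E; move: (t^-1) => u.
  case: k => [|k] /=; first by rewrite !mul0r expr0; ring.
  by rewrite !(exprS _ k.+2) !(exprS _ k.+1) !(exprS _ k); ring.
- have fl0 j : flat j 0 = 0 by rewrite /flat ltxx.
  rewrite !fl0 mulr0 addr0; apply: is_derive1P => e e0.
  have f0 : 0 < (k.+2)`!%:R :> R by rewrite ltr0n fact_gt0.
  apply/nbhs_ballP; exists (e / (k.+2)`!%:R); first by rewrite /= divr_gt0.
  move=> {}t; rewrite /ball /= sub0r normrN => te; rewrite fl0 mulr0 !subr0.
  have [t0|t0] := ltP 0 t; last first.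
    by rewrite /flat ltNge t0 /= normr0 mulr_ge0 // ltW.
  rewrite (ger0_norm (flat_ge0 _ _)) (gtr0_norm t0) in te *.
  apply: (le_trans (flat_le k t0)); rewrite expr2 mulrA ler_pM2r //.
  by rewrite mulrC -ler_pdivlMr // ltW.
Qed.

Lemma flat_Ck n k : Ck n setT (flat k).
Proof.
elim: n k => [|n IH] k.
  by split=> // t _; apply/derivable1_diffP; have := is_derive_flat k t.
apply: (Ck_der openT (fun t _ => is_derive_flat k t)).
by apply: (CkD openT) => //; apply: (CkM openT); [exact: Ck_cst|exact: IH].
Qed.

Lemma Ck_id n (U : set R) : Ck n U (fun t : R => t).
Proof.
case: n => [|n]; first by split=> // t _; apply/derivable1_diffP.
have := @Ck_der R setT (fun t : R => t) (cst 1) n openT (fun t _ => der_id t) (Ck_cst _ _ _).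
by apply: sub_Ck.
Qed.

(* The affine function 1 + x z is made positive on the whole line without
   changing it on z >= -1. *)
Lemma positive_extension (x : R) : 0 < x < 1 ->
  exists h : R -> R, [/\ Cinf setT h, (forall z, 0 < h z) &
    forall z, -1 <= z -> h z = 1 + x * z].
Proof.
move=> /andP[x0 x1].
(* Put t = -1 - z, so that 1 + x z = 1 - x - x t. Before t0 this exceeds (1 - x) / 2; from t0 on, K
   exp(-1/t) >= K exp(-1/t0) = x, so the added term compensates x t. *)
pose t0 := (1 - x) / (2 * x).
have t00 : 0 < t0 by rewrite /t0 divr_gt0 ?mulr_gt0 ?subr_gt0.
have E0 : 0 < expR (- t0^-1) by exact: expR_gt0.
pose K := x / expR (- t0^-1).
have K0 : 0 < K by rewrite divr_gt0.
have flatE t : 0 < t -> flat 0 t = expR (- t^-1).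
  by move=> tp; rewrite /flat tp expr0 mul1r.
exists (fun z => 1 + x * z + K * ((-1 - z) * flat 0 (-1 - z))); split.
- have s1 n : Ck n setT (fun z : R => -1 - z).
    by apply: (CkB openT); [exact: Ck_cst|exact: Ck_id].
  move=> n; apply: (CkD openT).
    apply: (CkD openT); first exact: Ck_cst.
    by apply: (CkM openT); [exact: Ck_cst|exact: Ck_id].
  apply: (CkM openT); first exact: Ck_cst.
  apply: (CkM openT) => //.
  exact: (Ck_comp1 (W := setT) openT (fun _ _ => Logic.I) (flat_Ck n 0) (s1 n)).
- move=> z; have -> : 1 + x * z = 1 - x - x * (-1 - z) by ring.
  move: (-1 - z) => t.
  have [tn|tp] := leP t 0.
    rewrite /flat [0 < t]ltNge tn /= !mulr0 addr0; nra.
  rewrite flatE //; have Et : 0 < expR (- t^-1) by exact: expR_gt0.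
  have [tt0|t0t] := ltP t t0.
    have : x * t < (1 - x) / 2.
      move: tt0; rewrite /t0 ltr_pdivlMr ?mulr_gt0 // => H; lra.
    have : 0 < K * (t * expR (- t^-1)) by apply: mulr_gt0 => //; apply: mulr_gt0.
    by move: (K * _) => q; lra.
  have le1 : expR (- t0^-1) <= expR (- t^-1).
    by rewrite ler_expR lerN2 lef_pV2 ?posrE.
  have : x * t <= K * (t * expR (- t^-1)).
    rewrite mulrCA mulrC ler_pM2l // /K mulrAC ler_pdivlMr //.
    by rewrite ler_pM2l.
  by move: (K * _) => q; lra.
- move=> z z1; rewrite /flat ltNge subr_le0 z1 /= !mulr0 addr0 //.
Qed.
End Flat.

(** * The constants of the Einstein-Maxwell profile *)

Section Root.
Context (R : realType) (x sg : R).
Hypotheses (x01 : 0 < x < 1) (sg0 : 0 <= sg).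

Local Notation A r := (1 - x * r).
Local Notation B r := ((x - r) - r * (1 - x * r)).
Local Notation E r := (- (r * (x - r))).
Local Notation M1 r := (2 * A r + 2 / 3 * E r).
Local Notation M2 r := (2 * A r ^+ 2 + 2 / 3 * (B r ^+ 2 + 2 * A r * E r) + 2 / 5 * E r ^+ 2).
Local Notation N1 r := (2 / 3 * B r).
Local Notation N2 r := (4 / 3 * (A r * B r) + 4 / 5 * (B r * E r)).
Local Notation P' r := (2 * (1 - x) ^+ 2 * (1 + r) ^+ 4).
Local Notation Q' r := (2 * (1 + x) ^+ 2 * (1 - r) ^+ 4).

(** [A], [B], [E] are the coefficients of m = (1 - r y)(1 - x r + (x - r) y) in powers of y; [M1],
    [M2] are the integrals over [-1, 1] of m and m^2, and [N1], [N2] those of y m and y m^2.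
    Eliminating C from the two equations of [em_constants] and multiplying by (1 - r^2)^5 leaves
    this polynomial, which makes sense also at r = -1 and r = 1. *)
Definition root_fun (r : R) : R :=
  M2 r * (sg * (1 - r ^+ 2) * N1 r - P' r + Q' r)
  - (sg * (1 - r ^+ 2) * M1 r + P' r + Q' r) * N2 r.

Lemma root_fun_zero : exists2 r, -1 < r < 1 & root_fun r = 0.
Proof.
have Cid n : Ck n setT (fun t : R => t) by exact: Ck_id.
have cts : continuous root_fun.
  suff C0 : Ck 0 setT root_fun.
    by move=> t; apply: differentiable_continuous; exact: (Ck_diff C0 Logic.I).
  rewrite /root_fun.
  repeat first [exact: Ck_cst | exact: Cid | apply: (CkB openT) | apply: (CkD openT)
    | apply: (CkN openT) | apply: (CkX _ openT) | apply: (CkM openT)].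
have [/andP[x0 x1]] := x01.
(* At both ends the factor 1 - r^2 removes the terms in [sg], so the signs do not depend on the
   curvature of the base. *)
have F1 : root_fun 1 < 0.
  rewrite /root_fun.
  rewrite (_ : _ - _ = - (32 * 32 / 15 * (1 - x) ^+ 4)); last by field.
  by rewrite oppr_lt0 !mulr_gt0 ?exprn_gt0 ?subr_gt0 ?invr_gt0 // ltr0n.
have F2 : 0 < root_fun (-1).
  rewrite /root_fun (_ : _ - _ = 32 * 32 / 15 * (1 + x) ^+ 4); last by field.
  by rewrite !mulr_gt0 ?exprn_gt0 ?invr_gt0 ?addr_gt0 // ltr0n.
have [|||r] := @IVT R root_fun (-1) 1 0 _ _ _.
- by lra.
- by apply: continuous_subspaceT.
- by rewrite min_r ?max_l ?(ltW F1) ?(ltW F2) // ltW // (lt_trans F1).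
rewrite in_itv /= => /andP[r1 r2] rE; exists r => //.
rewrite !lt_neqAle r1 r2 !andbT; apply/andP; split; apply/eqP => E.
  by move: F2; rewrite E rE ltxx.
by move: F1; rewrite -E rE ltxx.
Qed.

(** The target is phi'' = m (S - C m) with phi zero at -1 and 1, phi'(-1) = P and phi'(1) = -Q.
    Integrating phi'' against 1 and against y over [-1, 1] gives the two equations: the first fixes
    C because [M2] is positive, the second is then the vanishing of [root_fun]. *)
Lemma em_constants : exists r C : R, [/\ -1 < r < 1 &
  let S := sg / (1 - r ^+ 2) ^+ 4 in
  let P := 2 * (1 - x) ^+ 2 * (1 + r) ^+ 4 / (1 - r ^+ 2) ^+ 5 in
  let Q := 2 * (1 + x) ^+ 2 * (1 - r) ^+ 4 / (1 - r ^+ 2) ^+ 5 in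
  S * M1 r - C * M2 r = - (P + Q) /\ S * N1 r - C * N2 r = P - Q].
Proof.
have [r /andP[r1 r2] rE] := root_fun_zero.
have [/andP[x0 x1]] := x01.
have w0 : 0 < 1 - r ^+ 2 by nra.
have A0 : 0 < A r by nra.
have M20 : 0 < M2 r.
  (* The integral of m^2 as a sum of squares: the decomposition of m into Legendre polynomials. *)
  have -> : M2 r = 2 * (A r + E r / 3) ^+ 2 + 8 / 45 * E r ^+ 2 + 2 / 3 * B r ^+ 2 by field.
  have [E0|E0] := eqVneq (E r) 0.
    rewrite E0 mul0r addr0 expr0n /= mulr0 addr0.
    have B2 : 0 <= 2 / 3 * B r ^+ 2 by rewrite mulr_ge0 ?sqr_ge0.
    have A2 : 0 < A r ^+ 2 by rewrite exprn_gt0.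
    by move: (B r ^+ 2) (A r ^+ 2) B2 A2 => b a; lra.
  have E2 : 0 < E r ^+ 2 by rewrite lt_neqAle eq_sym sqrf_eq0 E0 sqr_ge0.
  have B2 : 0 <= B r ^+ 2 by rewrite sqr_ge0.
  have A2 : 0 <= (A r + E r / 3) ^+ 2 by rewrite sqr_ge0.
  by move: (B r ^+ 2) ((A r + E r / 3) ^+ 2) (E r ^+ 2) B2 A2 E2 => b a e; lra.
exists r, ((sg / (1 - r ^+ 2) ^+ 4 * M1 r
  + 2 * (1 - x) ^+ 2 * (1 + r) ^+ 4 / (1 - r ^+ 2) ^+ 5
  + 2 * (1 + x) ^+ 2 * (1 - r) ^+ 4 / (1 - r ^+ 2) ^+ 5) / M2 r).
split; first by rewrite r1.
move: M20 rE; rewrite /root_fun; move: (M2 r) (M1 r) (N1 r) (N2 r) => m2 m1 n1 n2 m20.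
move: (2 * (1 - x) ^+ 2 * _) (2 * (1 + x) ^+ 2 * _) (1 - r ^+ 2) w0 => p q w w0 rE /=.
have [mn wn] : m2 != 0 /\ w != 0 by rewrite !gt_eqF.
split; first by field; rewrite mn wn.
have -> : sg / w ^+ 4 * n1 - (sg / w ^+ 4 * m1 + p / w ^+ 5 + q / w ^+ 5) / m2 * n2 =
  (m2 * (sg * w * n1 - p + q) - (sg * w * m1 + p + q) * n2) / (m2 * w ^+ 5) + (p / w ^+ 5 - q / w ^+ 5).
  by field; rewrite mn wn.
by rewrite rE mul0r add0r.
Qed.
End Root.

(** * The Einstein-Maxwell profile *)

Section Sextic.
Context (R : realType).
Implicit Types (a b : R) (y z r : R).

Definition sextic a0 a1 a2 a3 a4 a5 a6 y : R :=
  a0 + a1 * y + a2 * y ^+ 2 + a3 * y ^+ 3 + a4 * y ^+ 4 + a5 * y ^+ 5 + a6 * y ^+ 6.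

Lemma der_sextic a0 a1 a2 a3 a4 a5 a6 y :
  is_derive y (1 : R) (sextic a0 a1 a2 a3 a4 a5 a6)
    (sextic a1 (2 * a2) (3 * a3) (4 * a4) (5 * a5) (6 * a6) 0 y).
Proof.
have dX k := derX k (der_id y).
have H := derD (derD (derD (derD (derD (derD (der_cst y a0) (derZ a1 (der_id y)))
  (derZ a2 (dX 2%N))) (derZ a3 (dX 3%N))) (derZ a4 (dX 4%N))) (derZ a5 (dX 5%N))) (derZ a6 (dX 6%N)).
by apply: (der_eq H); rewrite /sextic /=; ring.
Qed.

Definition homog r (i j : nat) z : R := (z + r) ^+ i * (1 + r * z) ^+ j.

Lemma der_homog r i j z : is_derive z (1 : R) (homog r i j)
  (i%:R * (z + r) ^+ i.-1 * (1 + r * z) ^+ j + j%:R * r * (z + r) ^+ i * (1 + r * z) ^+ j.-1).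
Proof.
have d1 := derX i (derD (der_id z) (der_cst z r)).
have d2 := derX j (derD (der_cst z 1) (derZ r (der_id z))).
by apply: (der_eq (derM d1 d2)); ring.
Qed.

(** This is f^6 phi(y) for the sextic phi, with f = 1 + r z and y = (z + r) / f, cleared of
    denominators: a polynomial in z, smooth also where f vanishes. [hsextic1] and [hsextic2] are its
    first two derivatives. *)
Definition hsextic r a0 a1 a2 a3 a4 a5 a6 z : R :=
  a0 * homog r 0 6 z + a1 * homog r 1 5 z + a2 * homog r 2 4 z + a3 * homog r 3 3 z
  + a4 * homog r 4 2 z + a5 * homog r 5 1 z + a6 * homog r 6 0 z.

Definition hsextic1 r a0 a1 a2 a3 a4 a5 a6 z : R :=
  a1 * homog r 0 5 z + 2 * a2 * homog r 1 4 z + 3 * a3 * homog r 2 3 z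
  + 4 * a4 * homog r 3 2 z + 5 * a5 * homog r 4 1 z + 6 * a6 * homog r 5 0 z
  + r * (6 * a0 * homog r 0 5 z + 5 * a1 * homog r 1 4 z + 4 * a2 * homog r 2 3 z
  + 3 * a3 * homog r 3 2 z + 2 * a4 * homog r 4 1 z + a5 * homog r 5 0 z).

Definition hsextic2 r a0 a1 a2 a3 a4 a5 a6 z : R :=
  2 * a2 * homog r 0 4 z + 6 * a3 * homog r 1 3 z + 12 * a4 * homog r 2 2 z
  + 20 * a5 * homog r 3 1 z + 30 * a6 * homog r 4 0 z
  + 2 * r * (5 * a1 * homog r 0 4 z + 8 * a2 * homog r 1 3 z + 9 * a3 * homog r 2 2 z
    + 8 * a4 * homog r 3 1 z + 5 * a5 * homog r 4 0 z)
  + r ^+ 2 * (30 * a0 * homog r 0 4 z + 20 * a1 * homog r 1 3 z + 12 * a2 * homog r 2 2 z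
    + 6 * a3 * homog r 3 1 z + 2 * a4 * homog r 4 0 z).

Lemma der_hsextic r a0 a1 a2 a3 a4 a5 a6 z :
  is_derive z (1 : R) (hsextic r a0 a1 a2 a3 a4 a5 a6) (hsextic1 r a0 a1 a2 a3 a4 a5 a6 z).
Proof.
have dh a i j := derZ a (der_homog r i j z).
have H := derD (derD (derD (derD (derD (derD (dh a0 0%N 6%N) (dh a1 1%N 5%N))
  (dh a2 2%N 4%N)) (dh a3 3%N 3%N)) (dh a4 4%N 2%N)) (dh a5 5%N 1%N)) (dh a6 6%N 0%N).
apply: (der_eq H); rewrite /hsextic1 /homog /=.
by move: (z + r) (1 + r * z) => u v; ring.
Qed.

Lemma der_hsextic1 r a0 a1 a2 a3 a4 a5 a6 z :
  is_derive z (1 : R) (hsextic1 r a0 a1 a2 a3 a4 a5 a6) (hsextic2 r a0 a1 a2 a3 a4 a5 a6 z).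
Proof.
have dh a i j := derZ a (der_homog r i j z).
have H1 := derD (derD (derD (derD (derD (dh a1 0%N 5%N) (dh (2 * a2) 1%N 4%N))
  (dh (3 * a3) 2%N 3%N)) (dh (4 * a4) 3%N 2%N)) (dh (5 * a5) 4%N 1%N)) (dh (6 * a6) 5%N 0%N).
have H2 := derD (derD (derD (derD (derD (dh (6 * a0) 0%N 5%N) (dh (5 * a1) 1%N 4%N))
  (dh (4 * a2) 2%N 3%N)) (dh (3 * a3) 3%N 2%N)) (dh (2 * a4) 4%N 1%N)) (dh a5 5%N 0%N).
apply: (der_eq (derD H1 (derZ r H2))); rewrite /hsextic2 /homog /=.
by move: (z + r) (1 + r * z) => u v; ring.
Qed.

(** Since y' = (1 - r^2) / f^2, the right side is (1 - r^2)^2 f^4 phi''(y); the contributions of phi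
    and phi' cancel. *)
Lemma hsextic_ode r a0 a1 a2 a3 a4 a5 a6 z (f := 1 + r * z) :
  f ^+ 2 * hsextic2 r a0 a1 a2 a3 a4 a5 a6 z - 10 * r * f * hsextic1 r a0 a1 a2 a3 a4 a5 a6 z
    + 30 * r ^+ 2 * hsextic r a0 a1 a2 a3 a4 a5 a6 z =
  (1 - r ^+ 2) ^+ 2 * (2 * a2 * f ^+ 4 + 6 * a3 * (z + r) * f ^+ 3
    + 12 * a4 * (z + r) ^+ 2 * f ^+ 2 + 20 * a5 * (z + r) ^+ 3 * f + 30 * a6 * (z + r) ^+ 4).
Proof.
rewrite /hsextic2 /hsextic1 /hsextic /homog -/f.
have -> : 1 - r ^+ 2 = f - r * (z + r) by rewrite /f; ring.
by move: (z + r) f => u v; ring.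
Qed.

Lemma hsexticE r a0 a1 a2 a3 a4 a5 a6 z : 1 + r * z != 0 ->
  hsextic r a0 a1 a2 a3 a4 a5 a6 z =
  (1 + r * z) ^+ 6 * sextic a0 a1 a2 a3 a4 a5 a6 ((z + r) / (1 + r * z)).
Proof.
rewrite /hsextic /homog /sextic; move: (z + r) (1 + r * z) => u v v0.
by field; rewrite v0.
Qed.

Lemma hsextic_Ck n r a0 a1 a2 a3 a4 a5 a6 : Ck n setT (hsextic r a0 a1 a2 a3 a4 a5 a6).
Proof.
have Cid k : Ck k setT (fun t : R => t) by exact: Ck_id.
rewrite /hsextic /homog.
by repeat first [exact: Ck_cst | exact: Cid | apply: (CkD openT) | apply: (CkX _ openT)
  | apply: (CkM openT)].
Qed.

(* A critical point with nonnegative second derivative propagates convexity up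
   to one of the endpoints, where the slope has the wrong sign. *)
Lemma convex_concave_pos (f f1 f2 m : R -> R) (S C : R) :
  (forall y, is_derive y (1 : R) f (f1 y)) -> (forall y, is_derive y (1 : R) f1 (f2 y)) ->
  (forall y, f2 y = m y * (S - C * m y)) -> 0 <= S ->
  (forall y, -1 <= y <= 1 -> 0 < m y) ->
  (forall u y v, -1 <= u <= 1 -> -1 <= v <= 1 -> u < y < v -> m y < m u -> m y < m v -> False) ->
  continuous f2 ->
  f (-1) = 0 -> f 1 = 0 -> 0 < f1 (-1) -> f1 1 < 0 -> forall y, -1 < y < 1 -> 0 < f y.
Proof.
move=> df df1 f2E S0 m0 mqc cf2 fl fr dl dr.
have cf : continuous f.
  by move=> y; apply: differentiable_continuous; apply/derivable1_diffP; have := df y.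
have cf1 : continuous f1.
  by move=> y; apply: differentiable_continuous; apply/derivable1_diffP; have := df1 y.
have nocrit y : -1 < y < 1 -> f1 y = 0 -> 0 <= f2 y -> False.
  move=> /andP[y1 y2] fy1; have yI : -1 <= y <= 1 by rewrite !ltW.
  rewrite f2E pmulr_rge0 ?m0 // subr_ge0 => CS.
  (* Nonnegativity of f2 at y means C m(y) <= S. It persists wherever m is smaller: directly for C
     >= 0, and because S >= 0 when C < 0. *)
  have pos v : -1 <= v <= 1 -> m v <= m y -> 0 <= f2 v.
    move=> vI mv; rewrite f2E mulr_ge0 ?(ltW (m0 _ vI)) // subr_ge0.
    have [C0|C0] := leP 0 C; first by apply: le_trans CS; rewrite ler_wpM2l.
    by apply: le_trans S0; rewrite nmulr_rle0 // ltW // m0.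
  have incr a b : a <= b -> (forall v, a <= v <= b -> 0 <= f2 v) -> f1 a <= f1 b.
    rewrite le_eqVlt => /orP[/eqP -> //|ab] H.
    have [c] := @MVT R f1 f2 a b ab (fun c _ => df1 c) (continuous_subspaceT cf1).
    rewrite in_itv /= => /andP[/ltW ac /ltW cb] E.
    by rewrite -subr_ge0 E mulr_ge0 ?subr_ge0 ?(ltW ab) // H // ac.
  (* By quasi-concavity m stays below m(y) on all of [-1, y] or on all of [y, 1]. On that side f1 is
     nondecreasing and zero at y, against its sign at the endpoint. *)
  have [Hl|/existsNP[u /not_implyP[uI mu]]] :=
      pselect (forall u, -1 <= u <= y -> m u <= m y).
    have : f1 (-1) <= f1 y.
      apply: incr; first exact: ltW.
      move=> v /andP[v1 v2]; apply: pos; first by rewrite v1 (le_trans v2) // ltW.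
      by apply: Hl; rewrite v1.
    by rewrite fy1 leNgt dl.
  have [Hr|/existsNP[v /not_implyP[vI mv]]] :=
      pselect (forall v, y <= v <= 1 -> m v <= m y).
    have : f1 y <= f1 1.
      apply: incr; first exact: ltW.
      move=> v /andP[v1 v2]; apply: pos; first by rewrite v2 andbT (le_trans _ v1) // ltW.
      by apply: Hr; rewrite v1.
    by rewrite fy1 leNgt dr.
  move/negP: mu; rewrite -ltNge => mu; move/negP: mv; rewrite -ltNge => mv.
  case/andP: uI => u1 u2; case/andP: vI => v1 v2.
  apply: (mqc u y v) => //.
  - by rewrite u1 (le_trans u2) // ltW.
  - by rewrite v2 andbT (le_trans _ v1) // ltW.
  - rewrite !lt_neqAle u2 v1 !andbT; apply/andP; split; apply/eqP => E.
      by move: mu; rewrite E ltxx.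
    by move: mv; rewrite E ltxx.
have nomin c : -1 < c < 1 -> (forall t, -1 <= t <= 1 -> f c <= f t) -> False.
  move=> cI minc; have cI' : c \in `]-1, 1[ by rewrite in_itv.
  have D0 : is_derive c 1 f 0.
    apply: (@derive1_at_min R f (-1) 1 c) => // t; rewrite in_itv /= => /andP[t1 t2].
    by apply: minc; rewrite !ltW.
  have fc0 : f1 c = 0 by have := df c => H; rewrite -(@derive_val _ _ _ _ _ _ _ H) (@derive_val _ _ _ _ _ _ _ D0).
  (* The remaining case is a minimum with negative second derivative; just to its right f would be
     strictly smaller. *)
  apply: (nocrit c cI fc0); rewrite leNgt; apply/negP => neg.
  have /nbhs_ballP[d /= d0 Hd] : \forall t \near c, f2 t < 0 by exact: (cvgr_lt _ (cf2 c)).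
  case/andP: cI => c1 c2.
  pose b := Num.min (c + d / 2) ((c + 1) / 2).
  have [b1 b2] : b <= c + d / 2 /\ b <= (c + 1) / 2 by rewrite !ge_min !lexx orbT.
  have cb : c < b by rewrite lt_min; apply/andP; split; lra.
  have neg1 t : c < t <= b -> f1 t < 0.
    move=> /andP[ct tb].
    have [e] := @MVT R f1 f2 c t ct (fun c _ => df1 c) (continuous_subspaceT cf1).
    rewrite in_itv /= fc0 subr0 => /andP[ce et] ->.
    rewrite nmulr_rlt0 ?subr_gt0 //; apply: Hd; rewrite /ball /= distrC ger0_norm ?subr_ge0 ?ltW //; lra.
  have [e] := @MVT R f f1 c b cb (fun c _ => df c) (continuous_subspaceT cf).
  rewrite in_itv /= => /andP[ce eb] E.
  have : f b < f c by rewrite -subr_lt0 E nmulr_rlt0 ?subr_gt0 // neg1 // ce ltW.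
  by rewrite ltNge minc //; apply/andP; split; lra.
have [||c] := @EVT_min R f (-1) 1.
- by lra.
- by apply: continuous_subspaceT.
rewrite in_itv /= => cI minc y yI.
have minc' t : -1 <= t <= 1 -> f c <= f t by move=> tI; apply: minc; rewrite in_itv.
have fc0 : f c = 0.
  case/andP: cI => c1 c2.
  have [E|n1] := eqVneq c (-1); first by rewrite E.
  have [E|n2] := eqVneq c 1; first by rewrite E.
  by case: (nomin c) => //; rewrite !lt_neqAle c1 c2 (eq_sym (-1)) n1 n2.
have [//|fy] := ltP 0 (f y); case: (nomin y yI) => t tI.
by apply: (le_trans fy); rewrite -fc0; exact: minc'.
Qed.
End Sextic.

Lemma affine_gt0 (R : realFieldType) (a b y : R) :
  0 < a + b -> 0 < a - b -> -1 <= y <= 1 -> 0 < a + b * y.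
Proof.
move=> ab1 ab2 /andP[y1 y2].
have -> : a + b * y = ((a + b) * (1 + y) + (a - b) * (1 - y)) / 2 by field.
have p1 : 0 <= 1 + y by lra.
have p2 : 0 <= 1 - y by lra.
rewrite divr_gt0 //; have [y0|y0] := leP y 0.
  by rewrite ltr_wpDl ?mulr_ge0 ?(ltW ab1) // mulr_gt0 //; lra.
by rewrite ltr_wpDr ?mulr_ge0 ?(ltW ab2) // mulr_gt0 //; lra.
Qed.

(** A product of two positive affine functions is quasi-concave: by the arithmetic-geometric mean
    inequality the cross term a q + b p is at least twice the square root of (a p)(b q), hence at
    least 2 k, and the weights add up to (t + s)^2 = 1. *)
Lemma quasi_concave_mul (R : realFieldType) (t s a b p q : R) :
  0 < t -> 0 < s -> t + s = 1 -> 0 < a -> 0 < b -> 0 < p -> 0 < q ->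
  (t * a + s * b) * (t * p + s * q) < a * p ->
  (t * a + s * b) * (t * p + s * q) < b * q -> False.
Proof.
move=> t0 s0 ts a0 b0 p0 q0; set k := (_ * _ : R) => ka kb.
have k0 : 0 < k by rewrite /k mulr_gt0 // addr_gt0 // mulr_gt0.
have kE : k = t ^+ 2 * (a * p) + s ^+ 2 * (b * q) + t * s * (a * q + b * p).
  by rewrite /k; ring.
have cross : 2 * k <= a * q + b * p.
  have c0 : 0 <= a * q + b * p by rewrite addr_ge0 // ltW // mulr_gt0.
  rewrite -ler_sqr ?nnegrE //; last by rewrite mulr_ge0 // ltW.
  apply: (@le_trans _ _ (4 * ((a * p) * (b * q)))).
    have -> : (2 * k) ^+ 2 = 4 * (k * k) by ring.
    by rewrite ler_pM2l // ler_pM ?ltW.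
  rewrite -subr_ge0 (_ : _ - _ = (a * q - b * p) ^+ 2) ?sqr_ge0 //; ring.
have : t ^+ 2 * k + s ^+ 2 * k + t * s * (2 * k) < k.
  rewrite [ltRHS]kE; apply: ltr_leD; last by rewrite ler_pM2l // mulr_gt0.
  by rewrite ltrD // ltr_pM2l // exprn_gt0.
have -> : t ^+ 2 * k + s ^+ 2 * k + t * s * (2 * k) = (t + s) ^+ 2 * k by ring.
by rewrite ts expr1n mul1r ltxx.
Qed.

(** [F] is kept beside the profile because it is a polynomial satisfying the equation on the whole
    line, whereas Th = F / (1 + x t)^2 is asked on [-1, 1] only; outside, the denominator is
    replaced by a positive function to keep Th smooth everywhere. *)
Lemma em_profile (R : realType) (x sg : R) : 0 < x < 1 -> 0 <= sg ->
  exists r c : R, exists F F1 F2 Th : R -> R,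
  [/\ -1 < r < 1, momentum_profile Th,
      (forall t, is_derive t (1 : R) F (F1 t) /\ is_derive t (1 : R) F1 (F2 t)),
      (forall t, -1 <= t <= 1 -> Th t = F t / (1 + x * t) ^+ 2)
    & forall t, (1 + r * t) ^+ 2 * F2 t - 10 * r * (1 + r * t) * F1 t
        + 30 * r ^+ 2 * F t
      = (1 + r * t) ^+ 2 * sg * (1 + x * t) - c * (1 + x * t) ^+ 2].
Proof.
move=> x01 sg0; have [r [C [/andP[r1 r2] [eq1 eq2]]]] := @em_constants R x sg x01.
case/andP: (x01) => x0 x1.
pose w := 1 - r ^+ 2; have w0 : 0 < w by rewrite /w; nra.
have wn : w != 0 by rewrite gt_eqF.
pose S := sg / w ^+ 4; have S0 : 0 <= S by rewrite divr_ge0 // exprn_ge0 // ltW.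
pose P := 2 * (1 - x) ^+ 2 * (1 + r) ^+ 4 / w ^+ 5.
pose Q := 2 * (1 + x) ^+ 2 * (1 - r) ^+ 4 / w ^+ 5.
have P0 : 0 < P by rewrite !(mulr_gt0, invr_gt0, exprn_gt0) //; lra.
have Q0 : 0 < Q by rewrite !(mulr_gt0, invr_gt0, exprn_gt0) //; lra.
pose A := 1 - x * r; pose B := (x - r) - r * A; pose E := - (r * (x - r)).
move: eq1 eq2; rewrite -/w -/S -/P -/Q -/A -/B -/E => eq1 eq2.
(* [a2] to [a6] integrate m (S - C m) twice; [a0] and [a1] cancel the even and the odd part at y =
   1, so phi vanishes at both ends. *)
pose a2 := (S * A - C * A ^+ 2) / 2.
pose a3 := (S * B - 2 * C * A * B) / 6.
pose a4 := (S * E - C * (B ^+ 2 + 2 * A * E)) / 12.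
pose a5 := (- 2 * C * B * E) / 20.
pose a6 := (- C * E ^+ 2) / 30.
pose a0 := - (a2 + a4 + a6); pose a1 := - (a3 + a5).
pose phi := sextic a0 a1 a2 a3 a4 a5 a6.
pose phi1 := sextic a1 (2 * a2) (3 * a3) (4 * a4) (5 * a5) (6 * a6) 0.
pose phi2 := sextic (2 * a2) (2 * (3 * a3)) (3 * (4 * a4)) (4 * (5 * a5)) (5 * (6 * a6)) 0 0.
have dphi y : is_derive y (1 : R) phi (phi1 y) by exact: der_sextic.
have dphi1 y : is_derive y (1 : R) phi1 (phi2 y).
  by apply: (der_eq (der_sextic _ _ _ _ _ _ _ y)); rewrite /phi2 /sextic; ring.
(* In terms of z this is w^2 (1 + x z) / f^2, which is how the right side of the equation becomes a
   quadratic in m. *)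
pose m y := (1 - r * y) * (A + (x - r) * y).
have phi2E y : phi2 y = m y * (S - C * m y).
  rewrite /phi2 /sextic /a2 /a3 /a4 /a5 /a6 /m.
  have -> : (1 - r * y) * (A + (x - r) * y) = A + B * y + E * y ^+ 2 by rewrite /B /E; ring.
  by clearbody A B E; field.
have L1 y : -1 <= y <= 1 -> 0 < 1 - r * y.
  by move=> yI; rewrite -mulNr affine_gt0 //; lra.
have L2 y : -1 <= y <= 1 -> 0 < A + (x - r) * y.
  move=> yI; apply: affine_gt0 => //.
    by have -> : A + (x - r) = (1 + x) * (1 - r) by [rewrite /A; ring]; rewrite mulr_gt0 //; lra.
  by have -> : A - (x - r) = (1 - x) * (1 + r) by [rewrite /A; ring]; rewrite mulr_gt0 //; lra.
have m0 y : -1 <= y <= 1 -> 0 < m y by move=> yI; rewrite mulr_gt0 ?L1 ?L2.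
have mqc u y v : -1 <= u <= 1 -> -1 <= v <= 1 -> u < y < v -> m y < m u -> m y < m v -> False.
  move=> uI vI /andP[uy yv]; have kp : 0 < m y.
    apply: m0; case/andP: uI => u1 _; case/andP: vI => _ v2.
    by rewrite (le_trans u1 (ltW uy)) (le_trans (ltW yv) v2).
  have vu : 0 < v - u by rewrite subr_gt0 (lt_trans uy).
  pose t := (v - y) / (v - u); pose s := (y - u) / (v - u).
  have vun : v - u != 0 by rewrite gt_eqF.
  have ts : t + s = 1 by rewrite /t /s; field.
  have [t0 s0] : 0 < t /\ 0 < s by split; rewrite divr_gt0 // subr_gt0.
  have yE : y = t * u + s * v by rewrite /t /s; field.
  clearbody t s.
  have := quasi_concave_mul t0 s0 ts (L1 u uI) (L1 v vI) (L2 u uI) (L2 v vI).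
  have sE : s = 1 - t by rewrite -ts; ring.
  have E1 : t * (1 - r * u) + s * (1 - r * v) = 1 - r * y by rewrite yE sE; ring.
  have E2 : t * (A + (x - r) * u) + s * (A + (x - r) * v) = A + (x - r) * y.
    by rewrite yE sE; ring.
  by rewrite E1 E2.
have cphi2 : continuous phi2.
  move=> y; apply: differentiable_continuous; apply/derivable1_diffP.
  by have := der_sextic (2 * a2) (2 * (3 * a3)) (3 * (4 * a4)) (4 * (5 * a5)) (5 * (6 * a6)) 0 0 y.
have fl : phi (-1) = 0 by rewrite /phi /sextic /a0 /a1; ring.
have fr : phi 1 = 0 by rewrite /phi /sextic /a0 /a1; ring.
have dl : phi1 (-1) = P.
  have -> : phi1 (-1) = ((S * (2 / 3 * B) - C * (4 / 3 * (A * B) + 4 / 5 * (B * E)))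
   - (S * (2 * A + 2 / 3 * E) - C * (2 * A ^+ 2 + 2 / 3 * (B ^+ 2 + 2 * A * E) + 2 / 5 * E ^+ 2))) / 2.
    by rewrite /phi1 /sextic /a1 /a2 /a3 /a4 /a5 /a6; field.
  by rewrite eq1 eq2; field.
have dr : phi1 1 = - Q.
  have -> : phi1 1 = ((S * (2 / 3 * B) - C * (4 / 3 * (A * B) + 4 / 5 * (B * E)))
   + (S * (2 * A + 2 / 3 * E) - C * (2 * A ^+ 2 + 2 / 3 * (B ^+ 2 + 2 * A * E) + 2 / 5 * E ^+ 2))) / 2.
    by rewrite /phi1 /sextic /a1 /a2 /a3 /a4 /a5 /a6; field.
  by rewrite eq1 eq2; field.
have phi_pos y : -1 < y < 1 -> 0 < phi y.
  apply: (convex_concave_pos dphi dphi1 phi2E S0 m0 mqc cphi2 fl fr); first by rewrite dl.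
  by rewrite dr oppr_lt0.
have [h [sh hpos hE]] := positive_extension x01.
pose F := hsextic r a0 a1 a2 a3 a4 a5 a6.
pose F1 := hsextic1 r a0 a1 a2 a3 a4 a5 a6.
pose F2 := hsextic2 r a0 a1 a2 a3 a4 a5 a6.
have fpos z : -1 <= z <= 1 -> 0 < 1 + r * z by move=> zI; apply: affine_gt0 => //; lra.
(* The operator contributes w^2 f^4 and m^2 contributes w^4 (1 + x z)^2 / f^4, whence the constant C
   w^6; likewise S w^4 = sg. *)
exists r, (C * w ^+ 6), F, F1, F2, (fun t => F t * (h t ^+ 2)^-1).
have sTh : Cinf setT (fun t => F t * (h t ^+ 2)^-1).
  move=> n; apply: (CkM openT); first exact: hsextic_Ck.
  apply: (CkV openT); last by apply: (CkX _ openT).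
  by move=> t _; rewrite expf_neq0 // gt_eqF.
have hl : h (-1) = 1 - x by rewrite hE // mulrN1.
have hr : h 1 = 1 + x by rewrite hE ?mulr1 //; lra.
have Fl : F (-1) = 0.
  rewrite /F hsexticE; last by rewrite gt_eqF // fpos //; lra.
  rewrite (_ : (-1 + r) / (1 + r * -1) = -1); first by rewrite -/(phi (-1)) fl mulr0.
  by field; rewrite mulrN1 gt_eqF //; lra.
have Fr : F 1 = 0.
  rewrite /F hsexticE; last by rewrite gt_eqF // fpos //; lra.
  rewrite (_ : (1 + r) / (1 + r * 1) = 1); first by rewrite -/(phi 1) fr mulr0.
  by field; rewrite gt_eqF //; lra.
have F1l : F1 (-1) = 2 * (1 - x) ^+ 2.
  have -> : F1 (-1) = w * (1 - r) ^+ 4 * phi1 (-1) + 6 * r * (1 - r) ^+ 5 * phi (-1).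
    by rewrite /F1 /phi1 /phi /hsextic1 /homog /sextic /w; ring.
  by rewrite dl fl mulr0 addr0 /P /w; field; rewrite -/w.
have F1r : F1 1 = - (2 * (1 + x) ^+ 2).
  have -> : F1 1 = w * (1 + r) ^+ 4 * phi1 1 + 6 * r * (1 + r) ^+ 5 * phi 1.
    by rewrite /F1 /phi1 /phi /hsextic1 /homog /sextic /w; ring.
  by rewrite dr fr mulr0 addr0 /Q /w; field; rewrite -/w.
have dTh t : F t = 0 -> is_derive t (1 : R) (fun t => F t * (h t ^+ 2)^-1) (F1 t / h t ^+ 2).
  move=> Ft; have sq : Cinf setT (fun t => (h t ^+ 2)^-1).
    move=> n; apply: (CkV openT); last by apply: (CkX _ openT).
    by move=> s _; rewrite expf_neq0 // gt_eqF.
  have H := derM (der_hsextic r a0 a1 a2 a3 a4 a5 a6 t) (der_Cinf sq Logic.I : is_derive t _ _ _).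
  by apply: (der_eq H); rewrite -/(F t) Ft mul0r addr0.
split.
- by rewrite r1.
- split.
  + by move=> k t; exact: ((Cinf_derive1n _ openT).1 sTh k t Logic.I).
  + move=> t tI; rewrite mulr_gt0 ?invr_gt0 ?exprn_gt0 //.
    case/andP: tI => t1 t2; have fp := fpos t; rewrite /F hsexticE; last first.
      by rewrite gt_eqF // fp // !ltW.
    have {}fp : 0 < 1 + r * t by rewrite fp // !ltW.
    rewrite mulr_gt0 ?exprn_gt0 //; apply: phi_pos.
    by rewrite ltr_pdivlMr // ltr_pdivrMr //; apply/andP; split; nra.
  + by rewrite Fl Fr !mul0r.
  + rewrite !derive1E; have := dTh _ Fl => H1; have := dTh _ Fr => H2.
    rewrite (@derive_val _ _ _ _ _ _ _ H1) (@derive_val _ _ _ _ _ _ _ H2) F1l F1r hl hr.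
    by split; field; lra.
- by move=> t; split; [exact: der_hsextic|exact: der_hsextic1].
- by move=> t /andP[t1 _]; rewrite hE.
- move=> t; rewrite hsextic_ode -/w.
  have -> : 2 * a2 * (1 + r * t) ^+ 4 + 6 * a3 * (t + r) * (1 + r * t) ^+ 3
    + 12 * a4 * (t + r) ^+ 2 * (1 + r * t) ^+ 2 + 20 * a5 * (t + r) ^+ 3 * (1 + r * t)
    + 30 * a6 * (t + r) ^+ 4 =
    (A * (1 + r * t) ^+ 2 + B * (t + r) * (1 + r * t) + E * (t + r) ^+ 2) *
     (S * (1 + r * t) ^+ 2 - C * (A * (1 + r * t) ^+ 2 + B * (t + r) * (1 + r * t) + E * (t + r) ^+ 2)).
    rewrite /a2 /a3 /a4 /a5 /a6; clearbody A B E; move: (1 + r * t) (t + r) => u v.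
    by field.
  have -> : A * (1 + r * t) ^+ 2 + B * (t + r) * (1 + r * t) + E * (t + r) ^+ 2 =
      w ^+ 2 * (1 + x * t) by rewrite /A /B /A /E /w; ring.
  by rewrite /S; move: (1 + r * t) (1 + x * t) => u v; field; rewrite wn.
Qed.

(** * Killing fields of the Calabi ansatz *)

Lemma jacobianE (R : realType) N n (F : 'rV[R]_N -> 'rV[R]_n) y :
  differentiable F y -> jacobian F y = \matrix_(i, m) partial i (fun y => F y 0 m) y.
Proof.
move=> dF; apply/matrixP => i m; rewrite [RHS]mxE /jacobian.
have -> : lin1_mx ('d F y) i m = 'd F y (delta_mx 0 i) 0 m by rewrite mxE.
by rewrite -deriveE // (derive_mx (diff_derivable dF)) mxE.
Qed.

Lemma mulmx1C_eq (R : comUnitRingType) N K (e : N = K) (C : 'M[R]_(N, K)) (B : 'M[R]_(K, N)) :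
  C *m B = 1%:M -> B *m C = 1%:M.
Proof. by case: K / e in C B *; exact: mulmx1C. Qed.

Section CalabiAnsatz.
Context (R : realType) (N n : nat) (U : set 'rV[R]_N) (W : set 'rV[R]_n) (I : set R).
Context (F : 'rV[R]_N -> 'rV[R]_n) (z : 'rV[R]_N -> R) (th : 'rV[R]_N -> 'cV[R]_N).
Context (g : 'rV[R]_n -> 'M[R]_n).
Hypotheses (oU : open U) (oW : open W)
  (FW : forall y, U y -> W (F y)) (zI : forall y, U y -> I (z y))
  (sF : forall m, Cinf U (fun y => F y 0 m)) (sz : Cinf U z) (sth : mCinf U th)
  (sg : mCinf W g).

Lemma differentiable_base y : U y -> differentiable F y.
Proof. by move=> Uy; apply: differentiable_row => m; exact: (Ck_diff (sF m 0%N) Uy). Qed.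

Lemma calabi_coframeE al be ga y : U y ->
  calabi_coframe F z th y *m calabi_frame_metric F z g al be ga y
     *m (calabi_coframe F z th y)^T =
  al (z y) *: (jacobian F y *m g (F y) *m (jacobian F y)^T)
  + be (z y) *: (grad z y *m (grad z y)^T) + ga (z y) *: (th y *m (th y)^T).
Proof.
move=> Uy; apply/matrixP => i j; rewrite mxE.
pose f b := (\sum_m cof F z th i y (inl m) * gh F z g al be ga y (inl m) b +
  (cof F z th i y (inr true) * gh F z g al be ga y (inr true) b +
   cof F z th i y (inr false) * gh F z g al be ga y (inr false) b)) * cof F z th j y b.
transitivity (\sum_(b < n + 2) f (split2 b)).
  apply: eq_bigr => b _; rewrite !mxE; congr (_ * _).
  rewrite -(sum_split2 (fun a => cof F z th i y a * gh F z g al be ga y a (split2 b))).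
  by apply: eq_bigr => a _; rewrite !mxE.
rewrite (sum_split2 f) /f /gh /cof /= /cst.
rewrite [X in _ + ((X + _) * _ + _)]big1 => [|m _]; last by rewrite !(mul0r, mulr0).
rewrite [X in _ + (_ + (X + _) * _)]big1 => [|m _]; last by rewrite !(mul0r, mulr0).
rewrite !(mul0r, mulr0, add0r, addr0, mulr1).
rewrite !mxE !big_ord1 !mxE -addrA; congr (_ + (_ + _)); try by ring.
rewrite jacobianE ?mulr_sumr; last exact: differentiable_base.
apply: eq_bigr => m _; rewrite !mxE addr0 mulrA; congr (_ * _).
by rewrite mulr_sumr; apply: eq_bigr => v _; rewrite !mxE; ring.
Qed.

(** Cartan's formula: the term d(c(X)) drops out because c(X) is constant. *)
Lemma lie_derivative_form (X : 'rV[R]_N -> 'rV[R]_N) (c : 'rV[R]_N -> 'cV[R]_N) (t : R) y i :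
  mCinf U X -> mCinf U c -> (forall y, U y -> X y *m c y = t%:M) -> U y ->
  \sum_k (X y 0 k * partial k (fun y => c y i 0) y + partial i (fun y => X y 0 k) y * c y k 0) =
  (X y *m extd c y) 0 i.
Proof.
move=> sX sc Xc Uy.
have dX k : differentiable (fun y => X y 0 k) y by exact: (Ck_diff (sX 0 k 0%N) Uy).
have dc k : differentiable (fun y => c y k 0) y by exact: (Ck_diff (sc k 0 0%N) Uy).
have : partial i (fun y => \sum_k X y 0 k * c y k 0) y = 0.
  rewrite (@eq_partial _ _ U _ (cst t) i y oU) //; first by rewrite /partial derive_cst.
  move=> y'; rewrite inE => Uy'; have := congr1 (fun M : 'M[R]_1 => M 0 0) (Xc y' Uy').
  by rewrite !mxE eqxx mulr1n => <-.
rewrite partial_sum => [E|k]; last exact: differentiableM.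
rewrite [RHS]mxE -[RHS]addr0 -[X in _ = _ + X]E -big_split /=; apply: eq_bigr => k _.
by rewrite partialM // !mxE; ring.
Qed.

Lemma extd_grad (f : 'rV[R]_N -> R) y : Cinf U f -> U y -> extd (grad f) y = 0.
Proof.
move=> sf Uy; apply/matrixP => i j; rewrite !mxE.
under [fun y => grad f y j 0]eq_fun do rewrite mxE.
under [fun y => grad f y i 0]eq_fun do rewrite mxE.
by rewrite (partial_swap j i oU Uy sf) subrr.
Qed.

(** It suffices that X preserve each coframe form and the components of G in the coframe; the
    product rule for G = C Gh C^T does the rest. *)
Lemma killing_frame K (C : 'rV[R]_N -> 'M[R]_(N, K)) (Gh : 'rV[R]_N -> 'M[R]_K)
    (G : 'rV[R]_N -> 'M[R]_N) (X : 'rV[R]_N -> 'rV[R]_N) y :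
  (forall y, U y -> G y = C y *m Gh y *m (C y)^T) -> (forall y, U y -> (Gh y)^T = Gh y) ->
  mCinf U C -> mCinf U Gh -> U y ->
  (forall c i, \sum_k (X y 0 k * partial k (fun y => C y i c) y
     + partial i (fun y => X y 0 k) y * C y k c) = 0) ->
  \sum_k X y 0 k *: dmx k Gh y = 0 ->
  killing_at G X y.
Proof.
move=> GE Ghs sC sGh Uy LC LGh i j.
pose A : 'M[R]_N := \matrix_(i, k) partial i (fun y => X y 0 k) y.
have dC := mCinf_diff sC Uy; have dGh := mCinf_diff sGh Uy.
have EC : \sum_k X y 0 k *: dmx k C y = - (A *m C y).
  apply/eqP; rewrite -addr_eq0; apply/eqP/matrixP => a c; rewrite mxE summxE !mxE -[RHS](LC c a).
  by rewrite -big_split /=; apply: eq_bigr => k _; rewrite !mxE.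
have EG : \sum_k X y 0 k *: dmx k G y = - (A *m G y) - (A *m G y)^T.
  have E k : dmx k G y = dmx k C y *m Gh y *m (C y)^T + C y *m dmx k Gh y *m (C y)^T
      + C y *m Gh y *m (dmx k C y)^T.
    rewrite (@eq_dmx _ _ _ _ U G (fun y => C y *m Gh y *m (C y)^T) k y oU) //; last first.
      by move=> y'; rewrite inE => /GE.
    rewrite dmxM; [|exact: mdiffM|exact: mdiff_tr].
    by rewrite dmx_tr dmxM // mulmxDl.
  under eq_bigr => k _ do rewrite E !scalerDr.
  rewrite !big_split /=.
  have -> : \sum_k X y 0 k *: (C y *m dmx k Gh y *m (C y)^T) = 0.
    rewrite -[RHS](mul0mx _ (C y)^T) -[in RHS](mulmx0 _ (C y)) -LGh mulmx_sumr mulmx_suml.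
    by apply: eq_bigr => k _; rewrite -scalemxAr -scalemxAl.
  have -> : \sum_k X y 0 k *: (dmx k C y *m Gh y *m (C y)^T) = - (A *m G y).
    rewrite (GE _ Uy) !mulmxA -2!mulNmx -EC !mulmx_suml.
    by apply: eq_bigr => k _; rewrite -!scalemxAl.
  rewrite addr0; congr (_ + _).
  have -> : \sum_k X y 0 k *: (C y *m Gh y *m (dmx k C y)^T) = - (C y *m Gh y *m (A *m C y)^T).
    rewrite -mulmxN -linearN /= -EC.
    rewrite linear_sum mulmx_sumr; under eq_bigr => k _ do rewrite scalemxAr -linearZ /=.
    by [].
  by rewrite (GE _ Uy) !trmx_mul trmxK (Ghs _ Uy) !mulmxA.
have Gs : (G y)^T = G y by rewrite (GE _ Uy) !trmx_mul trmxK (Ghs _ Uy) !mulmxA.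
have /matrixP/(_ i j) := EG; rewrite summxE !mxE => E.
rewrite !big_split /= (_ : \sum_k X y 0 k * _ = \sum_k (X y 0 k *: dmx k G y) i j); last first.
  by apply: eq_bigr => k _; rewrite !mxE.
rewrite E (_ : \sum_k A i k * G y k j = \sum_k partial i (fun y => X y 0 k) y * G y k j); last first.
  by apply: eq_bigr => k _; rewrite !mxE.
rewrite (_ : \sum_k A j k * G y k i = \sum_k partial j (fun y => X y 0 k) y * G y i k); last first.
  by apply: eq_bigr => k _; rewrite -[in G y k i]Gs !mxE.
ring.
Qed.

Context (J : 'M[R]_n).
Hypotheses (gs : forall x, W x -> (g x)^T = g x)
  (dth : forall y, U y ->
     extd th y = jacobian F y *m (J *m g (F y)) *m (jacobian F y)^T).

Lemma calabi_frame_metric_sym al be ga y : U y ->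
  (calabi_frame_metric F z g al be ga y)^T = calabi_frame_metric F z g al be ga y.
Proof.
move=> Uy; apply/matrixP => a c; rewrite !mxE /gh.
case: (split2 a) (split2 c) => [m|[]] [v|[]] //=.
by rewrite -[in LHS](gs (FW Uy)) mxE.
Qed.

(** X is r times the generator of the circle action: it annihilates dF and dz, hence also d theta,
    which is pulled back from the base. Cartan's formula then shows that each coframe form is
    preserved, and the weights depend on z alone. *)
Lemma calabi_killing al be ga (G : 'rV[R]_N -> 'M[R]_N) (X : 'rV[R]_N -> 'rV[R]_N) (r : R) y :
  Cinf I al -> Cinf I be -> Cinf I ga ->
  (forall y, U y -> G y = al (z y) *: (jacobian F y *m g (F y) *m (jacobian F y)^T)
    + be (z y) *: (grad z y *m (grad z y)^T) + ga (z y) *: (th y *m (th y)^T)) ->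
  mCinf U X -> (forall y, U y -> X y *m jacobian F y = 0) ->
  (forall y, U y -> X y *m grad z y = 0) -> (forall y, U y -> X y *m th y = r%:M) ->
  U y -> killing_at G X y.
Proof.
move=> sal sbe sga GE sX XF Xz Xt Uy.
have XC c y' : U y' -> \sum_k X y' 0 k * cof F z th k y' c = if c == inr false then r else 0.
  move=> Uy'; case: c => [m|[]] /=.
  - have := congr1 (fun M : 'rV[R]_n => M 0 m) (XF _ Uy').
    rewrite (jacobianE (differentiable_base Uy')) !mxE => E; rewrite -[RHS]E.
    by apply: eq_bigr => k _; rewrite mxE.
  - have := congr1 (fun M : 'M[R]_1 => M 0 0) (Xz _ Uy'); rewrite !mxE => E; rewrite -[RHS]E.
    by apply: eq_bigr => k _; rewrite mxE.
  - have := congr1 (fun M : 'M[R]_1 => M 0 0) (Xt _ Uy'); rewrite !mxE eqxx mulr1n => E.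
    by rewrite -[RHS]E.
apply: (@killing_frame _ (calabi_coframe F z th) (calabi_frame_metric F z g al be ga)) => //.
- by move=> y' Uy'; rewrite GE // calabi_coframeE.
- by move=> y' Uy'; apply: calabi_frame_metric_sym.
- exact: mCinf_calabi_coframe.
- exact: (mCinf_calabi_frame_metric oU FW zI sF sz sg sal sbe sga).
- move=> c i; pose co y := \col_k cof F z th k y (split2 c).
  have coE k : (fun y => co y k 0) = (fun y => calabi_coframe F z th y k c).
    by apply/funext => y'; rewrite !mxE.
  transitivity (\sum_k (X y 0 k * partial k (fun y => co y i 0) y
     + partial i (fun y => X y 0 k) y * co y k 0)).
    by apply: eq_bigr => k _; congr (_ * partial k _ y + _ * _); [exact: (esym (coE i))|rewrite !mxE].
  have sco : mCinf U co.
    move=> k j; rewrite (ord1 j) coE; exact: (mCinf_calabi_coframe sF sz sth).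
  rewrite (@lie_derivative_form X co (if split2 c == inr false then r else 0)) //; last first.
    move=> y' Uy'; apply/matrixP => a b; rewrite !ord1 [RHS]mxE eqxx mulr1n -(XC (split2 c) y') //.
    by rewrite mxE; apply: eq_bigr => k _; rewrite !mxE.
  rewrite /co; case: (split2 c) => [m|[]] /=.
  + by rewrite (extd_grad (sF m) Uy) mulmx0 mxE.
  + by rewrite (extd_grad sz Uy) mulmx0 mxE.
  + rewrite (_ : (fun y => _) = th); last by apply/funext => y'; apply/colP => k; rewrite mxE.
    by rewrite dth // !mulmxA XF // !mul0mx mxE.
- apply/matrixP => a b; rewrite summxE [RHS]mxE.
  have E k : partial k (fun y => calabi_frame_metric F z g al be ga y a b) y =
      \sum_(d < n + 2) cof F z th k y (split2 d) *
        dd F z (@partial R n) (ghw al be ga (split2 a) (split2 b)) (ghu g (split2 a) (split2 b))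
          y (split2 d).
    under [fun y => calabi_frame_metric F z g al be ga y a b]eq_fun do rewrite mxE.
    apply: (partial_sep (U := U) (W := W) (I := I)) => //.
      exact: Cinf_ghw.
    exact: Cinf_ghu.
  transitivity (\sum_(d < n + 2) (\sum_k X y 0 k * cof F z th k y (split2 d)) *
     dd F z (@partial R n) (ghw al be ga (split2 a) (split2 b)) (ghu g (split2 a) (split2 b))
          y (split2 d)).
    under eq_bigr => k _ do rewrite !mxE E mulr_sumr.
    rewrite exchange_big; apply: eq_bigr => d _; rewrite mulr_suml.
    by apply: eq_bigr => k _; rewrite mulrA.
  rewrite big1 // => d _; rewrite XC //.
  by case: (split2 d) => [m|[]] /=; rewrite ?mul0r ?mulr0.
Qed.
End CalabiAnsatz.

(** * Weights of the Einstein-Maxwell metric *)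

Section EinsteinMaxwellWeights.
Context (R : realType) (x r c cS : R) (P P1 P2 : R -> R).
Hypotheses (x01 : 0 < x < 1) (r1 : -1 < r < 1).

Definition Iop : set R := [set t | -1 < t < 1].

Lemma open_Iop : open Iop.
Proof.
rewrite (_ : Iop = [set` `]-1, 1[]); first exact: interval_open.
by apply/seteqP; split=> t /=; rewrite in_itv.
Qed.

Hypotheses (sP : Cinf Iop P) (P0 : forall t, Iop t -> 0 < P t)
  (dP : forall t, is_derive t (1 : R) P (P1 t)) (dP1 : forall t, is_derive t (1 : R) P1 (P2 t))
  (ode : forall t, (1 + r * t) ^+ 2 * P2 t - 10 * r * (1 + r * t) * P1 t
        + 30 * r ^+ 2 * P t
      = (1 + r * t) ^+ 2 * (x * cS) * (1 + x * t) - c * (1 + x * t) ^+ 2).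

Let v t := 1 + x * t.
Let f t := 1 + r * t.
(** [w_al], [w_be], [w_ga] are the weights of f^-2 g for the profile P / v^2. The other six are the
    logarithmic derivatives and quotients called [a1], [b1], [c1], [qb], [e], [d1] in the curvature
    computation. *)
Definition w_al t := v t * (x * f t ^+ 2)^-1.
Definition w_be t := v t ^+ 2 * (P t * f t ^+ 2)^-1.
Definition w_ga t := P t * (v t ^+ 2 * f t ^+ 2)^-1.
Definition w_a t := x / 2 * (v t)^-1 - r * (f t)^-1.
Definition w_b t := x * (v t)^-1 - 2^-1 * P1 t * (P t)^-1 - r * (f t)^-1.
Definition w_c t := 2^-1 * P1 t * (P t)^-1 - x * (v t)^-1 - r * (f t)^-1.
Definition w_q t := w_a t * (P t * (x * v t)^-1).
Definition w_e t := x / 2 * P t * (v t ^+ 3)^-1.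
Definition w_d t := w_c t * (P t ^+ 2 * (v t ^+ 4)^-1).

Lemma v_gt0 t : Iop t -> 0 < v t.
Proof.
by case/andP: x01 => x0 x1; rewrite /Iop /v /= => /andP[t1 t2]; apply: affine_gt0; [lra|lra|rewrite !ltW].
Qed.
Lemma f_gt0 t : Iop t -> 0 < f t.
Proof. by case/andP: r1 => r0 r2; rewrite /Iop /f /= => /andP[t1 t2]; apply: affine_gt0; [lra|lra|rewrite !ltW]. Qed.

Lemma Cinf_v : Cinf Iop v.
Proof.
move=> k; apply: (CkD open_Iop); first exact: Ck_cst.
by apply: (CkM open_Iop); [exact: Ck_cst|exact: Ck_id].
Qed.
Lemma Cinf_f : Cinf Iop f.
Proof.
move=> k; apply: (CkD open_Iop); first exact: Ck_cst.
by apply: (CkM open_Iop); [exact: Ck_cst|exact: Ck_id].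
Qed.
Lemma Cinf_P1 : Cinf Iop P1.
Proof.
move=> k; apply: (eq_Ck open_Iop _ (Cinf_D1 sP k)) => t _.
by have H := dP t; rewrite (@derive_val _ _ _ _ _ _ _ H).
Qed.

Lemma weights_Cinf : [/\ Cinf Iop w_al, Cinf Iop w_be & Cinf Iop w_ga] /\
  [/\ Cinf Iop w_a, Cinf Iop w_q & Cinf Iop w_e] /\
  [/\ Cinf Iop w_b, Cinf Iop w_c & Cinf Iop w_d].
Proof.
have vn t : Iop t -> v t != 0 by move=> It; apply: lt0r_neq0; exact: v_gt0.
have fn t : Iop t -> f t != 0 by move=> It; apply: lt0r_neq0; exact: f_gt0.
have Pn t : Iop t -> P t != 0 by move=> It; apply: lt0r_neq0; exact: P0.
have xn : x != 0 by case/andP: x01 => x0 _; rewrite gt_eqF.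
have vi k := CkV open_Iop vn (Cinf_v k); have fi k := CkV open_Iop fn (Cinf_f k).
have Pi k := CkV open_Iop Pn (sP k).
have inv g : Cinf Iop g -> (forall t, Iop t -> g t != 0) -> Cinf Iop (fun t => (g t)^-1).
  by move=> sg g0 k; apply: (CkV open_Iop).
have al : Cinf Iop w_al.
  move=> k; apply: (CkM open_Iop); first exact: Cinf_v.
  apply: inv => [l|t It]; last by rewrite mulf_neq0 // expf_neq0 // fn.
  by apply: (CkM open_Iop); [exact: Ck_cst|apply: (CkX _ open_Iop); exact: Cinf_f].
have be : Cinf Iop w_be.
  move=> k; apply: (CkM open_Iop); first by apply: (CkX _ open_Iop); exact: Cinf_v.
  apply: inv => [l|t It]; last by rewrite mulf_neq0 ?Pn // expf_neq0 // fn.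
  by apply: (CkM open_Iop); [exact: sP|apply: (CkX _ open_Iop); exact: Cinf_f].
have ga : Cinf Iop w_ga.
  move=> k; apply: (CkM open_Iop); first exact: sP.
  apply: inv => [l|t It]; last by rewrite mulf_neq0 // expf_neq0 ?vn // fn.
  by apply: (CkM open_Iop); apply: (CkX _ open_Iop); [exact: Cinf_v|exact: Cinf_f].
have a : Cinf Iop w_a.
  by move=> k; apply: (CkB open_Iop); apply: (CkM open_Iop); rewrite //; exact: Ck_cst.
have P1P k : Ck k Iop (fun t => 2^-1 * P1 t * (P t)^-1).
  by apply: (CkM open_Iop) => //; apply: (CkM open_Iop); [exact: Ck_cst|exact: Cinf_P1].
have b : Cinf Iop w_b.
  move=> k; apply: (CkB open_Iop); last by apply: (CkM open_Iop); rewrite //; exact: Ck_cst.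
  by apply: (CkB open_Iop) => //; apply: (CkM open_Iop); rewrite //; exact: Ck_cst.
have c' : Cinf Iop w_c.
  move=> k; apply: (CkB open_Iop); last by apply: (CkM open_Iop); rewrite //; exact: Ck_cst.
  by apply: (CkB open_Iop) => //; apply: (CkM open_Iop); rewrite //; exact: Ck_cst.
have q : Cinf Iop w_q.
  move=> k; apply: (CkM open_Iop) => //; apply: (CkM open_Iop); first exact: sP.
  apply: inv => [l|t It]; last by rewrite mulf_neq0 ?vn.
  by apply: (CkM open_Iop); [exact: Ck_cst|exact: Cinf_v].
have e : Cinf Iop w_e.
  move=> k; apply: (CkM open_Iop).
    by apply: (CkM open_Iop); [exact: Ck_cst|exact: sP].
  apply: inv => [l|t It]; last by rewrite expf_neq0 ?vn.
  by apply: (CkX _ open_Iop); exact: Cinf_v.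
have d : Cinf Iop w_d.
  move=> k; apply: (CkM open_Iop) => //; apply: (CkM open_Iop).
    by apply: (CkX _ open_Iop); exact: sP.
  apply: inv => [l|t It]; last by rewrite expf_neq0 ?vn.
  by apply: (CkX _ open_Iop); exact: Cinf_v.
by [].
Qed.

Lemma weights_neq0 t : Iop t -> [/\ w_al t != 0, w_be t != 0 & w_ga t != 0].
Proof.
move=> It; have vp := v_gt0 It; have fp := f_gt0 It; have Pp := P0 It; case/andP: x01 => x0 _.
by split; rewrite gt_eqF // !(mulr_gt0, invr_gt0, exprn_gt0).
Qed.

Let dv t : is_derive t (1 : R) v x.
Proof. by apply: (der_eq (derD (der_cst t 1) (derZ x (der_id t)))); rewrite add0r mulr1. Qed.
Let df t : is_derive t (1 : R) f r.
Proof. by apply: (der_eq (derD (der_cst t 1) (derZ r (der_id t)))); rewrite add0r mulr1. Qed.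

Let Dval (h : R -> R) t d : is_derive t (1 : R) h d -> 'D_1 h t = d.
Proof. by move=> H; rewrite (@derive_val _ _ _ _ _ _ _ H). Qed.

Lemma weights_derive t : Iop t ->
  [/\ 'D_1 w_al t = 2 * w_a t * w_al t, 'D_1 w_al t = 2 * w_q t * w_be t
    & w_ga t = 2 * w_e t * w_al t] /\
  [/\ 'D_1 w_be t = 2 * w_b t * w_be t, 'D_1 w_ga t = 2 * w_c t * w_ga t
    & 'D_1 w_ga t = 2 * w_d t * w_be t].
Proof.
move=> It; have vn : v t != 0 by apply: lt0r_neq0; exact: v_gt0.
have fn : f t != 0 by apply: lt0r_neq0; exact: f_gt0.
have Pn : P t != 0 by apply: lt0r_neq0; exact: P0.
have xn : x != 0 by case/andP: x01 => x0 _; rewrite gt_eqF.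
have Pt := dP t; have vt := dv t; have ft := df t.
have n1 : x * f t ^+ 2 != 0 by rewrite mulf_neq0 // expf_neq0.
have n2 : P t * f t ^+ 2 != 0 by rewrite mulf_neq0 // expf_neq0.
have n3 : v t ^+ 2 * f t ^+ 2 != 0 by rewrite mulf_neq0 // expf_neq0.
have Dal := Dval (derM vt (@derV _ _ (fun s => x * f s ^+ 2) _ n1 (derZ x (derX 2 ft)))).
have Dbe := Dval (derM (derX 2 vt) (@derV _ _ (fun s => P s * f s ^+ 2) _ n2 (derM Pt (derX 2 ft)))).
have Dga := Dval (derM Pt (@derV _ _ (fun s => v s ^+ 2 * f s ^+ 2) _ n3 (derM (derX 2 vt) (derX 2 ft)))).
rewrite [X in X = 2 * w_a t * _]Dal [X in X = 2 * w_q t * _]Dal [X in X = 2 * w_b t * _]Dbe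
  [X in X = 2 * w_c t * _]Dga [X in X = 2 * w_d t * _]Dga.
rewrite /w_d /w_q /w_e /w_a /w_b /w_c /w_al /w_be /w_ga /=.
move: (P t) (P1 t) (v t) (f t) Pn vn fn => p p1 u s pn un sn.
by do 2!split; field; rewrite ?xn ?pn ?un ?sn.
Qed.

(** The place where the second-order equation for P comes from: on a base of real dimension 4 the
    scalar curvature equals (f^2 x cS v - (f^2 P'' - 10 r f P' + 30 r^2 P)) / v^2 identically, and
    [ode] says that this is c. *)
Lemma weights_scal t : Iop t ->
  (w_al t)^-1 * (cS - 4 * ('D_1 w_q t
    + (4 * w_a t + w_b t + w_c t) * w_q t - 2 * w_a t * w_q t + w_e t))
  + (w_be t)^-1 * (- 4 * 'D_1 w_a t - 4 * w_a t ^+ 2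
      + 4 * w_a t * w_b t - 'D_1 w_c t + w_b t * w_c t - w_c t ^+ 2)
  + (w_ga t)^-1 * (4 * w_e t ^+ 2 - 4 * w_a t * w_d t
      - 'D_1 w_d t - w_b t * w_d t + w_c t * w_d t) = c.
Proof.
move=> It; have vn : v t != 0 by apply: lt0r_neq0; exact: v_gt0.
have fn : f t != 0 by apply: lt0r_neq0; exact: f_gt0.
have Pn : P t != 0 by apply: lt0r_neq0; exact: P0.
have xn : x != 0 by case/andP: x01 => x0 _; rewrite gt_eqF.
have Pt := dP t; have P1t := dP1 t; have vt := dv t; have ft := df t.
have da := derB (derZ (x / 2) (derV vn vt)) (derZ r (derV fn ft)).
have dPP := derM (derZ 2^-1 P1t) (derV Pn Pt).
have dc := derB (derB dPP (derZ x (derV vn vt))) (derZ r (derV fn ft)).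
have xv : x * v t != 0 by rewrite mulf_neq0.
have v4 : v t ^+ 4 != 0 by rewrite expf_neq0.
have dq := derM da (derM Pt (@derV _ _ (fun s => x * v s) _ xv (derZ x vt))).
have dd := derM dc (derM (derX 2 Pt) (@derV _ _ (fun s => v s ^+ 4) _ v4 (derX 4 vt))).
have Ea : 'D_1 w_a t = _ := Dval da.
have Eq : 'D_1 w_q t = _ := Dval dq.
have Ec : 'D_1 w_c t = _ := Dval dc.
have Ed : 'D_1 w_d t = _ := Dval dd.
have odet := ode t; rewrite Ea Eq Ec Ed; rewrite -/(v t) -/(f t) in odet.
have -> : c = (f t ^+ 2 * (x * cS) * v t - (f t ^+ 2 * P2 t - 10 * r * f t * P1 t
   + 30 * r ^+ 2 * P t)) / v t ^+ 2.
  by rewrite odet; field.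
rewrite /w_d /w_q /w_e /w_a /w_b /w_c /w_al /w_be /w_ga /=.
move: (P t) (P1 t) (P2 t) (v t) (f t) Pn vn fn => p p1 p2 u s pn un sn.
by field; rewrite ?xn ?pn ?un ?sn.
Qed.
End EinsteinMaxwellWeights.

Lemma einstein_maxwell_scal (R : realType) (N n : nat) (U : set 'rV[R]_N) (W : set 'rV[R]_n)
    (F : 'rV[R]_N -> 'rV[R]_n) (z : 'rV[R]_N -> R) (th : 'rV[R]_N -> 'cV[R]_N)
    (g : 'rV[R]_n -> 'M[R]_n) (J : 'M[R]_n) (G : 'rV[R]_N -> 'M[R]_N)
    (x r c cS : R) (P P1 P2 : R -> R) (y : 'rV[R]_N) :
  N = (n + 2)%N -> n = 4%N -> open U -> open W ->
  (forall y, U y -> W (F y)) -> (forall y, U y -> Iop (z y)) ->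
  (forall m, Cinf U (fun y => F y 0 m)) -> Cinf U z -> mCinf U th ->
  (forall x, W x -> (g x)^T = g x) -> (forall x, W x -> g x \in unitmx) -> mCinf W g ->
  (forall x, W x -> (J *m g x)^T = - (J *m g x)) -> J *m J = - 1%:M -> \tr J = 0 ->
  (forall y, U y -> extd th y = jacobian F y *m (J *m g (F y)) *m (jacobian F y)^T) ->
  0 < x < 1 -> -1 < r < 1 -> Cinf (@Iop R) P -> (forall t, Iop t -> 0 < P t) ->
  (forall t, is_derive t (1 : R) P (P1 t) /\ is_derive t (1 : R) P1 (P2 t)) ->
  (forall t, (1 + r * t) ^+ 2 * P2 t - 10 * r * (1 + r * t) * P1 t + 30 * r ^+ 2 * P t
      = (1 + r * t) ^+ 2 * (x * cS) * (1 + x * t) - c * (1 + x * t) ^+ 2) ->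
  (forall x, W x -> scal g x = cS) ->
  (forall y, U y -> G y = w_al x r (z y) *: (jacobian F y *m g (F y) *m (jacobian F y)^T)
    + w_be x r P (z y) *: (grad z y *m (grad z y)^T)
    + w_ga x r P (z y) *: (th y *m (th y)^T)) ->
  (forall y, U y -> G y \in unitmx) -> U y ->
  scal G y = c.
Proof.
move=> Nn n4 oU oW FW zI sF sz sth gs gu sg Jg JJ trJ dth x01 r1 sP P0 dP ode cg GE Gu Uy.
have dP1 t : is_derive t (1 : R) P (P1 t) by case: (dP t).
have dP2 t : is_derive t (1 : R) P1 (P2 t) by case: (dP t).
have [[sal sbe sga] [[sa sq se] [sb sc sd]]] := weights_Cinf x01 r1 sP P0 dP1.
have w0 t (It : Iop t) := weights_neq0 x01 r1 P0 It.
have wd t (It : Iop t) := weights_derive x01 r1 P0 dP1 It.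
pose C := calabi_coframe F z th.
pose Gh := calabi_frame_metric F z g (w_al x r) (w_be x r P) (w_ga x r P).
have GE' y' : U y' -> G y' = C y' *m Gh y' *m (C y')^T.
  by move=> Uy'; rewrite GE // /C /Gh (calabi_coframeE _ _ _ sF).
(* G = C Gh C^T is invertible, which exhibits a right inverse of the coframe; equality of the
   dimensions makes it two-sided. *)
pose B y' := Gh y' *m (C y')^T *m invmx (G y').
have CB y' : U y' -> C y' *m B y' = 1%:M.
  by move=> Uy'; rewrite /B !mulmxA -GE' // mulmxV // Gu.
have BC y' : U y' -> B y' *m C y' = 1%:M by move=> Uy'; apply: (mulmx1C_eq Nn); exact: CB.
have sC : mCinf U C by exact: mCinf_calabi_coframe.
have sGh : mCinf U Gh by exact: (mCinf_calabi_frame_metric oU FW zI sF sz sg sal sbe sga).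
have sG : mCinf U G.
  have H : mCinf U (fun y => C y *m Gh y *m (C y)^T).
    by apply: mCinfM => //; [exact: mCinfM|exact: mCinf_tr].
  move=> i j k; apply: (eq_Ck oU _ (H i j k)) => y'; rewrite inE => Uy'.
  by rewrite GE'.
have sB : mCinf U B.
  apply: mCinfM => //; last exact: mCinf_inv.
  by apply: mCinfM => //; exact: mCinf_tr.
have dth' y' i j : U y' -> extd th y' i j =
  \sum_m \sum_v partial i (fun y => F y 0 m) y' * partial j (fun y => F y 0 v) y'
    * (J *m g (F y')) m v.
  move=> Uy'; rewrite dth // (jacobianE (differentiable_base sF Uy')) mxE exchange_big.
  apply: eq_bigr => v _; rewrite [(_ *m _) i v]mxE [(_^T) v j]mxE [X in _ * X]mxE mulr_suml.
  by apply: eq_bigr => m _; rewrite [in LHS]mxE; ring.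
rewrite (@calabi_scal R N n U W (@Iop R) F z th g J oU oW FW zI sF sz sth gs gu sg Jg JJ trJ dth'
  (w_al x r) (w_be x r P) (w_ga x r P) (w_a x r) (w_q x r P) (w_e x P) (w_b x r P P1)
  (w_c x r P P1) (w_d x r P P1) (cst 1) sal sbe sga sa sq se sb sc sd
  (fun t It => let: And3 h _ _ := w0 t It in h) (fun t It => let: And3 _ h _ := w0 t It in h)
  (fun t It => let: And3 _ _ h := w0 t It in h)
  (fun t It => let: conj (And3 h _ _) _ := wd t It in h)
  (fun t It => let: conj (And3 _ h _) _ := wd t It in h)
  (fun t It => let: conj (And3 _ _ h) _ := wd t It in h)
  (fun t It => let: conj _ (And3 h _ _) := wd t It in h)
  (fun t It => let: conj _ (And3 _ h _) := wd t It in h)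
  (fun t It => let: conj _ (And3 _ _ h) := wd t It in h)
  (christoffel g) (@partial R n) erefl erefl erefl B CB BC sB G y GE' Uy).
rewrite (cg _ (FW _ Uy)) n4; exact: (weights_scal x01 r1 P0 dP1 dP2 ode (zI _ Uy)).
Qed.

(** A row vector annihilating P, d and t would annihilate the invertible form, so their columns are
    independent; by N = n + 2 they form a basis, and k is a member of the dual basis. *)
Lemma dual_vector (F : fieldType) N n (P : 'M[F]_(N, n)) (d t : 'cV[F]_N) (g : 'M[F]_n)
    (b c : F) : N = (n + 2)%N ->
  P *m g *m P^T + b *: (d *m d^T) + c *: (t *m t^T) \in unitmx ->
  exists k : 'rV[F]_N, [/\ k *m P = 0, k *m d = 0 & k *m t = 1%:M].
Proof.
move=> Nn; set G := (X in X \in _) => Gu.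
pose C := row_mx P (row_mx d t).
have Cfree : row_free C.
  rewrite -kermx_eq0 -submx0; apply/rV_subP => v /sub_kermxP.
  rewrite /C !mul_mx_row => /eqP; rewrite !row_mx_eq0 => /and3P[/eqP vP /eqP vd /eqP vt].
  have : v *m G = 0.
    by rewrite /G !mulmxDr -!scalemxAr !mulmxA vP vd vt !mul0mx !scaler0 !addr0.
  by move/(congr1 (mulmx^~ (invmx G))); rewrite mulmxK // mul0mx => ->; exact: sub0mx.
have Cfull : row_full C by rewrite /row_full (eqP Cfree) Nn.
pose k := row_mx (0 : 'rV[F]_n) (row_mx (0 : 'M[F]_1) 1%:M) *m pinvmx C.
have : k *m C = row_mx 0 (row_mx 0 1%:M) by rewrite mulmxKpV // submx_full.
rewrite !mul_mx_row => /eq_row_mx[kP /eq_row_mx[kd kt]].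
by exists k.
Qed.

(** Contracting k with G gives T t^T, and J d = - T t together with the J-invariance of G gives r
    times the same for X G; so X = r k without computing the inverse of G. *)
Lemma hamiltonian_field (F : fieldType) N n (P : 'M[F]_(N, n)) (d t : 'cV[F]_N) (g : 'M[F]_n)
    (J G : 'M[F]_N) (T r : F) : N = (n + 2)%N -> T != 0 -> J *m J = - 1%:M ->
  G = P *m g *m P^T + T^-1 *: (d *m d^T) + T *: (t *m t^T) -> G \in unitmx ->
  J *m G *m J^T = G -> - (J *m d) = T *: t ->
  let X := r *: (d^T *m invmx G *m J) in [/\ X *m P = 0, X *m d = 0 & X *m t = r%:M].
Proof.
move=> Nn T0 JJ GE Gu GJ Jd X.
have [k [kP kd kt]] : exists k : 'rV[F]_N, [/\ k *m P = 0, k *m d = 0 & k *m t = 1%:M].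
  by apply: (dual_vector Nn (g := g) (b := T^-1) (c := T)); rewrite -GE.
suff -> : X = r *: k by rewrite -!scalemxAl kP kd kt !scaler0 scale_scalar_mx mulr1.
have JtJ : J^T *m J^T = - 1%:M by rewrite -trmx_mul JJ linearN /= trmx1.
have JG : J *m G = - (G *m J^T).
  by have := congr1 (mulmx^~ J^T) GJ; rewrite -mulmxA JtJ mulmxN mulmx1 => <-; rewrite opprK.
have kG : k *m G = T *: t^T.
  rewrite GE !mulmxDr -!scalemxAr !mulmxA kP kd kt !mul0mx scaler0 !add0r mul1mx //.
rewrite -[LHS](mulmxK Gu) -[RHS](mulmxK Gu); congr (_ *m _).
rewrite /X -!scalemxAl kG -(mulmxA _ J) JG mulmxN -[d^T *m _ *m _]mulmxA mulKmx // -mulmxN; congr (_ *: _).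
by rewrite -linearN -trmx_mul mulNmx Jd linearZ.
Qed.

(** * Charts *)

Lemma jacobian_comp (R : realType) n m k (f : 'rV[R]_n -> 'rV[R]_m) (h : 'rV[R]_m -> 'rV[R]_k)
    (u : 'rV[R]_n -> 'rV[R]_k) x :
  {near x, u =1 h \o f} -> differentiable f x -> differentiable h (f x) ->
  jacobian u x = jacobian f x *m jacobian h (f x).
Proof.
move=> E df dh; have dc : differentiable (h \o f) x by exact: differentiable_comp.
have du : differentiable u x.
  by apply: near_eq_differentiable dc; apply: filterS E => y /= ->.
apply/row_matrixP => i; rewrite !rowE mulmxA /jacobian !mul_rV_lin1.
by rewrite -!deriveE // (near_eq_derive _ E) !deriveE // diff_comp.
Qed.

Lemma grad_comp (R : realType) n m (f : 'rV[R]_n -> 'rV[R]_m) (h : 'rV[R]_m -> R)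
    (u : 'rV[R]_n -> R) x :
  {near x, u =1 h \o f} -> differentiable f x -> differentiable h (f x) ->
  grad u x = jacobian f x *m grad h (f x).
Proof.
move=> E df dh; apply/colP => i; rewrite !mxE /partial (near_eq_derive _ E).
have dfj j : differentiable (fun y => f y 0 j) x.
  apply: (@differentiable_comp _ _ _ _ f (fun v : 'rV[R]_m => v 0 j) x df).
  exact: differentiable_coord.
rewrite derive_comp_row //; apply: eq_bigr => j _.
by rewrite (jacobianE df) !mxE.
Qed.

Section Join.
Context (R : realType) (m : nat).
Implicit Type u : 'rV[R]_((m + 1) + (m + 1)).

Definition join_base u : 'rV[R]_(m + m) :=
  row_mx (lsubmx (lsubmx u)) (lsubmx (rsubmx u)).

Fact join_base_linear : linear join_base.
Proof. by move=> c u v; rewrite /join_base !linearP /= scale_row_mx add_row_mx. Qed.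
HB.instance Definition _ := GRing.isLinear.Build R _ _ _ join_base join_base_linear.

Lemma join_baseE (x : 'rV[R]_(m + m)) (w : R[i]) : join_base (cplx_join x w) = x.
Proof. by rewrite /join_base /cplx_join row_mxKl row_mxKr !row_mxKl hsubmxK. Qed.

Lemma join_base_coord j : exists k, forall u, join_base u 0 j = u 0 k.
Proof.
rewrite /join_base -(fintype.splitK j); case: (fintype.split j) => k /=.
  by exists (lshift _ (lshift _ k)) => u; rewrite row_mxEl !mxE.
by exists (rshift _ (lshift _ k)) => u; rewrite row_mxEr !mxE.
Qed.

Lemma join_baseJ u : join_base (u *m Jmx R (m + 1)) = join_base u *m Jmx R m.
Proof.
rewrite -[u in LHS]hsubmxK /Jmx mul_row_block /join_base !mulmx0 add0r addr0.
rewrite row_mxKl row_mxKr mul_row_block !mulmx0 add0r addr0 !mulmxN !mulmx1.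
by rewrite linearN.
Qed.

Lemma join_inj (x x' : 'rV[R]_(m + m)) (w w' : R[i]) : cplx_join x w = cplx_join x' w' -> x = x' /\ w = w'.
Proof.
rewrite /cplx_join => /eq_row_mx[/eq_row_mx[l r] /eq_row_mx[l' r']].
split; first by rewrite -[x]hsubmxK -[x']hsubmxK l l'.
apply/eqP; rewrite eq_complex; apply/andP; split; apply/eqP.
  by have := congr1 (fun M : 'M[R]_1 => M 0 0) r; rewrite !mxE eqxx !mulr1n.
by have := congr1 (fun M : 'M[R]_1 => M 0 0) r'; rewrite !mxE eqxx !mulr1n.
Qed.
End Join.

Lemma Jmx_sqr (R : realType) m : Jmx R m *m Jmx R m = - 1%:M.
Proof.
rewrite /Jmx mulmx_block !mul0mx !mulmx0 !mul1mx !mulmx1 !addr0 !add0r.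
by rewrite scalar_mx_block opp_block_mx oppr0.
Qed.

Lemma tr_Jmx (R : realType) m : (Jmx R m)^T = - Jmx R m.
Proof.
by rewrite /Jmx tr_block_mx !linear0 linearN /= trmx1 opp_block_mx !oppr0 opprK.
Qed.

Lemma trace_Jmx (R : realType) m : \tr (Jmx R m) = 0.
Proof. by rewrite /Jmx mxtrace_block !linear0 addr0. Qed.

Section Charts.
Context (R : realType) (m : nat) (X : cmanifold R m).
Implicit Types (a b : chart X) (D O : set X).

Lemma paramK a p : dom a p -> param a (coord a p) = p.
Proof. by have [_ _ H _ _] := cm_chart a; exact: H. Qed.

Lemma coordK a y : cdom a y -> coord a (param a y) = y.
Proof. by case=> p ap <-; rewrite paramK. Qed.

Lemma dom_param a y : cdom a y -> dom a (param a y).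
Proof. by case=> p ap <-; rewrite paramK. Qed.

Lemma cdom_coord a p : dom a p -> cdom a (coord a p).
Proof. by move=> ap; exists p. Qed.

Lemma open_dom a : open (dom a).
Proof. by have [] := cm_chart a. Qed.

Lemma open_cdom a : open (cdom a).
Proof. by have [_ H] := cm_chart a. Qed.

Lemma near_param a y O : cdom a y -> open O -> O (param a y) ->
  \forall y' \near y, cdom a y' /\ O (param a y').
Proof.
move=> ay oO Oy; have [_ _ _ _ cp] := cm_chart a.
have H1 : \forall y' \near y, cdom a y' by apply: open_nbhs_nbhs; split=> //; exact: open_cdom.
have H2 : \forall y' \near y, O (param a y').
  by apply: (cp y ay); apply: open_nbhs_nbhs.
by apply: filterS2 H1 H2.
Qed.

Lemma imageE a O : coord a @` (dom a `&` O) = [set y | cdom a y /\ O (param a y)].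
Proof.
apply/seteqP; split=> y.
  by move=> [p [ap Op] <-]; rewrite /= paramK //; split=> //; exists p.
by move=> [ay Oy]; exists (param a y); [split=> //; exact: dom_param|exact: coordK].
Qed.

Lemma open_image a O : open O -> open (coord a @` (dom a `&` O)).
Proof.
move=> oO; rewrite imageE openE => y [ay Oy]; exact: near_param.
Qed.

Lemma smooth_funP (D : set X) f : open D ->
  smooth_fun_on D f <-> forall a, Cinf (coord a @` (dom a `&` D)) (f \o param a).
Proof.
move=> oD; split=> H a.
  by apply/smooth_onP; [exact: open_image|exact: H].
by apply/smooth_onP; [exact: open_image|exact: H].
Qed.

Lemma smooth_funTP f : smooth_fun_on setT f <-> forall a, Cinf (@cdom _ _ X a) (f \o param a).
Proof.
rewrite smooth_funP; last exact: openT.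
by split=> H a; have := H a; rewrite setIT.
Qed.

Lemma transition_diff a b p : dom a p -> dom b p ->
  differentiable (coord b \o param a) (coord a p).
Proof.
move=> ap bp; apply: differentiable_row => j.
have [sT _] := cm_transition a b; apply: (sT j [::]).
by exists p.
Qed.

Lemma near_transition a b p : dom a p -> dom b p ->
  \forall y \near coord a p, param b (coord b (param a y)) = param a y.
Proof.
move=> ap bp; have := @near_param a (coord a p) (dom b) (cdom_coord ap) (open_dom b).
rewrite paramK // => /(_ bp); apply: filterS => y [ay by_]; exact: paramK.
Qed.

Lemma transition_J a b p : dom a p -> dom b p ->
  Jmx R m *m jacobian (coord b \o param a) (coord a p) =
  jacobian (coord b \o param a) (coord a p) *m Jmx R m.
Proof. by move=> ap bp; have [_ H] := cm_transition a b; apply: H; exists p. Qed.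

Lemma grad_transition (f : X -> R) a b p : dom a p -> dom b p ->
  differentiable (f \o param b) (coord b p) ->
  grad (f \o param a) (coord a p) =
    jacobian (coord b \o param a) (coord a p) *m grad (f \o param b) (coord b p).
Proof.
move=> ap bp df; have E : (coord b \o param a) (coord a p) = coord b p by rewrite /= paramK.
rewrite -E; apply: grad_comp; [|exact: transition_diff|by rewrite E].
by apply: filterS (near_transition ap bp) => y /= ->.
Qed.

Lemma jacobian_transition k (F : X -> 'rV[R]_k) a b p : dom a p -> dom b p ->
  differentiable (F \o param b) (coord b p) ->
  jacobian (F \o param a) (coord a p) =
    jacobian (coord b \o param a) (coord a p) *m jacobian (F \o param b) (coord b p).
Proof.
move=> ap bp df; have E : (coord b \o param a) (coord a p) = coord b p by rewrite /= paramK.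
rewrite -E; apply: jacobian_comp; [|exact: transition_diff|by rewrite E].
by apply: filterS (near_transition ap bp) => y /= ->.
Qed.
End Charts.

(** * Charts of the projective bundle *)

Lemma diff_linear_comp (R : realType) (V W : normedModType R) n
    (L : {linear 'rV[R]_n -> W}) (f : V -> 'rV[R]_n) (x : V) :
  differentiable f x -> 'd (L \o f) x = L \o 'd f x :> (V -> W).
Proof.
move=> df; have cL : continuous L by exact: linear_row_continuous.
by rewrite diff_comp ?diff_lin //; apply: linear_differentiable.
Qed.

Lemma Ck_local (R : realType) (V : normedModType R) n (U : set V) (f : V -> R) :
  (forall x, U x -> exists2 Z : set V, Z x & Ck n Z f) -> Ck n U f.
Proof.
elim: n f => [|n IH] f H; split=> //;
  try by move=> x Ux; have [Z Zx CZ] := H x Ux; exact: Ck_diff CZ Zx.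
by move=> v; apply: IH => x Ux; have [Z Zx [_ CZ]] := H x Ux; exists Z => //; exact: CZ.
Qed.

Lemma Cinf_local (R : realType) (V : normedModType R) (U : set V) (f : V -> R) :
  (forall x, U x -> exists2 Z : set V, Z x & Cinf Z f) -> Cinf U f.
Proof. by move=> H n; apply: Ck_local => x /H[Z Zx CZ]; exists Z. Qed.

Section ProjectiveBundle.
Context (R : realType) (m : nat) (S : cmanifold R m) (E : line_bundle S) (M : proj_bundle E).
Implicit Types (a : chart S) (b : chart M) (i : frame E) (q : M).

Definition trivial_set a i : set M := [set q | dom a (proj q) /\ fdom i (proj q)].
Definition off_sections : set M := [set q | ~ sect true q /\ ~ sect false q].

Lemma trivial_set_cover q : exists a i, trivial_set a i q.
Proof.
have [a aq] := cm_cover (proj q); have [i iq] := lb_cover E (proj q).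
by exists a, i.
Qed.

Lemma open_trivial_minus a i s : open (trivial_set a i `\` sect s).
Proof. by have [psi [[hc _] _]] := pb_chart M a i s; case: hc. Qed.

Lemma open_trivial_set a i : open (trivial_set a i).
Proof.
rewrite (_ : trivial_set a i =
  (trivial_set a i `\` sect true) `|` (trivial_set a i `\` sect false)).
  by apply: openU; exact: open_trivial_minus.
rewrite -setDIr (_ : _ `&` _ = set0) ?setD0 //.
by apply/seteqP; split=> q //; exact: pb_disjoint.
Qed.

Lemma open_trivial_off a i : open (trivial_set a i `&` off_sections).
Proof.
rewrite (_ : trivial_set a i `&` off_sections =
  (trivial_set a i `\` sect true) `&` (trivial_set a i `\` sect false)).
  by apply: openI; exact: open_trivial_minus.
by apply/seteqP; split=> q [] => [Tq []|[Tq ? [_ ?]]].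
Qed.

Definition base_map a b y := coord a (proj (param b y)).

(** The two sections are disjoint, so near every point one of the two trivialising charts is
    available; there the base map is that chart followed by the complex linear projection
    [join_base]. *)
Lemma base_map_holomorphic a b i :
  (forall j, Cinf (coord b @` (dom b `&` trivial_set a i)) (fun y => base_map a b y 0 j)) /\
  forall y, (coord b @` (dom b `&` trivial_set a i)) y ->
    Jmx R (m + 1) *m jacobian (base_map a b) y = jacobian (base_map a b) y *m Jmx R m.
Proof.
set U := coord b @` _; have oU : open U by exact/open_image/open_trivial_set.
have loc y : U y -> exists V, [/\ open V, V y,
    (forall j, Cinf V (fun y => base_map a b y 0 j)) &
    Jmx R (m + 1) *m jacobian (base_map a b) y = jacobian (base_map a b) y *m Jmx R m].
  rewrite /U imageE => -[by_ Ty].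
  have [s ns] : exists s, ~ sect s (param b y).
    have [st|st] := pselect (sect true (param b y)); last by exists true.
    by exists false => sf; apply: (@pb_disjoint _ _ _ _ M (param b y)).
  have [psi [[hc hol] _]] := pb_chart M a i s.
  set D := (X in homeo_chart X _ _) in hc hol; set phi := (X in homeo_chart _ X _) in hc hol.
  have [_ [sphi Jphi]] := hol b.
  have oD : open D by case: hc.
  exists (coord b @` (D `&` dom b)); split.
  - by rewrite setIC; apply: open_image.
  - by exists (param b y); [split=> //; exact: dom_param|exact: coordK].
  - move=> j; have [k jk] := join_base_coord R j.
    have := (smooth_onP _ _).1 (sphi k); rewrite setIC => /(_ (open_image (a := b) oD)).
    rewrite (_ : (fun y => base_map a b y 0 j) = (fun y => (phi \o param b) y 0 k)) //.
    by apply/funext => y'; rewrite -jk /= /phi join_baseE.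
  - have Dy : (coord b @` (D `&` dom b)) y.
      by exists (param b y); [split=> //; exact: dom_param|exact: coordK].
    have dphi : differentiable (phi \o param b) y.
      by apply: differentiable_row => j; exact: (sphi j [::]).
    have FE : base_map a b = @join_base R m \o (phi \o param b).
      by apply/funext => y'; rewrite /= /phi join_baseE.
    have JE v : v *m jacobian (base_map a b) y =
        join_base (v *m jacobian (phi \o param b) y).
      by rewrite /jacobian !mul_rV_lin1 FE diff_linear_comp.
    apply/row_matrixP => k; rewrite !rowE !mulmxA.
    transitivity (join_base ((delta_mx 0 k : 'rV[R]_((m + 1) + (m + 1)))
      *m (Jmx R (m + 1) *m jacobian (phi \o param b) y))); first by rewrite mulmxA JE.
    by rewrite Jphi // mulmxA join_baseJ -JE.
split=> [j|y Uy]; last by case: (loc y Uy) => V [].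
by apply: Cinf_local => y Uy; have [V [_ Vy sV _]] := loc y Uy; exists V.
Qed.

(** On a section one of the fibre coordinates vanishes. Giving it a small nonzero real value t moves
    the point along the fibre off both sections, and the point returns as t tends to 0. *)
Lemma off_sections_dense a b i y (O : set 'rV[R]_((m + 1) + (m + 1))) :
  (coord b @` (dom b `&` trivial_set a i)) y -> nbhs y O ->
  exists2 y', O y' & (coord b @` (dom b `&` (trivial_set a i `&` off_sections))) y'.
Proof.
rewrite imageE => -[by_ Ty] Oy; set q := param b y in Ty.
have bq : dom b q by exact: dom_param.
have [oq|noq] := pselect (off_sections q).
  exists y; first exact: nbhs_singleton.
  by exists q; [split|exact: coordK].
have [s [ns sq]] : exists s, ~ sect s q /\ sect (~~ s) q.
  have [st|st] := pselect (sect true q).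
    by exists false; split=> // sf; exact: (@pb_disjoint _ _ _ _ M q).
  by exists true; split=> //; apply: contrapT => sf; apply: noq.
have [psi [[hc hol] im]] := pb_chart M a i s.
set D := (X in homeo_chart X _ _) in hc hol im; set phi := (X in homeo_chart _ X _) in hc hol im.
have [oD oim psiK cphi cpsi] := hc.
have Dq : D q by [].
have w0 : fib i s q = 0 by apply/(pb_zero Ty.2 ns).
pose e : 'rV[R]_((m + 1) + (m + 1)) := cplx_join 0 (Complex 1 0).
have uE t : phi q + t *: e = cplx_join (coord a (proj q)) (Complex t 0).
  rewrite /phi w0 /e /cplx_join !linear0 !(scale_row_mx, add_row_mx) !scaler0 !addr0 /=.
  by rewrite !scale_scalar_mx mulr1 mulr0 -!raddfD /= !add0r.
have Du t : (phi @` D) (phi q + t *: e).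
  by rewrite im uE; exists (proj q), (Complex t 0); split=> //; case: Ty.
pose p t := psi (phi q + t *: e).
have Dp t : D (p t) /\ phi (p t) = phi q + t *: e.
  by have [q' Dq' E'] := Du t; rewrite /p -E' psiK.
have cp : \forall t \near (0 : R), dom b (p t) /\ O (coord b (p t)).
  have cu : {for (0 : R), continuous (fun t : R => phi q + t *: e)}.
    have dl : is_diff (0 : R) (fun s : R => phi q + s *: e) (0 + *:%R^~ e).
      exact: is_diffD.
    by apply: differentiable_continuous; exact: (@ex_diff _ _ _ _ _ _ _ dl).
  have p0 : psi (phi q + 0 *: e) = q by rewrite scale0r addr0 psiK.
  have H : \forall q' \near q, dom b q' /\ O (coord b q').
    have [_ _ _ cb _] := cm_chart b.
    have H1 : \forall q' \near q, dom b q'.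
      by apply: open_nbhs_nbhs; split=> //; exact: open_dom.
    have H2 : \forall q' \near q, O (coord b q').
      by apply: (cb q bq); rewrite /q coordK.
    by apply: filterS2 H1 H2.
  rewrite -p0 in H; have H' := cpsi _ (Du 0) _ H; exact: (cu _ H').
have [t t0 [bt Ot]] : exists2 t : R, t != 0 & dom b (p t) /\ O (coord b (p t)).
  move/nbhs_ballP: cp => [d /= d0 Hd]; exists (d / 2).
    by rewrite gt_eqF // divr_gt0.
  apply: Hd; rewrite /ball /= sub0r normrN gtr0_norm ?divr_gt0 //.
  by rewrite ltr_pdivrMr // ltr_pMr // ltr1n.
exists (coord b (p t)) => //; exists (p t) => //; split=> //.
have [[Tp np] Ep] := Dp t.
have [_ wt] : coord a (proj (p t)) = coord a (proj q) /\ fib i s (p t) = Complex t 0.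
  by apply: (@join_inj R m); rewrite -uE -Ep.
have np' : ~ sect (~~ s) (p t).
  move/(pb_zero Tp.2 np); rewrite wt => /eqP; rewrite eq_complex /= => /andP[t0' _].
  by rewrite t0' in t0.
by split=> //; split; case: (s) np np'.
Qed.
End ProjectiveBundle.

(** * Pull-back of tensors from the base *)

Section Pullback.
Context (R : realType) (m : nat) (S : cmanifold R m) (E : line_bundle S) (M : proj_bundle E).
Implicit Types (a : chart S) (b : chart M) (i : frame E) (q : M) (T : tensor2 S).

Definition over a : set M := [set q | dom a (proj q)].

Lemma overE a q : over a q -> exists i, trivial_set a i q.
Proof. by move=> aq; have [i iq] := lb_cover E (proj q); exists i. Qed.

Lemma open_over a : open (over a).
Proof.
rewrite openE => q aq; have [i Tq] := overE aq.
have : \forall q' \near q, trivial_set a i q'.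
  by apply: open_nbhs_nbhs; split=> //; exact: open_trivial_set.
by apply: filterS => q' [].
Qed.

Lemma base_map_Cinf a b j :
  Cinf (coord b @` (dom b `&` over a)) (fun y => base_map a b y 0 j).
Proof.
apply: Cinf_local => y; rewrite imageE => -[by_ ay]; have [i Ty] := overE ay.
exists (coord b @` (dom b `&` trivial_set a i)); first by rewrite imageE.
exact: (base_map_holomorphic a b i).1.
Qed.

Lemma base_map_diff a b y : cdom b y -> over a (param b y) -> differentiable (base_map a b) y.
Proof.
move=> by_ ay; apply: differentiable_row => j; apply: (Ck_diff (base_map_Cinf a b j 0%N)).
by rewrite imageE.
Qed.

Lemma base_map_J a b y : cdom b y -> over a (param b y) ->
  Jmx R (m + 1) *m jacobian (base_map a b) y = jacobian (base_map a b) y *m Jmx R m.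
Proof.
move=> by_ ay; have [i Ty] := overE ay.
by apply: (base_map_holomorphic a b i).2; rewrite imageE.
Qed.

Lemma base_map_cdom a b y : over a (param b y) -> cdom a (base_map a b y).
Proof. by move=> ay; exact: cdom_coord. Qed.

Lemma pullback2E a b T y :
  pullback2 a b T y = jacobian (base_map a b) y *m T a (base_map a b y)
    *m (jacobian (base_map a b) y)^T.
Proof. by []. Qed.

Lemma pullback2_Cinf a b T : smooth_tensor2 T ->
  mCinf (coord b @` (dom b `&` over a)) (pullback2 a b T).
Proof.
move=> [sT _]; set U := (X in mCinf X); have oU : open U by exact/open_image/open_over.
have sJ : mCinf U (jacobian (base_map a b)).
  move=> k j n; apply: (eq_Ck oU _ (Cinf_partial k (base_map_Cinf a b j) n)) => y.
  by rewrite inE /U imageE => -[by_ ay]; rewrite (jacobianE (base_map_diff by_ ay)) mxE.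
have sTF : mCinf U (fun y => T a (base_map a b y)).
  move=> k l n; apply: (Ck_comp_row (W := @cdom _ _ S a) oU (F := fun u => T a u k l)).
  - by move=> y; rewrite /U imageE => -[_ ay]; exact: base_map_cdom.
  - by have /smooth_onP := sT a k l; apply; exact: open_cdom.
  - by move=> j; exact: base_map_Cinf.
by apply: mCinfM => //; [exact: mCinfM|exact: mCinf_tr].
Qed.

Lemma pullback2_indep a a' b T y : smooth_tensor2 T -> cdom b y ->
  over a (param b y) -> over a' (param b y) -> pullback2 a b T y = pullback2 a' b T y.
Proof.
move=> [_ tT] by_ ay ay'; rewrite !pullback2E.
have E1 : base_map a b y = (coord a \o param a') (base_map a' b y).
  by rewrite /base_map /= paramK.
have JE : jacobian (base_map a b) y = jacobian (base_map a' b) y *m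
    jacobian (coord a \o param a') (base_map a' b y).
  apply: jacobian_comp; [|exact: base_map_diff|exact: transition_diff].
  have := near_param by_ (open_over a') ay'; apply: filterS => y' [_ ay''].
  by rewrite /base_map /= paramK.
by rewrite JE [T a' _](tT a' a) // trmx_mul !mulmxA.
Qed.

Lemma pullback2_transition a b b' T q : dom b q -> dom b' q -> over a q ->
  pullback2 a b T (coord b q) = jacobian (coord b' \o param b) (coord b q) *m
    pullback2 a b' T (coord b' q) *m (jacobian (coord b' \o param b) (coord b q))^T.
Proof.
move=> bq bq' aq; rewrite !pullback2E /base_map !paramK //.
have := @jacobian_transition _ _ M _ (fun q => coord a (proj q)) b b' q bq bq'.
rewrite -[_ \o param b']/(base_map a b') => -> //.
  by rewrite trmx_mul !mulmxA.
by apply: base_map_diff; [exact: cdom_coord|rewrite paramK].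
Qed.

Lemma pullback2_J a b T y : cdom b y -> over a (param b y) ->
  Jmx R (m + 1) *m pullback2 a b T y = pullback2 a b (kform T) y.
Proof. by move=> by_ ay; rewrite !pullback2E !mulmxA base_map_J // /kform !mulmxA. Qed.

Lemma pullback2_tr a b T y :
  (pullback2 a b T y)^T = pullback2 a b (fun a y => (T a y)^T) y.
Proof. by rewrite !pullback2E !trmx_mul trmxK mulmxA. Qed.

Definition base_chart b y : chart S := projT1 (cid (cm_cover (proj (param b y)))).

Lemma base_chartP b y : over (base_chart b y) (param b y).
Proof. by rewrite /base_chart; case: cid. Qed.

(** The global pull-back. The base chart is chosen point by point, which is harmless because
    [pullback2_indep] makes the value independent of it. *)
Definition piS T : tensor2 M := fun b y => pullback2 (base_chart b y) b T y.

Lemma piSE T a b y : smooth_tensor2 T -> cdom b y -> over a (param b y) ->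
  piS T b y = pullback2 a b T y.
Proof. by move=> sT by_ ay; apply: pullback2_indep => //; exact: base_chartP. Qed.

Lemma piS_smooth T : smooth_tensor2 T -> smooth_tensor2 (piS T).
Proof.
move=> sT; split=> [b k l|b b' q bq bq'].
  apply/smooth_onP; first exact: open_cdom.
  apply: Cinf_local => y by_; pose a := base_chart b y.
  exists (coord b @` (dom b `&` over a)); first by rewrite imageE; split=> //; exact: base_chartP.
  move=> n; apply: (eq_Ck _ _ (pullback2_Cinf a b sT k l n)); first exact/open_image/open_over.
  by move=> y'; rewrite inE imageE => -[by' ay']; rewrite (piSE sT by' ay').
have [a aq] := cm_cover (proj q).
rewrite !(piSE (a := a)) ?paramK //; try exact: cdom_coord.
exact: pullback2_transition.
Qed.
End Pullback.

(** * Closed forms and density *)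

Lemma kform_skew (R : comNzRingType) n (J g : 'M[R]_n) : J *m J = - 1%:M -> J^T = - J -> g^T = g ->
  J *m g *m J^T = g -> (J *m g)^T = - (J *m g).
Proof.
move=> JJ JT gs gJ; rewrite trmx_mul gs JT mulmxN; congr (- _).
by rewrite -[in LHS]gJ -!mulmxA JT mulNmx JJ opprK mulmx1.
Qed.

Lemma extd_closed (R : realType) n (U : set 'rV[R]_n) (beta : 'rV[R]_n -> 'cV[R]_n) :
  open U -> mCinf U beta -> closed_form2 U (extd beta).
Proof.
move=> oU sb y i j k Uy.
have E a b c : partial a (fun y => extd beta y b c) y =
    partial a (partial b (fun y => beta y c 0)) y - partial a (partial c (fun y => beta y b 0)) y.
  have -> : (fun y => extd beta y b c) =
      (fun y => partial b (fun y => beta y c 0) y + - partial c (fun y => beta y b 0) y).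
    by apply/funext => y'; rewrite mxE.
  have d e f : differentiable (partial e (fun y => beta y f 0)) y.
    exact: (Ck_diff (Cinf_partial e (sb f 0) 0%N) Uy).
  by rewrite partialD ?partialN //; exact: differentiableN.
rewrite !E (partial_swap j i oU Uy (sb k 0)) (partial_swap k i oU Uy (sb j 0)).
rewrite (partial_swap k j oU Uy (sb i 0)).
move: (partial i (partial j _) y) (partial i (partial k _) y) (partial j (partial k _) y).
by move=> u v w; ring.
Qed.

Lemma extd_scale (R : realType) n (U : set 'rV[R]_n) (h : 'rV[R]_n -> R) (t beta : 'rV[R]_n -> 'cV[R]_n) y :
  open U -> U y -> differentiable h y -> mdiff t y ->
  (forall y, U y -> beta y = h y *: t y) ->
  extd beta y = h y *: extd t y + (grad h y *m (t y)^T - t y *m (grad h y)^T).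
Proof.
move=> oU Uy dh dt bE; apply/matrixP => i j.
have E a b : partial a (fun y => beta y b 0) y =
    partial a h y * t y b 0 + h y * partial a (fun y => t y b 0) y.
  rewrite -(partialM a dh (dt b 0)); apply: (eq_partial _ oU _ Uy) => y'.
  by rewrite inE => /bE ->; rewrite mxE.
by rewrite !mxE !E !big_ord1 !mxE; ring.
Qed.

Section TensorCalculus.
Context (R : realType) (m : nat) (X : cmanifold R m).
Implicit Types (g : tensor2 X) (a : chart X).

Lemma smooth_tensor2_Cinf g a : smooth_tensor2 g -> mCinf (@cdom _ _ X a) (g a).
Proof. by move=> [sg _] k l; have /smooth_onP := sg a k l; apply; exact: open_cdom. Qed.

Lemma smooth_kform g : smooth_tensor2 g -> smooth_tensor2 (kform g).
Proof.
move=> sg; split=> [a k l|a b p ap bp].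
  apply/smooth_onP; first exact: open_cdom.
  have H : mCinf (@cdom _ _ X a) (fun y => Jmx R m *m g a y).
    by apply: mCinfM; [exact: open_cdom|exact: mCinf_cst|exact: smooth_tensor2_Cinf].
  exact: H.
by rewrite /kform (sg.2 a b) // !mulmxA transition_J.
Qed.

Lemma kahler_unit g a y : kahler g -> cdom a y -> g a y \in unitmx.
Proof.
move=> [_ _ gp _ _] ay; rewrite -row_free_unit -kermx_eq0 -submx0.
apply/rV_subP => v /sub_kermxP vg; have [-> //|v0] := eqVneq v 0; first exact: sub0mx.
by have := gp a y v ay v0; rewrite vg mul0mx mxE ltxx.
Qed.

End TensorCalculus.

Section Density.
Context (R : realType) (m : nat) (S : cmanifold R m) (E : line_bundle S) (M : proj_bundle E).

Definition off_chart (a : chart S) (b : chart M) (i : frame E) :=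
  coord b @` (dom b `&` (trivial_set a i `&` @off_sections _ _ _ _ M)).

Lemma open_off_chart a b i : open (off_chart a b i).
Proof. exact/open_image/open_trivial_off. Qed.

Lemma off_chartP a b i y : off_chart a b i y ->
  [/\ cdom b y, trivial_set a i (param b y) & off_sections (param b y)].
Proof. by rewrite /off_chart imageE => -[? []]. Qed.

Lemma dense_closed (b : chart M) (h : 'rV[R]_((m + 1) + (m + 1)) -> R) (C : set R) y :
  closed C -> cdom b y -> {for y, continuous h} ->
  (forall a i y, off_chart a b i y -> C (h y)) -> C (h y).
Proof.
move=> cC by_ ch H; apply: contrapT => nC.
have [a [i Ty]] := trivial_set_cover (param b y).
have hO : nbhs y [set y' | ~ C (h y')].
  apply: (ch (~` C)); apply: open_nbhs_nbhs; split=> //; exact: closed_openC.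
have [|y' nCy' y'off] := @off_sections_dense _ _ _ _ M a b i y _ _ hO.
  by rewrite imageE.
by apply: nCy'; exact: (H a i).
Qed.

Lemma dense_eq (b : chart M) (h : 'rV[R]_((m + 1) + (m + 1)) -> R) (c : R) y :
  cdom b y -> {for y, continuous h} ->
  (forall a i y, off_chart a b i y -> h y = c) -> h y = c.
Proof.
move=> by_ ch H; apply: (@dense_closed b h [set c] y) => //; exact: closed_eq.
Qed.

Lemma dense_mx_eq p q (b : chart M) (A B : 'rV[R]_((m + 1) + (m + 1)) -> 'M[R]_(p, q)) y :
  cdom b y -> mCinf (@cdom _ _ M b) A -> mCinf (@cdom _ _ M b) B ->
  (forall a i y, off_chart a b i y -> A y = B y) -> A y = B y.
Proof.
move=> by_ sA sB H; apply/matrixP => k l; apply/eqP; rewrite -subr_eq0; apply/eqP.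
apply: (@dense_eq b (fun y => A y k l - B y k l)) => //; last first.
  by move=> a i y' /H ->; rewrite subrr.
apply: differentiable_continuous; apply: differentiableB.
  exact: (Ck_diff (sA k l 0%N) by_).
exact: (Ck_diff (sB k l 0%N) by_).
Qed.
End Density.

(** * Admissible metrics off the two sections *)

Section AnsatzOff.
Context (R : realType) (m : nat) (S : cmanifold R m) (gS : tensor2 S).
Context (E : line_bundle S) (M : proj_bundle E).
Context (x : R) (g : tensor2 M) (H : frame E -> S -> R) (Theta : R -> R) (z : M -> R).
Implicit Types (a : chart S) (b : chart M) (i : frame E).

(** The local clause of [admissible], isolated because it is used both for the given data and for
    the deformed ones. *)
Definition calabi_ansatz := forall a b i q, dom b q -> dom a (proj q) -> fdom i (proj q) ->
  ~ sect true q -> ~ sect false q ->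
  let y := coord b q in
  let theta := theta_form H b i in
  let dz := grad (z \o param b) y in
  let base := (1 + x * z q) / x in
  [/\ extd theta y = pullback2 a b (kform gS) y,
      - (Jmx R (m + 1) *m dz) = Theta (z q) *: theta y,
      g b y = base *: pullback2 a b gS y
              + (Theta (z q))^-1 *: (dz *m dz^T)
              + Theta (z q) *: (theta y *m (theta y)^T),
      kform g b y = base *: pullback2 a b (kform gS) y
                    + (dz *m (theta y)^T - theta y *m dz^T) &
      forall k, is_K a b i y k ->
        k *m kform g b y = - dz^T /\ k *m theta y = 1%:M].

Hypotheses (x0 : 0 < x) (kg : kahler g) (kS : kahler gS) (sz : smooth_fun_on setT z)
  (zI : forall q, -1 <= z q <= 1) (T1 : Theta (-1) = 0 /\ Theta 1 = 0)
  (Tp : forall t, -1 < t < 1 -> 0 < Theta t) (sT : Cinf (@Iop R) Theta)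
  (ans : calabi_ansatz).

Section OffChart.
Context (a : chart S) (b : chart M) (i : frame E).
Implicit Type y : 'rV[R]_((m + 1) + (m + 1)).

Let th := @theta_form _ _ _ _ M H b i.
Let P := jacobian (base_map a b).
Let zb := z \o param b.

Lemma ansatz_off y : off_chart a b i y ->
  [/\ extd th y = pullback2 a b (kform gS) y,
      - (Jmx R (m + 1) *m grad zb y) = Theta (zb y) *: th y,
      g b y = (1 + x * zb y) / x *: pullback2 a b gS y
              + (Theta (zb y))^-1 *: (grad zb y *m (grad zb y)^T)
              + Theta (zb y) *: (th y *m (th y)^T),
      kform g b y = (1 + x * zb y) / x *: pullback2 a b (kform gS) y
                    + (grad zb y *m (th y)^T - th y *m (grad zb y)^T) &
      forall k, is_K a b i y k ->
        k *m kform g b y = - (grad zb y)^T /\ k *m th y = 1%:M].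
Proof.
move=> /off_chartP[by_ [ay iy] [nt nf]].
by have := ans (dom_param by_) ay iy nt nf; rewrite (coordK by_).
Qed.

(** That the momentum stays strictly between -1 and 1 off the sections follows from positivity of
    the metric: where Theta(z) = 0 the last two terms of g vanish, the inverse of 0 being 0, and g
    is a multiple of a tensor pulled back from the base. *)
Lemma Theta_off y : off_chart a b i y -> 0 < Theta (zb y) /\ Iop (zb y).
Proof.
move=> yo; have [by_ Ty _] := off_chartP yo.
have Tn : Theta (zb y) != 0.
  apply/eqP => T0; have [_ _ gE _ _] := ansatz_off yo.
  (* The Jacobian of the projection has two more rows than columns, so a nonzero vertical vector
     exists, and it would have g-norm zero. *)
  have ker0 : kermx (P y) != 0.
    rewrite -mxrank_eq0 mxrank_ker subn_eq0 -ltnNge.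
    by apply: (leq_ltn_trans (rank_leq_col _)); rewrite !addn1 addSn addnS ltnS leqW.
  pose v := nz_row (kermx (P y)).
  have v0 : v != 0 by rewrite nz_row_eq0.
  have vP : v *m P y = 0 by apply/sub_kermxP; exact: nz_row_sub.
  have [_ _ gp _ _] := kg; have := gp b y v by_ v0.
  rewrite gE T0 invr0 !scale0r !addr0 -scalemxAr -scalemxAl pullback2E -/(P y) !mulmxA vP.
  by rewrite !mul0mx scaler0 mxE ltxx.
have It : Iop (zb y).
  have /andP[z1 z2] := zI (param b y); rewrite /Iop /= /zb /= !lt_neqAle z1 z2 !andbT.
  rewrite eq_sym; apply/andP; split; apply/eqP => E'; move: Tn; rewrite /zb /= E' ?T1.1 ?T1.2 ?eqxx //.
by split=> //; exact: Tp.
Qed.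

Lemma z_Cinf : Cinf (@cdom _ _ M b) zb.
Proof. exact: ((smooth_funTP z).1 sz b). Qed.

Lemma off_cdom : off_chart a b i `<=` @cdom _ _ M b.
Proof. by move=> y /off_chartP[]. Qed.

Lemma sub_Cinf (V : normedModType R) (U U' : set V) (f : V -> R) :
  U' `<=` U -> Cinf U f -> Cinf U' f.
Proof. by move=> UU sf n; exact: sub_Ck (sf n). Qed.

Lemma mCinf_grad n (U : set 'rV[R]_n) (f : 'rV[R]_n -> R) : Cinf U f -> mCinf U (grad f).
Proof.
move=> sf k l n'; under eq_fun do rewrite mxE; exact: (Cinf_partial k sf).
Qed.

Lemma theta_off y : off_chart a b i y ->
  th y = - (Theta (zb y))^-1 *: (Jmx R (m + 1) *m grad zb y).
Proof.
move=> yo; have [_ E' _ _ _] := ansatz_off yo; have [Tp' _] := Theta_off yo.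
by rewrite scaleNr -scalerN E' scalerA mulVf ?scale1r // gt_eqF.
Qed.

(** Smoothness is read from theta = - J dz / Theta(z), whose right side is built from the smooth
    function z, and not from the fibre coordinate and the Hermitian metric. *)
Lemma theta_Cinf : mCinf (off_chart a b i) th.
Proof.
have oU : open (off_chart a b i) by exact: open_off_chart.
have szo := sub_Cinf off_cdom z_Cinf.
have sV : Cinf (off_chart a b i) (fun y => - (Theta (zb y))^-1).
  move=> n; apply: CkN => //; apply: CkV => //.
    by move=> y /Theta_off[]; rewrite lt0r => /andP[].
  by apply: (Ck_comp1 oU (fun y yo => (Theta_off yo).2) (sT n) (szo n)).
have sJ : mCinf (off_chart a b i) (fun y => Jmx R (m + 1) *m grad zb y).
  by apply: mCinfM => //; [exact: mCinf_cst|exact: mCinf_grad].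
move=> k l n; apply: (eq_Ck oU _ (mCinfZ oU sV sJ k l n)) => y; rewrite inE => /theta_off ->.
by [].
Qed.
End OffChart.
End AnsatzOff.

(** * Deformation inside the Kaehler class *)

Lemma square_form_ge0 (R : realType) n (v : 'rV[R]_n) (t : 'cV[R]_n) :
  0 <= (v *m (t *m t^T) *m v^T) 0 0.
Proof.
rewrite mulmxA -mulmxA -trmx_mul; move: (v *m t) => u.
by rewrite mxE big_ord1 [u^T _ _]mxE -expr2 sqr_ge0.
Qed.

Section Deformation.
Context (R : realType) (m : nat) (S : cmanifold R m) (gS : tensor2 S).
Context (E : line_bundle S) (M : proj_bundle E).
Context (x : R) (g0 : tensor2 M) (H : frame E -> S -> R) (Th0 : R -> R) (z0 : M -> R).
Hypotheses (x_gt0 : 0 < x) (x_lt1 : x < 1) (kg0 : kahler g0) (kS : kahler gS)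
  (sz0 : smooth_fun_on setT z0)
  (z0I : forall q, -1 <= z0 q <= 1) (T01 : Th0 (-1) = 0 /\ Th0 1 = 0)
  (T0p : forall t, -1 < t < 1 -> 0 < Th0 t) (sT0 : Cinf (@Iop R) Th0)
  (ans : calabi_ansatz gS x g0 H Th0 z0).
Context (d : R) (psi chi Th : R -> R).
Hypotheses (d0 : 0 < d) (spsi : Cinf (J d) psi) (schi : Cinf (J d) chi)
  (psiI : forall t, -1 <= t <= 1 -> -1 <= psi t <= 1)
  (pc : forall t, J d t -> [/\ 0 < 'D_1 psi t, 'D_1 psi t * Th0 t = Th (psi t)
        & chi t * Th0 t = psi t - t]).
Implicit Types (a : chart S) (b : chart M) (i : frame E).
Local Notation Jm := (Jmx R (m + 1)).

Definition new_z q := psi (z0 q).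
(** Chosen so that the horizontal part psi' (1 + x z0) / x of psi' g0 is corrected to (1 + x psi) /
    x. *)
Definition new_weight t := ((1 + x * psi t) - 'D_1 psi t * (1 + x * t)) / x.
Definition new_metric : tensor2 M := fun b y =>
  'D_1 psi (z0 (param b y)) *: g0 b y + new_weight (z0 (param b y)) *: piS gS b y.
(** Off the sections this is (psi(z0) - z0) theta, because - J dz0 = Theta0(z0) theta; in the
    present form it is smooth everywhere. *)
Definition new_potential : form1 M := fun b y =>
  chi (z0 (param b y)) *: - (Jm *m grad (z0 \o param b) y).

Let zJ q : J d (z0 q).
Proof. exact: J_cc. Qed.

Let sS : smooth_tensor2 gS.
Proof. by case: kS. Qed.

Let xn : x != 0.
Proof. by rewrite gt_eqF. Qed.

Let sz b : Cinf (@cdom _ _ M b) (z0 \o param b).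
Proof. exact: (z_Cinf sz0 b). Qed.

Lemma comp_z_Cinf f b : Cinf (J d) f -> Cinf (@cdom _ _ M b) (fun y => f (z0 (param b y))).
Proof.
move=> sf n.
exact: (@Ck_comp1 _ _ n _ (J d) f (z0 \o param b) (open_cdom (a := b)) (fun y _ => zJ (param b y))
  (sf n) (sz b n)).
Qed.

Lemma new_weight_Cinf : Cinf (J d) new_weight.
Proof.
have oJ : open (J d) by exact: open_J.
have sid k : Ck k (J d) (fun t : R => t) by exact: Ck_id.
have aff h : Cinf (J d) h -> Cinf (J d) (fun t => 1 + x * h t).
  move=> sh k; apply: CkD => //; first exact: Ck_cst.
  by apply: CkM => //; exact: Ck_cst.
move=> k; apply: CkM => //; last exact: Ck_cst.
apply: CkB => //; first exact: aff.
by apply: CkM => //; [exact: Cinf_D1|exact: (aff _ sid)].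
Qed.

Lemma new_z_smooth : smooth_fun_on setT new_z.
Proof. by apply/smooth_funTP => b; exact: (comp_z_Cinf b spsi). Qed.

Lemma grad_new_z b y : cdom b y ->
  grad (new_z \o param b) y = 'D_1 psi (z0 (param b y)) *: grad (z0 \o param b) y.
Proof.
move=> by_; apply/colP => k; rewrite !mxE.
rewrite -[new_z \o _]/(psi \o (z0 \o param b)) /partial derive_comp1 //.
  exact: (Ck_diff (sz b 0%N) by_).
exact: (Ck_diff (spsi 0%N) (zJ _)).
Qed.

Lemma new_metric_Cinf b : mCinf (@cdom _ _ M b) (new_metric b).
Proof.
have [sg _ _ _ _] := kg0.
apply: mCinfD; first exact: open_cdom.
  apply: mCinfZ; [exact: open_cdom| |exact: smooth_tensor2_Cinf].
  exact: (comp_z_Cinf b (Cinf_D1 spsi)).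
apply: mCinfZ; [exact: open_cdom|exact: (comp_z_Cinf b new_weight_Cinf)|].
exact/smooth_tensor2_Cinf/piS_smooth.
Qed.

Lemma new_metric_smooth : smooth_tensor2 new_metric.
Proof.
have [[_ tg] _ _ _ _] := kg0; have [_ tp] := @piS_smooth _ _ _ _ M _ sS.
split=> [b k l|b b' q bq bq'].
  by apply/smooth_onP; [exact: open_cdom|exact: new_metric_Cinf].
rewrite /new_metric !paramK // (tg b b') // (tp b b') //.
by rewrite mulmxDr mulmxDl -!scalemxAr -!scalemxAl.
Qed.

Lemma piS_sym b y : cdom b y -> (piS gS b y)^T = piS gS b y.
Proof.
move=> by_; rewrite /piS pullback2_tr !pullback2E; have [_ gs _ _ _] := kS.
by rewrite gs //; apply: base_map_cdom; exact: base_chartP.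
Qed.

Lemma piS_J b y : cdom b y -> Jm *m piS gS b y *m Jm^T = piS gS b y.
Proof.
move=> by_; rewrite /piS !pullback2E !mulmxA base_map_J //; last exact: base_chartP.
rewrite -!mulmxA -trmx_mul base_map_J //; last exact: base_chartP.
have [_ _ _ gJ _] := kS; rewrite trmx_mul !mulmxA; congr (_ *m _).
rewrite -!mulmxA; congr (_ *m _); rewrite !mulmxA gJ //.
by apply: base_map_cdom; exact: base_chartP.
Qed.

Lemma new_metric_sym b y : cdom b y -> (new_metric b y)^T = new_metric b y.
Proof.
move=> by_; have [_ gs _ _ _] := kg0.
by rewrite /new_metric linearD /= !linearZ /= gs // piS_sym.
Qed.

Lemma new_metric_J b y : cdom b y -> Jm *m new_metric b y *m Jm^T = new_metric b y.
Proof.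
move=> by_; have [_ _ _ gJ _] := kg0.
by rewrite /new_metric mulmxDr mulmxDl -!scalemxAr -!scalemxAl gJ // piS_J.
Qed.

Lemma piS_ge0 b y (v : 'rV[R]_((m + 1) + (m + 1))) : cdom b y ->
  0 <= (v *m piS gS b y *m v^T) 0 0.
Proof.
move=> by_; have ao := @base_chartP _ _ _ _ M b y.
rewrite /piS pullback2E !mulmxA -mulmxA -trmx_mul; set u := v *m _.
have [-> |u0] := eqVneq u 0; first by rewrite !mul0mx mxE.
have [_ _ gp _ _] := kS; apply/ltW/gp => //; exact: base_map_cdom.
Qed.

(* Off the sections the difference is the positive semidefinite fibre part of
   the metric. *)
Lemma fibre_part_ge0 b y (v : 'rV[R]_((m + 1) + (m + 1))) : cdom b y ->
  0 <= (v *m g0 b y *m v^T) 0 0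
       - (1 + x * z0 (param b y)) / x * (v *m piS gS b y *m v^T) 0 0.
Proof.
move=> by_.
pose h y := (v *m g0 b y *m v^T) 0 0
       - (1 + x * z0 (param b y)) / x * (v *m piS gS b y *m v^T) 0 0.
have Ch : Ck 0 (@cdom _ _ M b) h.
  have ocd : open (@cdom _ _ M b) by exact: open_cdom.
  have [sg _ _ _ _] := kg0.
  have quad T : mCinf (@cdom _ _ M b) T ->
      Cinf (@cdom _ _ M b) (fun y => (v *m T y *m v^T) 0 0).
    move=> sT; apply: (mCinfM (F := fun y => v *m T y) (H := fun=> v^T)) => //.
      by apply: mCinfM => //; exact: mCinf_cst.
    exact: mCinf_cst.
  apply: (CkB ocd); first exact/quad/smooth_tensor2_Cinf.
  apply: (CkM ocd); last exact/quad/smooth_tensor2_Cinf/piS_smooth.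
  apply: (CkM ocd); last exact: Ck_cst.
  apply: (CkD ocd); first exact: Ck_cst.
  by apply: (CkM ocd); [exact: Ck_cst|exact: sz].
apply: (@dense_closed _ _ _ _ M b h [set t | 0 <= t] y (@closed_ge R 0)) => //.
- by apply: differentiable_continuous; exact: Ck_diff Ch by_.
move=> a i y' yo; have [by' [ay' _] _] := off_chartP yo.
have [_ _ gE _ _] := ansatz_off ans yo.
have [Tp _] := Theta_off kg0 z0I T01 T0p ans yo.
rewrite /h /= gE; move: (theta_form H b i y') => th; rewrite (piSE sS by' ay') !mulmxDr !mulmxDl -!scalemxAr -!scalemxAl.
rewrite ![(_ + _ : 'M[R]_1) 0 0]mxE ![(_ *: _ : 'M[R]_1) 0 0]mxE.
rewrite -addrA [X in X - _]addrC addrK addr_ge0 //.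
  by apply: mulr_ge0; [rewrite invr_ge0 ltW|exact: square_form_ge0].
by apply: mulr_ge0; [exact: ltW|exact: square_form_ge0].
Qed.

Lemma new_metric_pos b y (v : 'rV[R]_((m + 1) + (m + 1))) : cdom b y -> v != 0 ->
  0 < (v *m new_metric b y *m v^T) 0 0.
Proof.
move=> by_ v0; have fp := fibre_part_ge0 v by_; have pp := piS_ge0 v by_.
have [_ _ gp _ _] := kg0; have := gp b y v by_ v0.
rewrite /new_metric !mulmxDr !mulmxDl -!scalemxAr -!scalemxAl.
rewrite ![(_ + _ : 'M[R]_1) 0 0]mxE ![(_ *: _ : 'M[R]_1) 0 0]mxE.
move: fp pp; set G := (v *m g0 b y *m v^T) 0 0; set Q := (v *m piS gS b y *m v^T) 0 0.
set t := z0 (param b y) => fp pp G0; have [p0 _ _] := pc (zJ (param b y)); rewrite -/t in p0.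
(* The fibre part of g0 rescaled by psi', plus the new horizontal part. Both are nonnegative; when
   the horizontal part vanishes the first is psi' times the positive g0-norm. *)
have -> : 'D_1 psi t * G + new_weight t * Q =
  'D_1 psi t * (G - (1 + x * t) / x * Q) + (1 + x * psi t) / x * Q.
  by rewrite /new_weight; field.
have w0 : 0 < (1 + x * psi t) / x.
  rewrite divr_gt0 //; apply: affine_gt0; [by rewrite addr_gt0|by rewrite subr_gt0|exact: psiI (z0I _)].
have [Q0|Q0] := eqVneq Q 0.
  by rewrite Q0 !mulr0 subr0 addr0 mulr_gt0.
by rewrite ltr_wpDl // ?mulr_ge0 // ?ltW // mulr_gt0 // lt0r Q0.
Qed.

Section OffSections.
Context (a : chart S) (b : chart M) (i : frame E) (y : 'rV[R]_((m + 1) + (m + 1))).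
Hypothesis yo : off_chart a b i y.
Let th := @theta_form _ _ _ _ M H b i.

Lemma new_Theta : Th (new_z (param b y)) != 0 /\
  Th (new_z (param b y)) = 'D_1 psi (z0 (param b y)) * Th0 (z0 (param b y)).
Proof.
have [Tp _] := Theta_off kg0 z0I T01 T0p ans yo.
have [p0 <- _] := pc (zJ (param b y)); split=> //.
by rewrite mulf_neq0 ?gt_eqF.
Qed.

Lemma new_metric_off : new_metric b y = (1 + x * new_z (param b y)) / x *: pullback2 a b gS y
  + (Th (new_z (param b y)))^-1 *: (grad (new_z \o param b) y *m (grad (new_z \o param b) y)^T)
  + Th (new_z (param b y)) *: (th y *m (th y)^T).
Proof.
have [by_ [ay _] _] := off_chartP yo; have [_ ->] := new_Theta.
have [_ _ gE _ _] := ansatz_off ans yo; have [Tp _] := Theta_off kg0 z0I T01 T0p ans yo.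
have [p0 _ _] := pc (zJ (param b y)).
rewrite /new_metric gE (piSE sS by_ ay) grad_new_z //= -/th linearZ /= -scalemxAr -scalemxAl.
rewrite /new_z /new_weight /=; move: p0 Tp; rewrite /=.
move: ('D_1 psi _) => p; move: (psi _) => s; move: (Th0 _) => T; move: (z0 _) => t p0 T0.
rewrite !scalerDr !scalerA addrAC (addrAC (_ *: _)) -scalerDl -!addrA; congr (_ *: _ + _).
  by field.
congr (_ *: _ + _ *: _); by field; rewrite !gt_eqF.
Qed.

Lemma kform_new_metric : kform new_metric b y =
  'D_1 psi (z0 (param b y)) *: kform g0 b y
  + new_weight (z0 (param b y)) *: pullback2 a b (kform gS) y.
Proof.
have [by_ [ay _] _] := off_chartP yo.
by rewrite /kform /new_metric mulmxDr -!scalemxAr (piSE sS by_ ay) pullback2_J.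
Qed.

Lemma kform_new_off : kform new_metric b y =
  (1 + x * new_z (param b y)) / x *: pullback2 a b (kform gS) y
  + (grad (new_z \o param b) y *m (th y)^T - th y *m (grad (new_z \o param b) y)^T).
Proof.
have [by_ [ay _] _] := off_chartP yo; have [_ _ _ gE _] := ansatz_off ans yo.
rewrite kform_new_metric gE grad_new_z //= -/th linearZ /= -scalemxAr -scalemxAl -scalerBr.
rewrite /new_z /new_weight /=.
move: ('D_1 psi _) => p; move: (psi _) => s; move: (z0 _) => t.
rewrite scalerDr !scalerA addrAC -scalerDl; congr (_ *: _ + _); by field.
Qed.

Lemma new_exact_off :
  extd (new_potential b) y = kform new_metric b y - kform g0 b y.
Proof.
have [by_ [ay _] _] := off_chartP yo; have [dth _ _ gE _] := ansatz_off ans yo.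
have oU : open (off_chart a b i) by exact: open_off_chart.
have sub : off_chart a b i `<=` @cdom _ _ M b by move=> y' /off_chartP[].
pose h y := psi (z0 (param b y)) - z0 (param b y).
have sh : Cinf (@cdom _ _ M b) h.
  by move=> n; apply: (CkB (open_cdom (a := b))); [exact: comp_z_Cinf|exact: sz].
have dh := Ck_diff (sh 0%N) by_.
have sth : mCinf (off_chart a b i) th.
  exact: (theta_Cinf kg0 sz0 z0I T01 T0p sT0 ans).
rewrite (@extd_scale _ _ (off_chart a b i) h th _ y oU yo dh (mCinf_diff sth yo)); last first.
  move=> y' yo'; have [_ E' _ _ _] := ansatz_off ans yo'.
  have [_ _ c'] := pc (zJ (param b y')).
  by rewrite /new_potential E' scalerA /h -c'.
have gh : grad h y = ('D_1 psi (z0 (param b y)) - 1) *: grad (z0 \o param b) y.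
  have dz := Ck_diff (sz b 0%N) by_.
  have dp : differentiable (fun y => psi (z0 (param b y))) y.
    exact: (Ck_diff (comp_z_Cinf b spsi 0%N) by_).
  have := grad_new_z by_; rewrite scalerBl scale1r => <-.
  by apply/colP => k; rewrite !mxE /h partialD ?partialN //; exact: differentiableN.
rewrite [kform new_metric b y]kform_new_off [kform g0 b y]gE grad_new_z // gh dth -/th /h /new_z /=.
rewrite !linearZ /= -!scalemxAl.
move: ('D_1 psi _) => p; move: (psi _) => s; move: (z0 _) => t.
rewrite opprD addrACA -scalerBl -!scalerDr (scalerBl p 1) scale1r; congr (_ *: _ + _).
by field.
Qed.
End OffSections.

Lemma new_potential_smooth : smooth_form1 new_potential.
Proof.
split=> [b k|b b' q bq bq'].
  apply/smooth_onP; first exact: open_cdom.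
  have H1 : mCinf (@cdom _ _ M b) (new_potential b).
    apply: mCinfZ; [exact: open_cdom|exact: comp_z_Cinf|].
    apply: mCinfN; first exact: open_cdom.
    by apply: mCinfM; [exact: open_cdom|exact: mCinf_cst|exact/mCinf_grad/sz].
  exact: H1.
rewrite /new_potential !paramK //.
rewrite (grad_transition bq bq'); last exact: (Ck_diff (sz b' 0%N) (cdom_coord bq')).
by rewrite mulmxA transition_J // -scalemxAr mulmxN !mulmxA.
Qed.

Lemma new_exact b y : cdom b y ->
  kform new_metric b y - kform g0 b y = extd (new_potential b) y.
Proof.
move=> by_; have [sg _ _ _ _] := kg0.
apply: (@dense_mx_eq _ _ _ _ M _ _ b (fun y => kform new_metric b y - kform g0 b y)
  (extd (new_potential b))) => //.
- apply: mCinfD; first exact: open_cdom.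
    exact/smooth_tensor2_Cinf/smooth_kform/new_metric_smooth.
  apply: mCinfN; first exact: open_cdom.
  exact/smooth_tensor2_Cinf/smooth_kform.
- move=> k l n; under eq_fun do rewrite mxE.
  have sb j : Cinf (@cdom _ _ M b) (fun y => new_potential b y j 0).
    by have [sp _] := new_potential_smooth; have /smooth_onP := sp b j; apply; exact: open_cdom.
  by apply: (CkB (open_cdom (a := b))); apply: Cinf_partial; exact: sb.
- by move=> a i y' /new_exact_off ->.
Qed.

Lemma new_closed : closed2form (kform new_metric).
Proof.
have [_ _ _ _ [_ _ cl0]] := kg0.
have sk := smooth_kform new_metric_smooth.
split=> // [b y by_|b].
  apply: kform_skew; [exact: Jmx_sqr|exact: tr_Jmx|exact: new_metric_sym|exact: new_metric_J].
have sb : mCinf (@cdom _ _ M b) (new_potential b).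
  move=> j l; rewrite (ord1 l); have [sp _] := new_potential_smooth.
  by have /smooth_onP := sp b j; apply; exact: open_cdom.
have clb := extd_closed (open_cdom (a := b)) sb.
move=> y i j k by_.
have E1 u v w : partial u (fun y => kform new_metric b y v w) y =
    partial u (fun y => kform g0 b y v w) y + partial u (fun y => extd (new_potential b) y v w) y.
  have [sg _ _ _ _] := kg0.
  have d1 : differentiable (fun y => kform g0 b y v w) y.
    exact: (Ck_diff (smooth_tensor2_Cinf b (smooth_kform sg) v w 0%N) by_).
  have d2 : differentiable (fun y => extd (new_potential b) y v w) y.
    under eq_fun do rewrite mxE.
    have pd e f := Ck_diff (Cinf_partial e (sb f 0) 0%N) by_.
    by apply: differentiableB; exact: pd.
  rewrite -(partialD u d1 d2); apply: (eq_partial _ (open_cdom (a := b)) _ by_) => y'.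
  rewrite inE => by'; have := new_exact by' => /matrixP/(_ v w).
  by rewrite ![(_ - _ : 'M[R]_ _) v w]mxE [(- _ : 'M[R]_ _) v w]mxE => <-; rewrite [RHS]addrC subrK.
rewrite !E1; have := congr2 +%R (cl0 b y i j k by_) (clb y i j k by_).
by rewrite addr0; apply: etrans; ring.
Qed.

Lemma new_kahler : kahler new_metric.
Proof.
split; [exact: new_metric_smooth|exact: new_metric_sym|exact: new_metric_pos|
  exact: new_metric_J|exact: new_closed].
Qed.

Lemma new_class : derham_class (kform g0) (kform new_metric).
Proof.
split; first exact: new_closed.
by exists new_potential; split; [exact: new_potential_smooth|exact: new_exact].
Qed.

Lemma new_ansatz : calabi_ansatz gS x new_metric H Th new_z.
Proof.
move=> a b i q bq aq iq nt nf.
have yo : off_chart a b i (coord b q) by exists q.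
have by_ := cdom_coord bq; have [dth Jdz _ gE KK] := ansatz_off ans yo.
have qE : param b (coord b q) = q by exact: paramK.
have := new_metric_off yo; have := kform_new_off yo; have := new_Theta yo; rewrite qE.
move=> [_ TE] kE nE; split=> //.
  by rewrite grad_new_z // qE -scalemxAr -scalerN Jdz scalerA TE /= qE.
move=> k Kk; have [kg kt] := KK k Kk; split=> //.
have skew : (kform g0 b (coord b q))^T = - kform g0 b (coord b q).
  by have [_ _ _ _ [_ H' _]] := kg0; exact: H'.
(* The generator preserves the momentum: its contraction with the old Kaehler form is - dz0, and a
   skew form vanishes on (k, k). *)
have kdz : k *m grad (z0 \o param b) (coord b q) = 0.
  move: kg skew; move: (kform g0 b (coord b q)) => W kg skew.
  have := congr1 (mulmx^~ k^T) kg; rewrite mulNmx -trmx_mul => E1.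
  have E2 : (k *m W *m k^T)^T = - (k *m W *m k^T).
    by rewrite !trmx_mul trmxK skew mulNmx mulmxN mulmxA.
  have dd : (k *m grad (z0 \o param b) (coord b q))^T = k *m grad (z0 \o param b) (coord b q).
    by apply/matrixP => u v; rewrite [LHS]mxE (ord1 u) (ord1 v).
  move: E2; rewrite E1 linearN /= trmxK dd opprK => /eqP.
  by rewrite eq_sym -subr_eq0 opprK -mulr2n -scaler_nat scaler_eq0 pnatr_eq0 /= => /eqP.
have kP : k *m jacobian (base_map a b) (coord b q) = 0 by case: Kk.
rewrite kE mulmxDr -scalemxAr pullback2E !mulmxA kP !mul0mx scaler0 add0r.
rewrite mulmxBr !mulmxA kt mul1mx grad_new_z // -scalemxAr kdz scaler0 mul0mx sub0r.
by [].
Qed.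
End Deformation.

(** * The Einstein-Maxwell metric *)

Section EinsteinMaxwell.
Context (R : realType) (m : nat) (S : cmanifold R m) (gS : tensor2 S).
Context (E : line_bundle S) (M : proj_bundle E).
Context (x : R) (g : tensor2 M) (H : frame E -> S -> R) (Theta : R -> R) (z : M -> R).
Hypotheses (x01 : 0 < x < 1) (kg : kahler g) (kS : kahler gS)
  (sz : smooth_fun_on setT z)
  (zI : forall q, -1 <= z q <= 1) (T1 : Theta (-1) = 0 /\ Theta 1 = 0)
  (Tp : forall t, -1 < t < 1 -> 0 < Theta t) (sT : Cinf (@Iop R) Theta)
  (ans : calabi_ansatz gS x g H Theta z).
Context (r : R).
Hypothesis r1 : -1 < r < 1.
Implicit Types (a : chart S) (b : chart M) (i : frame E).

Definition em_potential (q : M) := 1 + r * z q.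

Lemma em_potential_gt0 q : 0 < em_potential q.
Proof.
case/andP: r1 => r0 r2; apply: affine_gt0; last exact: zI.
  by rewrite -ltrBlDl sub0r.
by rewrite subr_gt0.
Qed.

Let szb b : Cinf (@cdom _ _ M b) (z \o param b).
Proof. exact: (z_Cinf sz b). Qed.

Lemma em_potential_Cinf b : Cinf (@cdom _ _ M b) (em_potential \o param b).
Proof.
move=> n; apply: (CkD (open_cdom (a := b))); first exact: Ck_cst.
by apply: (CkM (open_cdom (a := b))); [exact: Ck_cst|exact: szb].
Qed.

Lemma grad_em_potential b y : cdom b y ->
  grad (em_potential \o param b) y = r *: grad (z \o param b) y.
Proof.
move=> by_; have dz := Ck_diff (szb b 0%N) by_.
apply/colP => k; rewrite !mxE.
rewrite (@partialD _ _ (cst 1) (fun y => cst r y * (z \o param b) y)) //; last exact: differentiableM.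
by rewrite partialM // /partial !derive_cst mul0r !add0r.
Qed.

Lemma metric_Cinf b : mCinf (@cdom _ _ M b) (g b).
Proof. by have [sg _ _ _ _] := kg; exact: smooth_tensor2_Cinf. Qed.

Lemma Jgrad_Cinf b : mCinf (@cdom _ _ M b) (Jgrad g em_potential b).
Proof.
have ocd : open (@cdom _ _ M b) by exact: open_cdom.
have sgr : mCinf (@cdom _ _ M b) (grad (em_potential \o param b)).
  exact/mCinf_grad/em_potential_Cinf.
apply: mCinfM => //; last exact: mCinf_cst.
apply: mCinfM => //; first exact: mCinf_tr.
apply: mCinf_inv => //; first by move=> y; exact: kahler_unit.
exact: metric_Cinf.
Qed.

Lemma dim_total : ((m + 1) + (m + 1) = (m + m) + 2)%N.
Proof. by rewrite addnACA. Qed.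

Section OffChart.
Context (a : chart S) (b : chart M) (i : frame E).
Let U := off_chart a b i.
Let th := @theta_form _ _ _ _ M H b i.

Let oU : open U.
Proof. exact: open_off_chart. Qed.
Let oW : open (@cdom _ _ S a).
Proof. exact: open_cdom. Qed.
Let FW y : U y -> @cdom _ _ S a (base_map a b y).
Proof. by move=> /off_chartP[_ [ay _] _]; exact: base_map_cdom. Qed.
Let zU y : U y -> Iop ((z \o param b) y).
Proof. by move=> yo; have [] := Theta_off kg zI T1 Tp ans yo. Qed.
Let sF j : Cinf U (fun y => base_map a b y 0 j).
Proof.
apply: sub_Cinf (base_map_Cinf a b j) => y /off_chartP[by_ [ay _] _].
by rewrite imageE.
Qed.
Let Ub : U `<=` @cdom _ _ M b.
Proof. by move=> y /off_chartP[]. Qed.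
Let sz' : Cinf U (z \o param b).
Proof. exact: sub_Cinf (szb b). Qed.
Let sth : mCinf U th.
Proof. exact: (theta_Cinf kg sz zI T1 Tp sT ans). Qed.
Let sg : mCinf (@cdom _ _ S a) (gS a).
Proof. by case: kS => sS _ _ _ _; exact: smooth_tensor2_Cinf. Qed.
Let gs u : @cdom _ _ S a u -> (gS a u)^T = gS a u.
Proof. by case: kS => _ H' _ _ _; exact: H'. Qed.
Let dth y : U y -> extd th y = jacobian (base_map a b) y *m (Jmx R m *m gS a (base_map a b y))
  *m (jacobian (base_map a b) y)^T.
Proof. by move=> yo; have [-> _ _ _ _] := ansatz_off ans yo; rewrite pullback2E. Qed.

Lemma killing_off y : U y -> killing_at (g b) (Jgrad g em_potential b) y.
Proof.
move=> Uy; pose al t := (1 + x * t) / x.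
have sal : Cinf (@Iop R) al.
  move=> n; have oI := @open_Iop R; apply: CkM => //; last exact: Ck_cst.
  by apply: CkD => //; [exact: Ck_cst|apply: CkM => //; [exact: Ck_cst|exact: Ck_id]].
have sbe : Cinf (@Iop R) (fun t => (Theta t)^-1).
  by move=> n; apply: (CkV (@open_Iop R)) => // t It; rewrite gt_eqF ?Tp.
(* J grad f is r times the generator of the circle action, because df = r dz and z is its
   momentum. *)
have ham y' : U y' -> [/\ Jgrad g em_potential b y' *m jacobian (base_map a b) y' = 0,
    Jgrad g em_potential b y' *m grad (z \o param b) y' = 0 &
    Jgrad g em_potential b y' *m th y' = r%:M].
  move=> yo; have by' := Ub yo; have [_ Jd gE _ _] := ansatz_off ans yo.
  have [T0 _] := Theta_off kg zI T1 Tp ans yo.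
  have -> : Jgrad g em_potential b y' =
      r *: ((grad (z \o param b) y')^T *m invmx (g b y') *m Jmx R (m + 1)).
    by rewrite /Jgrad grad_em_potential // linearZ /= -!scalemxAl.
  apply: (hamiltonian_field (g := (1 + x * (z \o param b) y') / x *: gS a (base_map a b y')) r
    dim_total _ (Jmx_sqr R (m + 1)) _ _ _ Jd).
  - by rewrite gt_eqF.
  - by rewrite gE pullback2E -scalemxAr -scalemxAl.
  - exact: kahler_unit.
  - by have [_ _ _ gJ _] := kg; exact: gJ.
apply: (calabi_killing oU FW zU sF sz' sth sg gs dth sal sbe sT _ _ _ _ _ Uy (r := r)).
- by move=> y' yo; have [_ _ -> _ _] := ansatz_off ans yo; rewrite pullback2E.
- by move=> k l; apply: sub_Cinf (Jgrad_Cinf b k l).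
- by move=> y' /ham[].
- by move=> y' /ham[].
- by move=> y' /ham[].
Qed.

Context (c cS : R) (P P1 P2 : R -> R).
Hypotheses (m4 : (m + m = 4)%N)
  (TE : forall t, -1 <= t <= 1 -> Theta t = P t / (1 + x * t) ^+ 2)
  (dP : forall t, is_derive t (1 : R) P (P1 t) /\ is_derive t (1 : R) P1 (P2 t))
  (ode : forall t, (1 + r * t) ^+ 2 * P2 t - 10 * r * (1 + r * t) * P1 t + 30 * r ^+ 2 * P t
      = (1 + r * t) ^+ 2 * (x * cS) * (1 + x * t) - c * (1 + x * t) ^+ 2)
  (cg : const_scal gS cS).

Definition em_metric : tensor2 M := fun b y => (em_potential (param b y)) ^- 2 *: g b y.

Lemma em_metric_unit b' y : cdom b' y -> em_metric b' y \in unitmx.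
Proof.
move=> by_; rewrite unitmxZ; first exact: kahler_unit.
by rewrite unitfE invr_eq0 expf_neq0 // gt_eqF // em_potential_gt0.
Qed.

Lemma scal_off y : U y -> scal (em_metric b) y = c.
Proof.
move=> Uy; have x0 : 0 < x by case/andP: x01.
have vp t : Iop t -> 0 < 1 + x * t by exact: v_gt0.
have TE' t : Iop t -> P t = Theta t * (1 + x * t) ^+ 2.
  move=> It; have ? := vp t It; case/andP: It => t1 t2.
  by rewrite TE ?ltW // mulfVK // gt_eqF // exprn_gt0.
(* The hypotheses on P give two derivatives only; smoothness is inherited from Theta through P =
   Theta (1 + x t)^2. *)
have sP : Cinf (@Iop R) P.
  move=> n; have oI := @open_Iop R.
  have sQ : Ck n (@Iop R) (fun t => Theta t * (1 + x * t) ^+ 2).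
    apply: CkM => //; apply: CkX => //; apply: CkD => //; first exact: Ck_cst.
    by apply: CkM => //; [exact: Ck_cst|exact: Ck_id].
  by apply: (eq_Ck oI _ sQ) => t; rewrite inE => /TE'.
have P0 t : Iop t -> 0 < P t.
  by move=> It; rewrite TE' // mulr_gt0 ?exprn_gt0 ?vp // Tp.
apply: (einstein_maxwell_scal dim_total m4 oU oW FW zU sF sz' sth gs _ sg _ (Jmx_sqr R m)
  (trace_Jmx R m) dth x01 r1 sP P0 dP ode _ _ _ Uy).
- by move=> u; exact: kahler_unit.
- move=> u au; apply: kform_skew; [exact: Jmx_sqr|exact: tr_Jmx|exact: gs|].
  by have [_ _ _ gJ _] := kS; exact: gJ.
- by move=> u; exact: cg.
- move=> y' yo; have [_ _ gE _ _] := ansatz_off ans yo.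
  have It := zU yo; have vn : 1 + x * (z \o param b) y' != 0 by rewrite gt_eqF ?vp.
  have fn : 1 + r * (z \o param b) y' != 0 by rewrite gt_eqF //; exact: em_potential_gt0.
  have Pn : P ((z \o param b) y') != 0 by rewrite gt_eqF ?P0.
  rewrite /em_metric gE TE; last by case/andP: It => t1 t2; rewrite !ltW.
  rewrite pullback2E -/th /em_potential !scalerDr !scalerA /w_al /w_be /w_ga /=.
  have xn : x != 0 by rewrite gt_eqF.
  move: vn fn Pn; rewrite /=; move: (P _) => p; move: (z _) => t vn fn pn.
  by congr (_ *: _ + _ *: _ + _ *: _); field; rewrite ?fn ?vn ?pn ?xn.
- by move=> y' yo; apply: em_metric_unit; exact: Ub.
Qed.
End OffChart.

Lemma em_killing : killing_potential g em_potential.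
Proof.
split=> [|b y by_ k l]; first by apply/smooth_funTP => b; exact: em_potential_Cinf.
pose h y := \sum_j (Jgrad g em_potential b y 0 j * partial j (fun y => g b y k l) y
  + partial k (fun y => Jgrad g em_potential b y 0 j) y * g b y j l
  + partial l (fun y => Jgrad g em_potential b y 0 j) y * g b y k j).
have ocd : open (@cdom _ _ M b) by exact: open_cdom.
have sX := Jgrad_Cinf b; have sG := metric_Cinf b.
have sh : Ck 0 (@cdom _ _ M b) h.
  apply: Ck_sum => // j _; apply: CkD => //; first apply: CkD => //.
  - apply: CkM => //; first exact: sX.
    exact: (Cinf_partial j (sG k l)).
  - apply: CkM => //; last exact: sG.
    exact: (Cinf_partial k (sX 0 j)).
  - apply: CkM => //; last exact: sG.
    exact: (Cinf_partial l (sX 0 j)).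
apply: (@dense_eq _ _ _ _ M b h 0 y by_).
  by apply: differentiable_continuous; exact: Ck_diff sh by_.
by move=> a i y' yo; exact: (killing_off yo).
Qed.

Lemma em_const_scal (c cS : R) (P P1 P2 : R -> R) : (m + m = 4)%N ->
  (forall t, -1 <= t <= 1 -> Theta t = P t / (1 + x * t) ^+ 2) ->
  (forall t, is_derive t (1 : R) P (P1 t) /\ is_derive t (1 : R) P1 (P2 t)) ->
  (forall t, (1 + r * t) ^+ 2 * P2 t - 10 * r * (1 + r * t) * P1 t + 30 * r ^+ 2 * P t
      = (1 + r * t) ^+ 2 * (x * cS) * (1 + x * t) - c * (1 + x * t) ^+ 2) ->
  const_scal gS cS -> const_scal em_metric c.
Proof.
move=> m4 TE dP ode cg b y by_.
have ocd : open (@cdom _ _ M b) by exact: open_cdom.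
apply: (@dense_eq _ _ _ _ M b (scal (em_metric b)) c y by_); last first.
  by move=> a i y' yo; exact: (scal_off m4 TE dP ode cg yo).
apply: differentiable_continuous.
have sG : mCinf (@cdom _ _ M b) (em_metric b).
  apply: mCinfZ => //; last exact: metric_Cinf.
  move=> n; apply: (CkV ocd); last by apply: (CkX _ ocd); exact: em_potential_Cinf.
  by move=> y' _; rewrite expf_neq0 // gt_eqF // em_potential_gt0.
apply: (Ck_diff (n := 0)) by_; apply: (Cinf_scal ocd) => // y'; exact: em_metric_unit.
Qed.
End EinsteinMaxwell.

Lemma momentum_profile_on (R : realType) (d : R) (Theta : R -> R) :
  momentum_profile Theta -> Cinf setT Theta /\ profile_on d Theta.
Proof.
move=> [sT Tp T1 dT].
have sT' : Cinf setT Theta by apply/(Cinf_derive1n _ openT) => k t _; exact: sT.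
split=> //; split=> //; first exact: sub_Cinf sT'.
by rewrite -!derive1E.
Qed.

Theorem proposition4p4 (R : realType) (S : cmanifold R 2) (gS : tensor2 S)
    (E : line_bundle S) (M : proj_bundle E) :
  compact [set: S] ->
  kahler gS ->
  (exists2 c : R, 0 <= c & const_scal gS c) ->
  first_chern_class_is E (fun a y => (2 * pi)^-1 *: kform gS a y) ->
  forall (x : R) (Omega : set (tensor2 M)),
    0 < x < 1 -> admissible_class gS x Omega ->
    exists g : tensor2 M,
      [/\ admissible gS x g, Omega (kform g) &
          conformally_Einstein_Maxwell g].
Proof.
move=> _ kS [cS cS0 cg] _ x Omega x01 [g0 [[kg0 [H [Th0 [z0 [hH p0 sz0 z0I ans]]]]] ->]].
have /andP[x0 x1] := x01.
(* The parameter [sg] of the profile is x times the scalar curvature of the base, and this is where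
   that curvature must be nonnegative. *)
have [r [c [P [P1 [P2 [Th [r1 pT dP TE ode]]]]]]] := em_profile x01 (mulr_ge0 (ltW x0) cS0).
have [sT0 p0'] := momentum_profile_on 1 p0; have [sT pT'] := momentum_profile_on 1 pT.
have [d [psi [chi [/andP[d0 _] spsi schi psiI pc]]]] := profile_change ltr01 p0' pT'.
have [_ T0p T01 _] := p0; have [_ Tp T1 _] := pT.
have sub f : Cinf setT f -> Cinf (@Iop R) f by apply: sub_Cinf.
have ans0 : calabi_ansatz gS x g0 H Th0 z0 by [].
have kn := new_kahler x0 x1 kg0 kS sz0 z0I T01 T0p (sub _ sT0) ans0 d0 spsi schi psiI pc.
have an := new_ansatz x0 kg0 kS sz0 z0I T01 T0p ans0 d0 spsi pc.
have szn : smooth_fun_on setT (new_z z0 psi) := new_z_smooth sz0 z0I d0 spsi.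
have znI q : -1 <= new_z z0 psi q <= 1 by exact: psiI.
exists (new_metric gS x g0 z0 psi); split.
- by split=> //; exists H, Th, (new_z z0 psi).
- exact: (new_class x0 kg0 kS sz0 z0I T01 T0p (sub _ sT0) ans0 d0 spsi schi pc).
exists (em_potential (new_z z0 psi) r); split.
- exact: (em_killing kn kS szn znI T1 Tp (sub _ sT) an).
- by move=> q; exact: em_potential_gt0.
- exists c; exact: (em_const_scal x01 kn kS szn znI T1 Tp (sub _ sT) an r1 erefl TE dP ode cg).
Qed.
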